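(* Let $v\in C^\infty(\mathbb T,\mathbb R)$ and $j\in\mathbb Z\setminus\{0\}$ with Fourier coefficient $v_j\ne0$. Then $V(t,x):=\cos(jt)\,v(x)$ is a transporter for the half-wave equation $\mathrm i\partial_t\psi=|D|\psi+V(t,x)\psi$, $x\in\mathbb T$: for every $r>0$ there exist a solution $\psi(t)\in H^r(\mathbb T)$ and constants $C,T>0$ with $\|\psi(t)\|_{H^r}\ge C\langle t\rangle^r$ for all $t>T$.
   Context: $\mathbb T=\mathbb R/2\pi\mathbb Z$; $\psi_j=\frac1{2\pi}\int_{\mathbb T}\psi(x)e^{-\mathrm ijx}dx$; $|D|\psi=\sum_j|j|\psi_je^{\mathrm ijx}$. The Sobolev norm is $\|\psi\|_{H^r}=\|(|D|+1)^r\psi\|_{L^2}$. A potential is a transporter if for every $r>0$ some solution in $H^r$ has unbounded $H^r$-norm as $t\to\infty$. $\langle t\rangle=\sqrt{1+t^2}$. *)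

(* Defs.v *)
From Stdlib Require Import Reals ZArith.
From Coquelicot Require Import Coquelicot.
Open Scope R_scope.

Definition fourier (f : R -> R) (n : Z) : C :=
  (RInt (fun x => f x * cos (IZR n * x)) 0 (2 * PI) / (2 * PI),
   - (RInt (fun x => f x * sin (IZR n * x)) 0 (2 * PI) / (2 * PI))).

Definition smooth_periodic (v : R -> R) : Prop :=
  (forall (n : nat) (x : R), ex_derive_n v n x) /\
  (forall x : R, v (x + 2 * PI) = v x).

Definition zsum_is (a : Z -> C) (l : C) : Prop :=
  exists l1 l2 : C,
    is_series (fun n : nat => a (Z.of_nat n)) l1 /\
    is_series (fun n : nat => a (- Z.of_nat (S n))%Z) l2 /\
    l = Cplus l1 l2.

(* Functions on T are represented by their Fourier coefficient sequences Z -> C. *)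
Definition Hweight (r : R) (k : Z) : R := Rpower (IZR (Z.abs k) + 1) r.

Definition Hterm (r : R) (f : Z -> C) (k : Z) : R := (Hweight r k * Cmod (f k)) ^ 2.

Definition in_Hr (r : R) (f : Z -> C) : Prop :=
  ex_series (fun n : nat => Hterm r f (Z.of_nat n)) /\
  ex_series (fun n : nat => Hterm r f (- Z.of_nat (S n))%Z).

(* ||f||_{H^r} = ||(|D|+1)^r f||_{L^2(T)}, with ||g||_{L^2}^2 = int_T |g|^2 = 2pi sum_k |g_k|^2 *)
Definition Hr_norm (r : R) (f : Z -> C) : R :=
  sqrt (2 * PI * (Series (fun n : nat => Hterm r f (Z.of_nat n)) +
                  Series (fun n : nat => Hterm r f (- Z.of_nat (S n))%Z))).

(* psi : R -> (Z -> C), psi t = Fourier coefficients of psi(t, .), is a solution in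
   C(R, H^r(T)) of  i d/dt psi = |D| psi + V(t,x) psi, written on the Fourier side:
   i d/dt psi_k = |k| psi_k + sum_m V(t)_{k-m} psi_m. *)
Definition half_wave_Hr_solution (V : R -> R -> R) (r : R) (psi : R -> Z -> C) : Prop :=
  (forall t : R, in_Hr r (psi t)) /\
  (forall t eps : R, 0 < eps -> exists delta : R, 0 < delta /\
      forall s : R, Rabs (s - t) < delta ->
        Hr_norm r (fun k => Cminus (psi s k) (psi t k)) < eps) /\
  (forall (t : R) (k : Z), exists d conv : C,
      is_derive (fun s => psi s k) t d /\
      zsum_is (fun m => Cmult (fourier (V t) (k - m)%Z) (psi t m)) conv /\
      Cmult Ci d = Cplus (Cmult (RtoC (IZR (Z.abs k))) (psi t k)) conv).

Definition jbracket (t : R) : R := sqrt (1 + t ^ 2).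

(* Main.v *)
Require Import Defs.
From Stdlib Require Import Reals ZArith Lra Lia Psatz.
From Coquelicot Require Import Coquelicot.
Open Scope R_scope.

(** Write [psi_k = e^{-i |k| t} u_k].  If [|D|] were [D = -i d/dx] the equation would be a
    transport equation, solved by the packet [phi(x - t) e^{i (N (x - t) - theta(t, x - t))}] with
    [theta(t, y) = int_0^t cos(j s) v(y + s) ds].  The resonance [v_j <> 0] makes
    [- theta_y = t drift(y) + O(1)] with [drift] a nonzero combination of [cos (j y)] and
    [sin (j y)], so for [phi] supported in [drift >= c0] the packet lives at frequencies of order
    [N + c0 t]: by non-stationary phase its coefficients of index at most [A / 2], where
    [A = N / 2 + c0 t], are [O(A^{-2})].

    Let [psi] be the exact solution with [psi(0) = e^{i N x}].  The two evolutions differ only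
    through the coupling, by the rapidly decaying [v_{k - m}], of frequencies [k] and [m] of opposite
    signs.  Hence the correlation of [psi] with the packet over nonnegative frequencies has
    derivative [O(A^{-2})], and for [N] large it stays bounded below for all [t >= 0].  By
    Cauchy-Schwarz a fixed amount of the L^2 mass of [psi] sits at frequencies above [c0 t / 2],
    whence the growth of every H^r norm. *)

(** * Weights and finite sums over the integers *)

(** The estimate must hold for all times with one fixed N, so the derivative of the correlation has
    to be integrable in time. This fixes the number of integrations by parts: a bound A^{-1} would
    integrate to a logarithm, while the integral of A^{-2} over t >= 0 is 2 / (c0 N). The initial
    correlation is the mean of phi, whatever N is, so a large N wins. The solution and the packet
    may well drift apart; only their correlation is followed, with L^2 bounds on both.

    Passing to u_k removes the unbounded |k| from the equation, and Picard iteration runs globally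
    in the norms sup_k (1 + |k|)^p |u_k|. A large p puts the solution in H^r, and the single-mode
    datum lies in all these spaces. The packet, built from a cut-off of limited smoothness, is only
    used through boundedness, Bessel's inequality and its smallness at low frequency. Each pairing
    therefore sets a bounded sequence against a decaying one, over a finite window whose truncation
    error vanishes at fixed t as the window grows. *)

Definition br (k : Z) : R := 1 + IZR (Z.abs k).

Lemma br_ge_1 k : 1 <= br k.
Proof. unfold br. assert (0 <= IZR (Z.abs k)) by (apply IZR_le; lia). lra. Qed.

Lemma br_pos k : 0 < br k.
Proof. pose proof (br_ge_1 k); lra. Qed.

Lemma br_pow_pos k n : 0 < br k ^ n.
Proof. apply pow_lt, br_pos. Qed.

Lemma br_pow_ge_1 k n : 1 <= br k ^ n.
Proof. apply pow_R1_Rle, br_ge_1. Qed.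

(** Peetre's inequality. It lets polynomial weights pass through a matrix that decays away from the
    diagonal. *)
Lemma br_mul k m : br k <= br (k - m) * br m.
Proof.
  unfold br. rewrite <- !(plus_IZR 1), <- mult_IZR. apply IZR_le.
  pose proof (Z.abs_triangle (k - m) m) as H.
  replace (k - m + m)%Z with k in H by lia. nia.
Qed.

Lemma br_mul' k m : br m <= br (k - m) * br k.
Proof.
  replace (br (k - m)) with (br (m - k)); [apply br_mul|].
  unfold br. f_equal; f_equal; lia.
Qed.

Lemma inv_br_pow_pos k n : 0 < / br k ^ n.
Proof. apply Rinv_0_lt_compat, br_pow_pos. Qed.

Lemma inv_br_pow_le_1 k n : / br k ^ n <= 1.
Proof.
  rewrite <- Rinv_1. apply Rinv_le_contravar; [lra|apply br_pow_ge_1].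
Qed.

Lemma decay_nonneg (f : Z -> C) D q : (forall k, Cmod (f k) <= D * / br k ^ q) -> 0 <= D.
Proof.
  intros H. pose proof (H 0%Z). pose proof (Cmod_ge_0 (f 0%Z)).
  pose proof (inv_br_pow_pos 0 q). nra.
Qed.

(* Both finite sums run over the window -n <= k < n. *)
Fixpoint rsum (n : nat) (f : Z -> R) : R :=
  match n with
  | O => 0
  | S p => rsum p f + (f (Z.of_nat p) + f (- Z.of_nat (S p))%Z)
  end.

Fixpoint csum (n : nat) (f : Z -> C) : C :=
  match n with
  | O => RtoC 0
  | S p => (csum p f + (f (Z.of_nat p) + f (- Z.of_nat (S p))%Z))%C
  end.

Lemma rsum_le n f g :
  (forall k, (Z.abs k <= Z.of_nat n)%Z -> f k <= g k) -> rsum n f <= rsum n g.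
Proof.
  induction n as [|n IH]; intros H; [apply Rle_refl|].
  cbn [rsum].
  assert (rsum n f <= rsum n g) by (apply IH; intros; apply H; lia).
  assert (f (Z.of_nat n) <= g (Z.of_nat n)) by (apply H; lia).
  assert (f (- Z.of_nat (S n))%Z <= g (- Z.of_nat (S n))%Z) by (apply H; lia).
  lra.
Qed.

Lemma rsum_scal n c f : rsum n (fun k => c * f k) = c * rsum n f.
Proof. induction n as [|n IH]; cbn [rsum]; [ring|rewrite IH; ring]. Qed.

Lemma rsum_pos n f : (forall k, 0 <= f k) -> 0 <= rsum n f.
Proof.
  intros H; induction n as [|n IH]; cbn [rsum]; [lra|].
  pose proof (H (Z.of_nat n)); pose proof (H (- Z.of_nat (S n))%Z); lra.
Qed.

Lemma rsum_incr n p f : (forall k, 0 <= f k) -> (n <= p)%nat -> rsum n f <= rsum p f.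
Proof.
  intros H; induction 1 as [|p _ IH]; [apply Rle_refl|]. cbn [rsum].
  pose proof (H (Z.of_nat p)); pose proof (H (- Z.of_nat (S p))%Z); lra.
Qed.

Lemma rsum_term_le n f k :
  (forall k, 0 <= f k) -> (Z.abs k < Z.of_nat n)%Z -> f k <= rsum n f.
Proof.
  intros H; induction n as [|n IH]; intros Hk; [lia|]. cbn [rsum].
  pose proof (H (Z.of_nat n)); pose proof (H (- Z.of_nat (S n))%Z).
  destruct (Z.eq_dec (Z.abs k) (Z.of_nat n)) as [E|E].
  - destruct (Z.eq_dec k (Z.of_nat n)) as [->|E2].
    + pose proof (rsum_pos n f H); lra.
    + destruct n as [|n]; [lia|]. cbn [rsum].
      replace k with (- Z.of_nat (S n))%Z by lia.
      pose proof (rsum_pos n f H). pose proof (H (Z.of_nat n)). lra.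
  - assert (f k <= rsum n f) by (apply IH; lia). lra.
Qed.

Lemma csum_ext n f g :
  (forall k, (- Z.of_nat n <= k < Z.of_nat n)%Z -> f k = g k) -> csum n f = csum n g.
Proof.
  induction n as [|n IH]; intros H; [reflexivity|].
  cbn [csum]. rewrite IH by (intros; apply H; lia). rewrite !H by lia. reflexivity.
Qed.

Lemma csum_plus n f g : csum n (fun k => f k + g k)%C = (csum n f + csum n g)%C.
Proof. induction n as [|n IH]; cbn [csum]; [ring|rewrite IH; ring]. Qed.

Lemma csum_minus n f g : csum n (fun k => f k - g k)%C = (csum n f - csum n g)%C.
Proof. induction n as [|n IH]; cbn [csum]; [ring|rewrite IH; ring]. Qed.

Lemma csum_scal n c f : csum n (fun k => c * f k)%C = (c * csum n f)%C.
Proof. induction n as [|n IH]; cbn [csum]; [ring|rewrite IH; ring]. Qed.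

Lemma csum_scal_r n c f : csum n (fun k => f k * c)%C = (csum n f * c)%C.
Proof. induction n as [|n IH]; cbn [csum]; [ring|rewrite IH; ring]. Qed.

Lemma csum_conj n f : Cconj (csum n f) = csum n (fun k => Cconj (f k)).
Proof.
  induction n as [|n IH]; cbn [csum].
  - unfold Cconj, RtoC; simpl. f_equal; ring.
  - rewrite !Cplus_conj, IH. reflexivity.
Qed.

Lemma csum_switch n p (f : Z -> Z -> C) :
  csum n (fun k => csum p (fun m => f k m)) = csum p (fun m => csum n (fun k => f k m)).
Proof.
  induction n as [|n IH]; cbn [csum].
  - induction p as [|p IHp]; cbn [csum]; [reflexivity|rewrite <- IHp; ring].
  - rewrite IH, <- !csum_plus. reflexivity.
Qed.

Lemma Cmod_csum n f : Cmod (csum n f) <= rsum n (fun k => Cmod (f k)).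
Proof.
  induction n as [|n IH]; cbn [csum rsum].
  - rewrite Cmod_0; lra.
  - eapply Rle_trans; [apply Cmod_triangle|].
    pose proof (Cmod_triangle (f (Z.of_nat n)) (f (- Z.of_nat (S n))%Z)). lra.
Qed.

Lemma Cmod_csum_le n f g :
  (forall k, (Z.abs k <= Z.of_nat n)%Z -> Cmod (f k) <= g k) -> Cmod (csum n f) <= rsum n g.
Proof. intros H. eapply Rle_trans; [apply Cmod_csum|apply rsum_le, H]. Qed.

(** All indices outside the window of radius [n] satisfy |k| >= n, which is the condition
    [INR n + 1 <= br k]. Summing [g] over the whole larger window loses nothing of interest, because
    the smallness in [n] is put into [g] itself. *)
Lemma Cmod_csum_tail n p f g :
  (forall k, 0 <= g k) ->
  (forall k, INR n + 1 <= br k -> Cmod (f k) <= g k) ->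
  (n <= p)%nat -> Cmod (csum p f - csum n f) <= rsum p g.
Proof.
  intros Hg Hf; induction 1 as [|p Hp IH].
  - replace (csum n f - csum n f)%C with (RtoC 0) by ring.
    rewrite Cmod_0. now apply rsum_pos.
  - cbn [csum rsum].
    match goal with |- Cmod (?A + (?x + ?y) - ?B) <= _ =>
      replace (A + (x + y) - B)%C with ((A - B) + (x + y))%C by ring end.
    pose proof (Cmod_triangle (csum p f - csum n f) (f (Z.of_nat p) + f (- Z.of_nat (S p))%Z)).
    pose proof (Cmod_triangle (f (Z.of_nat p)) (f (- Z.of_nat (S p))%Z)).
    assert (Cmod (f (Z.of_nat p)) <= g (Z.of_nat p)).
    { apply Hf. unfold br. rewrite INR_IZR_INZ, Rplus_comm.
      apply Rplus_le_compat_l, IZR_le; lia. }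
    assert (Cmod (f (- Z.of_nat (S p))%Z) <= g (- Z.of_nat (S p))%Z).
    { apply Hf. unfold br. rewrite INR_IZR_INZ, Rplus_comm.
      apply Rplus_le_compat_l, IZR_le; lia. }
    lra.
Qed.

(* [l / (1 + |l|)] is bounded and its increments dominate [1 / (1 + |l|)^2]; this makes
   the bound uniform in the shift. *)
Lemma inv_br2_telescope l :
  / br l ^ 2 <= 2 * (IZR (l + 1) / br (l + 1) - IZR l / br l).
Proof.
  unfold br. destruct (Z_le_gt_dec 0 l) as [H|H].
  - rewrite !Z.abs_eq by lia. rewrite plus_IZR.
    assert (0 <= IZR l) by (apply IZR_le; lia). set (x := IZR l) in *.
    apply Rminus_le.
    replace (/ (1 + x) ^ 2 - 2 * ((x + 1) / (1 + (x + 1)) - x / (1 + x)))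
      with (- x / ((1 + x) ^ 2 * (2 + x))) by (field; lra).
    assert (0 < / ((1 + x) ^ 2 * (2 + x))) by (apply Rinv_0_lt_compat; nra).
    unfold Rdiv. nra.
  - rewrite !Z.abs_neq by lia. rewrite !opp_IZR, plus_IZR.
    assert (IZR l <= -1) by (apply IZR_le; lia). set (x := IZR l) in *.
    apply Rminus_le.
    replace (/ (1 + - x) ^ 2 - 2 * ((x + 1) / (1 + - (x + 1)) - x / (1 + - x)))
      with (- (2 - x) / ((1 - x) ^ 2 * (- x))) by (field; split; lra).
    assert (0 < / ((1 - x) ^ 2 * (- x))) by (apply Rinv_0_lt_compat; nra).
    unfold Rdiv. nra.
Qed.

Lemma div_br_bound l : -1 <= IZR l / br l <= 1.
Proof.
  assert (Rabs (IZR l) <= br l) by (unfold br; rewrite <- abs_IZR; lra).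
  pose proof (br_pos l). apply Rabs_le_between in H.
  split; [apply Rle_div_r|apply Rle_div_l]; lra.
Qed.

Lemma rsum_inv_br2 k n : rsum n (fun m => / br (k - m) ^ 2) <= 4.
Proof.
  assert (H : rsum n (fun m => / br (k - m) ^ 2) <=
    2 * (IZR (k + Z.of_nat n + 1) / br (k + Z.of_nat n + 1)
         - IZR (k - Z.of_nat n + 1) / br (k - Z.of_nat n + 1))).
  { induction n as [|n IH].
    - cbn [rsum]. replace (k + Z.of_nat 0 + 1)%Z with (k - Z.of_nat 0 + 1)%Z by lia. lra.
    - cbn [rsum].
      pose proof (inv_br2_telescope (k - Z.of_nat n)) as H1.
      pose proof (inv_br2_telescope (k + Z.of_nat n + 1)) as H2.
      replace (k - - Z.of_nat (S n))%Z with (k + Z.of_nat n + 1)%Z by lia.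
      replace (k + Z.of_nat (S n) + 1)%Z with (k + Z.of_nat n + 1 + 1)%Z by lia.
      replace (k - Z.of_nat (S n) + 1)%Z with (k - Z.of_nat n)%Z by lia.
      lra. }
  (* The telescoped sum has two boundary terms in [-1, 1], which gives 2 * (1 + 1) = 4 for any
     shift. *)
  pose proof (div_br_bound (k + Z.of_nat n + 1)).
  pose proof (div_br_bound (k - Z.of_nat n + 1)). lra.
Qed.

Lemma rsum_inv_br2_0 n : rsum n (fun m => / br m ^ 2) <= 4.
Proof.
  eapply Rle_trans; [|apply (rsum_inv_br2 0 n)]. apply rsum_le. intros k _.
  apply Req_le. f_equal. f_equal. unfold br. do 2 f_equal. lia.
Qed.

(** * Convergence of sums over the integers *)

Definition cconv (s : nat -> C) (l : C) : Prop :=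
  forall eps, 0 < eps -> exists N, forall n, (N <= n)%nat -> Cmod (s n - l) < eps.

Lemma Cmod_le_sum (z : C) : Cmod z <= Rabs (fst z) + Rabs (snd z).
Proof.
  unfold Cmod. apply Rsqr_incr_0_var; [|pose proof (Rabs_pos (fst z)); pose proof (Rabs_pos (snd z)); lra].
  rewrite Rsqr_sqrt by nra. unfold Rsqr.
  pose proof (Rabs_pos (fst z)); pose proof (Rabs_pos (snd z)).
  pose proof (pow2_abs (fst z)); pose proof (pow2_abs (snd z)). nra.
Qed.

Lemma Rabs_fst_le (z : C) : Rabs (fst z) <= Cmod z.
Proof. apply (re_le_Cmod z). Qed.

Lemma Rabs_snd_le (z : C) : Rabs (snd z) <= Cmod z.
Proof. eapply Rle_trans; [apply Rmax_r|apply Rmax_Cmod]. Qed.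

Lemma Cmod_minus_sym (x y : C) : Cmod (x - y) = Cmod (y - x).
Proof. rewrite <- Cmod_opp. f_equal. ring. Qed.

Lemma cconv_le s l (z : C) B n0 :
  cconv s l -> (forall n, (n0 <= n)%nat -> Cmod (s n - z) <= B) -> Cmod (l - z) <= B.
Proof.
  intros Hs H. apply le_epsilon. intros eps He. destruct (Hs eps He) as [N HN].
  set (n := Nat.max n0 N). specialize (HN n ltac:(lia)). specialize (H n ltac:(lia)).
  replace (l - z)%C with ((l - s n) + (s n - z))%C by ring.
  eapply Rle_trans; [apply Cmod_triangle|]. rewrite Cmod_minus_sym in HN. lra.
Qed.

Lemma cconv_unique s l l' : cconv s l -> cconv s l' -> l = l'.
Proof.
  intros H H'. assert (Cmod (l - l') <= 0).
  { apply le_epsilon. intros eps He. rewrite Rplus_0_l.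
    destruct (H' eps He) as [N HN].
    apply (cconv_le s l l' eps N H). intros n Hn. left; auto. }
  assert (E : (l - l')%C = 0) by (apply Cmod_eq_0; pose proof (Cmod_ge_0 (l - l')); lra).
  replace l with ((l - l') + l')%C by ring. rewrite E. ring.
Qed.

Lemma cconv_cauchy s (e : nat -> R) :
  (forall eps, 0 < eps -> exists n, e n < eps) ->
  (forall n p, (n <= p)%nat -> Cmod (s p - s n) <= e n) ->
  exists l, cconv s l /\ forall n, Cmod (l - s n) <= e n.
Proof.
  intros He Hs.
  assert (Hc : forall pr : C -> R,
    (forall z, Rabs (pr z) <= Cmod z) -> (forall x y, pr (x - y)%C = pr x - pr y) ->
    { l | Un_cv (fun n => pr (s n)) l}).
  { intros pr Hpr Hm. apply Rcomplete.R_complete. intros eps Heps.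
    destruct (He (eps / 2)) as [N HN]; [lra|].
    exists N. intros n m Hn Hm'. unfold Rdist. rewrite <- Hm.
    eapply Rle_lt_trans; [apply Hpr|].
    replace (s n - s m)%C with ((s n - s N) - (s m - s N))%C by ring.
    eapply Rle_lt_trans; [apply Cmod_triangle|]. rewrite Cmod_opp.
    pose proof (Hs N n Hn). pose proof (Hs N m Hm'). lra. }
  destruct (Hc fst Rabs_fst_le) as [a Ha]; [reflexivity|].
  destruct (Hc snd Rabs_snd_le) as [b Hb]; [reflexivity|].
  assert (Hl : cconv s (a, b)).
  { intros eps Heps. destruct (Ha (eps / 2)) as [N1 H1]; [lra|].
    destruct (Hb (eps / 2)) as [N2 H2]; [lra|].
    exists (Nat.max N1 N2). intros n Hn.
    eapply Rle_lt_trans; [apply Cmod_le_sum|].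
    specialize (H1 n ltac:(lia)). specialize (H2 n ltac:(lia)).
    unfold Rdist in *. cbn -[Rabs]. 
    replace (fst (s n) + - a) with (fst (s n) - a) by ring.
    replace (snd (s n) + - b) with (snd (s n) - b) by ring. lra. }
  exists (a, b). split; [exact Hl|]. intros n.
  apply (cconv_le s _ _ _ n Hl). intros; now apply Hs.
Qed.

(** A total function, with a meaningless value when the limit does not exist; it is evaluated only
    through [clim_unique]. Infinite sums can thus be written before their convergence is proved. *)
Definition clim (s : nat -> C) : C :=
  (real (Lim_seq (fun n => fst (s n))), real (Lim_seq (fun n => snd (s n)))).

Lemma clim_unique s l : cconv s l -> clim s = l.
Proof.
  intros H. destruct l as [x y]. unfold clim.
  f_equal; [change x with (real (Finite x))|change y with (real (Finite y))];
    apply (f_equal real), is_lim_seq_unique, is_lim_seq_Reals; intros eps He;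
    destruct (H eps He) as [N HN]; exists N; intros n Hn;
    (eapply Rle_lt_trans; [|apply (HN n Hn)]).
  - apply (Rabs_fst_le (s n - (x, y))).
  - apply (Rabs_snd_le (s n - (x, y))).
Qed.

Definition zsum (a : Z -> C) : C := clim (fun n => csum n a).

Lemma zsum_unique a l : cconv (fun n => csum n a) l -> zsum a = l.
Proof. apply clim_unique. Qed.

Lemma cconv_minus s s' l l' :
  cconv s l -> cconv s' l' -> cconv (fun n => s n - s' n)%C (l - l')%C.
Proof.
  intros H H' eps He. destruct (H (eps / 2)) as [N HN]; [lra|].
  destruct (H' (eps / 2)) as [N' HN']; [lra|].
  exists (Nat.max N N'). intros n Hn.
  specialize (HN n ltac:(lia)). specialize (HN' n ltac:(lia)).
  replace (s n - s' n - (l - l'))%C with ((s n - l) - (s' n - l'))%C by ring.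
  eapply Rle_lt_trans; [apply Cmod_triangle|]. rewrite Cmod_opp. lra.
Qed.

Lemma zsum_minus a b l l' :
  cconv (fun n => csum n a) l -> cconv (fun n => csum n b) l' ->
  zsum (fun m => a m - b m)%C = (l - l')%C.
Proof.
  intros H H'. apply zsum_unique. intros eps He.
  destruct (cconv_minus _ _ _ _ H H' eps He) as [N HN]. exists N. intros n Hn.
  rewrite csum_minus. now apply HN.
Qed.

Lemma inv_INR_small C eps : 0 < eps -> exists n : nat, C / (INR n + 1) < eps.
Proof.
  intros He. destruct (INR_unbounded (C / eps)) as [n Hn]. exists n.
  pose proof (pos_INR n). apply Rlt_div_l; [lra|].
  apply Rlt_div_l in Hn; [|lra]. nra.
Qed.

Section ShiftedSum.

Variables (a : Z -> C) (k : Z) (E : R).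
Hypothesis Ha : forall m, Cmod (a m) <= E * / br (k - m) ^ 3.

Lemma shift_bound_nonneg : 0 <= E.
Proof.
  pose proof (Ha 0). pose proof (Cmod_ge_0 (a 0%Z)).
  pose proof (inv_br_pow_pos (k - 0) 3). nra.
Qed.

Lemma csum_shift_bound n : Cmod (csum n a) <= 4 * E.
Proof.
  pose proof shift_bound_nonneg.
  eapply Rle_trans; [apply (Cmod_csum_le _ _ (fun m => E * / br (k - m) ^ 2))|].
  - intros m _. eapply Rle_trans; [apply Ha|]. apply Rmult_le_compat_l; [assumption|].
    apply Rinv_le_contravar; [apply br_pow_pos|].
    apply Rle_pow; [apply br_ge_1|lia].
  - rewrite rsum_scal. pose proof (rsum_inv_br2 k n). nra.
Qed.

(** For |m| >= n Peetre's inequality gives n + 1 <= br (k - m) * br k. One of the three powers of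
    [br (k - m)] is traded for the rate br k / (n + 1), and the other two are summed uniformly in
    [k]. *)
Lemma csum_shift_tail n p : (n <= p)%nat ->
  Cmod (csum p a - csum n a) <= 4 * E * br k / (INR n + 1).
Proof.
  pose proof shift_bound_nonneg. intros Hn.
  assert (Hn1 : 0 < INR n + 1) by (pose proof (pos_INR n); lra).
  assert (0 <= E * br k / (INR n + 1)).
  { apply Rmult_le_pos; [pose proof (br_pos k); nra|left; now apply Rinv_0_lt_compat]. }
  eapply Rle_trans;
    [apply (Cmod_csum_tail _ _ _ (fun m => (E * br k / (INR n + 1)) * / br (k - m) ^ 2))|].
  - intros m. apply Rmult_le_pos; [assumption|left; apply inv_br_pow_pos].
  - intros m Hm. eapply Rle_trans; [apply Ha|].
    replace (E * / br (k - m) ^ 3) with (E * / br (k - m) * / br (k - m) ^ 2)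
      by (field; apply Rgt_not_eq, br_pos).
    apply Rmult_le_compat_r; [left; apply inv_br_pow_pos|].
    unfold Rdiv. rewrite Rmult_assoc. apply Rmult_le_compat_l; [assumption|].
    pose proof (br_mul' k m). pose proof (br_pos (k - m)).
    apply (Rmult_le_reg_l (br (k - m) * (INR n + 1))); [nra|].
    replace (br (k - m) * (INR n + 1) * / br (k - m)) with (INR n + 1) by (field; lra).
    replace (br (k - m) * (INR n + 1) * (br k * / (INR n + 1)))
      with (br (k - m) * br k) by (field; lra). lra.
  - exact Hn.
  - rewrite rsum_scal. pose proof (rsum_inv_br2 k p).
    replace (4 * E * br k / (INR n + 1)) with ((E * br k / (INR n + 1)) * 4) by (field; lra).
    now apply Rmult_le_compat_l.
Qed.

Lemma zsum_shift :
  cconv (fun n => csum n a) (zsum a) /\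
  (forall n, Cmod (zsum a - csum n a) <= 4 * E * br k / (INR n + 1)) /\
  Cmod (zsum a) <= 4 * E.
Proof.
  destruct (cconv_cauchy (fun n => csum n a) (fun n => 4 * E * br k / (INR n + 1)))
    as [l [Hl Ht]].
  - intros eps He. now apply inv_INR_small.
  - intros; now apply csum_shift_tail.
  - rewrite (zsum_unique a l Hl). split; [exact Hl|]. split; [exact Ht|].
    replace l with (l - 0)%C by ring. apply (cconv_le _ _ _ _ 0%nat Hl).
    intros n _. replace (csum n a - 0)%C with (csum n a) by ring. apply csum_shift_bound.
Qed.

End ShiftedSum.

Lemma is_series_cconv (a : nat -> C) (l : C) :
  cconv (fun n => sum_n a n) l -> @is_series C_AbsRing C_NormedModule a l.
Proof.
  intros H. apply (filterlim_locally (F := eventually)). intros eps.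
  destruct (H eps (cond_pos eps)) as [N HN]. exists N. intros n Hn.
  apply C_NormedModule_mixin_compat1. apply HN, Hn.
Qed.

(** The notion of solution asks for convergence of the two half-series separately, whereas [zsum] is
    a limit over symmetric windows. Cutting [a] by the sign of the index turns each half-series into
    a windowed sum. *)
Lemma zsum_is_zsum (a : Z -> C) E :
  (forall m, Cmod (a m) <= E * / br m ^ 3) -> zsum_is a (zsum a).
Proof.
  intros Ha.
  set (a1 := fun k : Z => if Z_le_gt_dec 0 k then a k else RtoC 0).
  set (a2 := fun k : Z => if Z_le_gt_dec 0 k then RtoC 0 else a k).
  assert (Hb : forall m, br (0 - m) = br m) by (intros m; unfold br; do 2 f_equal; lia).
  assert (H0 : forall m, 0 <= E * / br m ^ 3)
    by (intros m; eapply Rle_trans; [apply Cmod_ge_0|apply Ha]).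
  destruct (zsum_shift a 0 E) as [Hs _]; [intros m; now rewrite Hb|].
  destruct (zsum_shift a1 0 E) as [Hs1 _].
  { intros m. rewrite Hb. unfold a1. destruct (Z_le_gt_dec 0 m); [apply Ha|].
    rewrite Cmod_0. apply H0. }
  destruct (zsum_shift a2 0 E) as [Hs2 _].
  { intros m. rewrite Hb. unfold a2. destruct (Z_le_gt_dec 0 m); [|apply Ha].
    rewrite Cmod_0. apply H0. }
  (* [sum_n] includes its last index, while the window of radius [n] stops at n - 1 on the right;
     hence the successor. *)
  assert (E1 : forall n, csum (S n) a1 = sum_n (fun n => a (Z.of_nat n)) n
                      /\ csum (S n) a2 = sum_n (fun n => a (- Z.of_nat (S n))%Z) n).
  { induction n as [|n [IH1 IH2]]; [rewrite !sum_O|rewrite !sum_Sn, <- IH1, <- IH2; remember (S n) as q];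
      cbn [csum]; unfold a1 at 2 3, a2 at 2 3 || unfold a1, a2;
      repeat match goal with |- context [Z_le_gt_dec 0 ?z] => destruct (Z_le_gt_dec 0 z); try lia end;
      unfold plus; simpl; split; ring. }
  exists (zsum a1), (zsum a2). split; [|split].
  - apply is_series_cconv. intros eps He. destruct (Hs1 eps He) as [N HN].
    exists N. intros n Hn. rewrite <- (proj1 (E1 n)). apply HN. lia.
  - apply is_series_cconv. intros eps He. destruct (Hs2 eps He) as [N HN].
    exists N. intros n Hn. rewrite <- (proj2 (E1 n)). apply HN. lia.
  - apply (cconv_unique _ _ _ Hs). intros eps He.
    destruct (Hs1 (eps / 2)) as [N1 H1]; [lra|].
    destruct (Hs2 (eps / 2)) as [N2 H2]; [lra|].
    exists (Nat.max N1 N2). intros n Hn.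
    specialize (H1 n ltac:(lia)). specialize (H2 n ltac:(lia)).
    replace (csum n a) with (csum n a1 + csum n a2)%C.
    + replace (csum n a1 + csum n a2 - (zsum a1 + zsum a2))%C
        with ((csum n a1 - zsum a1) + (csum n a2 - zsum a2))%C by ring.
      eapply Rle_lt_trans; [apply Cmod_triangle|]. lra.
    + rewrite <- csum_plus. apply csum_ext. intros k _. unfold a1, a2.
      destruct (Z_le_gt_dec 0 k); ring.
Qed.

(** Of the p + 3 powers of the kernel, p carry the weight from [m] to [k] by Peetre's inequality,
    and 3 remain for the convergence of the sum over [m]. *)
Lemma kernel_weight (kap f : C) D B k m p :
  0 <= D -> 0 <= B ->
  Cmod kap <= D * / br (k - m) ^ (p + 3) -> Cmod f <= B * / br m ^ p ->
  Cmod (kap * f) <= (D * B * / br k ^ p) * / br (k - m) ^ 3.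
Proof.
  intros HD HB Hk Hf. rewrite Cmod_mult.
  eapply Rle_trans; [apply Rmult_le_compat; [apply Cmod_ge_0|apply Cmod_ge_0|apply Hk|apply Hf]|].
  assert (Hp : br k ^ p <= (br (k - m) * br m) ^ p).
  { apply pow_incr. split; [left; apply br_pos|apply br_mul]. }
  rewrite Rpow_mult_distr in Hp. rewrite pow_add.
  pose proof (br_pow_pos k p). pose proof (br_pow_pos m p).
  pose proof (br_pow_pos (k - m) p). pose proof (br_pow_pos (k - m) 3).
  replace (D * / (br (k - m) ^ p * br (k - m) ^ 3) * (B * / br m ^ p))
    with (D * B * (/ (br (k - m) ^ p * br m ^ p)) * / br (k - m) ^ 3)
    by (pose proof (br_pos (k - m)); field; repeat split; apply Rgt_not_eq; assumption).
  apply Rmult_le_compat_r; [left; apply inv_br_pow_pos|].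
  apply Rmult_le_compat_l; [now apply Rmult_le_pos|].
  now apply Rinv_le_contravar.
Qed.

(** * Complex-valued functions of a real variable *)

Definition cder (f : R -> C) (x : R) (d : C) : Prop :=
  is_derive (fun y => fst (f y)) x (fst d) /\ is_derive (fun y => snd (f y)) x (snd d).

Definition ccont (f : R -> C) : Prop :=
  forall x, continuous (fun y => fst (f y)) x /\ continuous (fun y => snd (f y)) x.

Lemma cder_eq f x d d' : cder f x d -> d = d' -> cder f x d'.
Proof. now intros H <-. Qed.

Lemma cder_ext f g x d : (forall y, f y = g y) -> cder f x d -> cder g x d.
Proof.
  intros H [H1 H2]. split;
    (eapply is_derive_ext; [intros y; rewrite <- H; reflexivity|assumption]).
Qed.

Lemma cder_const c x : cder (fun _ => c) x (RtoC 0).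
Proof. split; apply @is_derive_const. Qed.

Lemma cder_plus f g x d e : cder f x d -> cder g x e -> cder (fun y => f y + g y)%C x (d + e)%C.
Proof.
  intros [H1 H2] [H3 H4]. split.
  - apply (is_derive_plus (fun y => fst (f y)) (fun y => fst (g y))); assumption.
  - apply (is_derive_plus (fun y => snd (f y)) (fun y => snd (g y))); assumption.
Qed.

Lemma cder_minus f g x d e : cder f x d -> cder g x e -> cder (fun y => f y - g y)%C x (d - e)%C.
Proof.
  intros [H1 H2] [H3 H4]. split.
  - apply (is_derive_minus (fun y => fst (f y)) (fun y => fst (g y))); assumption.
  - apply (is_derive_minus (fun y => snd (f y)) (fun y => snd (g y))); assumption.
Qed.

Lemma cder_conj f x d : cder f x d -> cder (fun y => Cconj (f y)) x (Cconj d).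
Proof.
  intros [H1 H2]. split; [exact H1|].
  apply (is_derive_opp (fun y => snd (f y))). exact H2.
Qed.

Lemma is_derive_Rmult (f g : R -> R) x d e :
  is_derive f x d -> is_derive g x e -> is_derive (fun y => f y * g y) x (d * g x + f x * e).
Proof. intros H1 H2. apply (is_derive_mult f g); auto. intros; apply Rmult_comm. Qed.

Lemma cder_mult f g x d e :
  cder f x d -> cder g x e -> cder (fun y => f y * g y)%C x (d * g x + f x * e)%C.
Proof.
  intros [H1 H2] [H3 H4]. split; cbn.
  - replace (fst d * fst (g x) - snd d * snd (g x) + (fst (f x) * fst e - snd (f x) * snd e))
      with ((fst d * fst (g x) + fst (f x) * fst e) - (snd d * snd (g x) + snd (f x) * snd e)) by ring.
    apply (is_derive_minus (fun y => fst (f y) * fst (g y)) (fun y => snd (f y) * snd (g y)));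
      apply is_derive_Rmult; assumption.
  - replace (fst d * snd (g x) + snd d * fst (g x) + (fst (f x) * snd e + snd (f x) * fst e))
      with ((fst d * snd (g x) + fst (f x) * snd e) + (snd d * fst (g x) + snd (f x) * fst e)) by ring.
    apply (is_derive_plus (fun y => fst (f y) * snd (g y)) (fun y => snd (f y) * fst (g y)));
      apply is_derive_Rmult; assumption.
Qed.

Lemma cder_scal c f x d : cder f x d -> cder (fun y => c * f y)%C x (c * d)%C.
Proof.
  intros H. eapply cder_eq; [apply (cder_mult _ _ _ _ _ (cder_const c x) H)|]. ring.
Qed.

Lemma cder_csum n (f : R -> Z -> C) x (d : Z -> C) :
  (forall k, cder (fun y => f y k) x (d k)) -> cder (fun y => csum n (f y)) x (csum n d).
Proof.
  intros H. induction n as [|n IH]; cbn [csum]; [apply cder_const|].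
  repeat apply cder_plus; auto.
Qed.

(** Bridge from componentwise derivatives to the vector-valued derivative in the definition of a
    solution: f is decomposed along the basis (1, 0), (0, 1). *)
Lemma cder_is_derive (f : R -> C) x (d : C) :
  cder f x d ->
  @is_derive R_AbsRing (prod_NormedModule R_AbsRing R_NormedModule R_NormedModule) f x d.
Proof.
  intros [H1 H2].
  apply (is_derive_ext (fun y => plus (scal (fst (f y)) (1, 0) : R * R) (scal (snd (f y)) (0, 1)))).
  { intros t. destruct (f t) as [u v]. unfold plus, scal; cbn. unfold mult; cbn.
    unfold prod_plus, prod_scal, plus, scal; cbn. unfold mult; cbn. f_equal; ring. }
  replace d with (plus (scal (fst d) (1, 0) : R * R) (scal (snd d) (0, 1))).
  - apply @is_derive_plus; apply @is_derive_scal_l; assumption.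
  - destruct d as [u v]. unfold plus, scal; cbn.
    unfold prod_plus, prod_scal, plus, scal; cbn. unfold mult; cbn. f_equal; ring.
Qed.

(** [G + F] and [G - F] are both nondecreasing. Working with a primitive [G] of the majorant avoids
    any integrability question for [f]. *)
Lemma mean_value_bound (F G f g : R -> R) a b :
  a <= b ->
  (forall s, a <= s <= b -> is_derive F s (f s)) ->
  (forall s, a <= s <= b -> is_derive G s (g s)) ->
  (forall s, a <= s <= b -> Rabs (f s) <= g s) ->
  Rabs (F b - F a) <= G b - G a.
Proof.
  intros Hab HF HG Hfg.
  assert (Hmono : forall H h, (forall s, a <= s <= b -> is_derive H s (h s)) ->
    (forall s, a <= s <= b -> 0 <= h s) -> 0 <= H b - H a).
  { intros H h Hd Hp. destruct (MVT_gen H a b h) as [c [Hc E]].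
    - rewrite Rmin_left, Rmax_right by lra. intros; apply Hd; lra.
    - rewrite Rmin_left, Rmax_right by lra. intros x Hx.
      apply continuity_pt_filterlim, (ex_derive_continuous H). exists (h x). now apply Hd.
    - rewrite Rmin_left, Rmax_right in Hc by lra. rewrite E.
      apply Rmult_le_pos; [now apply Hp|lra]. }
  apply Rabs_le. split.
  - assert (0 <= (G b + F b) - (G a + F a)); [|lra].
    apply (Hmono (fun s => G s + F s) (fun s => g s + f s)).
    + intros s Hs. apply (is_derive_plus G F); auto.
    + intros s Hs. specialize (Hfg s Hs). apply Rabs_le_between in Hfg. lra.
  - assert (0 <= (G b - F b) - (G a - F a)); [|lra].
    apply (Hmono (fun s => G s - F s) (fun s => g s - f s)).
    + intros s Hs. apply (is_derive_minus G F); auto.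
    + intros s Hs. specialize (Hfg s Hs). apply Rabs_le_between in Hfg. lra.
Qed.

(** The mean value inequality is applied to the real and imaginary parts separately; the factor 2 is
    the price and recurs in the later constants. *)
Lemma cder_bound (F f : R -> C) (G g : R -> R) a b :
  a <= b ->
  (forall s, a <= s <= b -> cder F s (f s)) ->
  (forall s, a <= s <= b -> is_derive G s (g s)) ->
  (forall s, a <= s <= b -> Cmod (f s) <= g s) ->
  Cmod (F b - F a) <= 2 * (G b - G a).
Proof.
  intros Hab HF HG Hfg. eapply Rle_trans; [apply Cmod_le_sum|]. cbn -[Rabs].
  assert (Rabs (fst (F b) + - fst (F a)) <= G b - G a).
  { apply (mean_value_bound (fun s => fst (F s)) G (fun s => fst (f s)) g); auto.
    - intros s Hs. apply (HF s Hs).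
    - intros s Hs. eapply Rle_trans; [apply Rabs_fst_le|auto]. }
  assert (Rabs (snd (F b) + - snd (F a)) <= G b - G a).
  { apply (mean_value_bound (fun s => snd (F s)) G (fun s => snd (f s)) g); auto.
    - intros s Hs. apply (HF s Hs).
    - intros s Hs. eapply Rle_trans; [apply Rabs_snd_le|auto]. }
  lra.
Qed.

Lemma cder_lipschitz (F f : R -> C) L T :
  (forall s, Rabs s <= T -> cder F s (f s)) ->
  (forall s, Rabs s <= T -> Cmod (f s) <= L) ->
  forall s t, Rabs s <= T -> Rabs t <= T -> Cmod (F t - F s) <= 2 * L * Rabs (t - s).
Proof.
  intros HF Hf.
  assert (H : forall s t, Rabs s <= T -> Rabs t <= T -> s <= t ->
    Cmod (F t - F s) <= 2 * L * (t - s)).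
  { intros s t Hs Ht Hst. apply Rabs_le_between in Hs. apply Rabs_le_between in Ht.
    eapply Rle_trans; [apply (cder_bound F f (fun x => L * x) (fun _ => L))|].
    - exact Hst.
    - intros; apply HF. apply Rabs_le; lra.
    - intros x Hx. auto_derive; [auto|ring].
    - intros; apply Hf. apply Rabs_le; lra.
    - apply Req_le; ring. }
  intros s t Hs Ht. destruct (Rle_dec s t) as [Hst|Hst].
  - rewrite Rabs_pos_eq by lra. now apply H.
  - rewrite Cmod_minus_sym, Rabs_minus_sym, Rabs_pos_eq by lra. apply H; auto. lra.
Qed.

(** Integrating the weight e^{lam |s|} gains 1 / lam. With lam large this makes the Picard map a
    contraction on the whole line at once, as in Bielecki's norm. Negative times follow by the
    reflection s -> -s. *)
Lemma cder_exp_bound (F f : R -> C) lam c :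
  0 < lam -> (forall s, cder F s (f s)) ->
  (forall s, Cmod (f s) <= c * exp (lam * Rabs s)) ->
  forall t, Cmod (F t - F 0) <= 2 * (c / lam) * exp (lam * Rabs t).
Proof.
  intros Hl HF Hf t.
  assert (Hc : 0 <= c).
  { pose proof (Cmod_ge_0 (f 0)). pose proof (Hf 0). rewrite Rabs_R0, Rmult_0_r, exp_0 in H0. lra. }
  assert (Hcl : 0 <= c / lam)
    by (apply Rmult_le_pos; [assumption|left; now apply Rinv_0_lt_compat]).
  assert (H : forall (F f : R -> C), (forall s, cder F s (f s)) ->
    (forall s, Cmod (f s) <= c * exp (lam * Rabs s)) ->
    forall t, 0 <= t -> Cmod (F t - F 0) <= 2 * (c / lam) * exp (lam * t)).
  { clear F f HF Hf t. intros F f HF Hf t Ht.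
    eapply Rle_trans; [apply (cder_bound F f (fun x => c / lam * exp (lam * x))
      (fun x => c * exp (lam * x)) 0 t Ht)|].
    - intros; apply HF.
    - intros s _. auto_derive; [auto|]. field; lra.
    - intros s Hs. specialize (Hf s). now rewrite Rabs_pos_eq in Hf by lra.
    - rewrite Rmult_0_r, exp_0. lra. }
  destruct (Rle_dec 0 t) as [Ht|Ht].
  - rewrite Rabs_pos_eq by assumption. now apply (H F f).
  - rewrite Rabs_left by lra.
    specialize (H (fun s => F (- s)) (fun s => Copp (f (- s)))).
    replace (Cmod (F t - F 0)) with (Cmod (F (- - t) - F (- 0)))
      by (rewrite Ropp_involutive, Ropp_0; reflexivity).
    apply H.
    + intros s. destruct (HF (- s)) as [H1 H2]. split; cbn.
      * replace (- fst (f (- s))) with (scal (-1) (fst (f (- s)))) by (unfold scal; cbn; unfold mult; cbn; ring).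
        apply (is_derive_comp (fun y => fst (F y)) Ropp); [exact H1|auto_derive; auto].
      * replace (- snd (f (- s))) with (scal (-1) (snd (f (- s)))) by (unfold scal; cbn; unfold mult; cbn; ring).
        apply (is_derive_comp (fun y => snd (F y)) Ropp); [exact H2|auto_derive; auto].
    + intros s. rewrite Cmod_opp. rewrite <- (Rabs_Ropp s). apply Hf.
    + lra.
Qed.

Lemma lipschitz_continuous (f : R -> R) :
  (forall T, exists L, forall s t, Rabs s <= T -> Rabs t <= T -> Rabs (f t - f s) <= L * Rabs (t - s)) ->
  forall x, continuous f x.
Proof.
  intros H x. destruct (H (Rabs x + 1)) as [L HL].
  apply filterlim_locally. intros eps.
  assert (Hd : 0 < Rmin 1 (eps / (Rabs L + 1))).
  { apply Rmin_pos; [lra|]. apply Rdiv_lt_0_compat; [apply cond_pos|pose proof (Rabs_pos L); lra]. }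
  exists (mkposreal _ Hd). intros y Hy. change (Rabs (y - x) < Rmin 1 (eps / (Rabs L + 1))) in Hy.
  pose proof (Rmin_l 1 (eps / (Rabs L + 1))). pose proof (Rmin_r 1 (eps / (Rabs L + 1))).
  change (Rabs (f y - f x) < eps).
  eapply Rle_lt_trans; [apply HL|].
  - lra.
  - replace y with ((y - x) + x) by ring. eapply Rle_trans; [apply Rabs_triang|]. lra.
  - assert (Hy2 : Rabs (y - x) < eps / (Rabs L + 1)) by lra.
    apply Rlt_div_r in Hy2; [|pose proof (Rabs_pos L); lra].
    pose proof (Rabs_pos (y - x)). pose proof (Rle_abs L). nra.
Qed.

Lemma lipschitz_ccont (f : R -> C) :
  (forall T, exists L, forall s t, Rabs s <= T -> Rabs t <= T -> Cmod (f t - f s) <= L * Rabs (t - s)) ->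
  ccont f.
Proof.
  intros H x. split; apply lipschitz_continuous; intros T; destruct (H T) as [L HL]; exists L;
    intros s t Hs Ht; (eapply Rle_trans; [|apply (HL s t Hs Ht)]).
  - apply (Rabs_fst_le (f t - f s)).
  - apply (Rabs_snd_le (f t - f s)).
Qed.

Definition cprim (f : R -> C) (t : R) : C :=
  (RInt (fun s => fst (f s)) 0 t, RInt (fun s => snd (f s)) 0 t).

Lemma is_derive_prim (f : R -> R) t :
  (forall x, continuous f x) -> is_derive (fun x => RInt f 0 x) t (f t).
Proof.
  intros H. apply (is_derive_RInt f (fun x => RInt f 0 x) 0); [|apply H].
  apply filter_forall. intros b. apply (RInt_correct f), ex_RInt_continuous. auto.
Qed.

Lemma cder_cprim f t : ccont f -> cder (cprim f) t (f t).
Proof.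
  intros H. split; cbn.
  - apply (is_derive_prim (fun s => fst (f s))). apply H.
  - apply (is_derive_prim (fun s => snd (f s))). apply H.
Qed.

Lemma cprim_0 f : cprim f 0 = RtoC 0.
Proof. unfold cprim. rewrite !RInt_point. reflexivity. Qed.

Definition cis (a : R) : C := (cos a, sin a).

Lemma Cmod_cis a : Cmod (cis a) = 1.
Proof.
  unfold Cmod, cis; cbn [fst snd]. rewrite <- sqrt_1. f_equal.
  pose proof (sin2_cos2 a). unfold Rsqr in *. nra.
Qed.

Lemma cis_plus a b : cis (a + b) = (cis a * cis b)%C.
Proof. unfold cis, Cmult; cbn. rewrite cos_plus, sin_plus. f_equal; ring. Qed.

Lemma cis_0 : cis 0 = RtoC 1.
Proof. unfold cis. rewrite cos_0, sin_0. reflexivity. Qed.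

Lemma cis_conj a : Cconj (cis a) = cis (- a).
Proof. unfold cis, Cconj; cbn. rewrite cos_neg, sin_neg. reflexivity. Qed.

Lemma cder_cis (a : R -> R) x d :
  is_derive a x d -> cder (fun y => cis (a y)) x (Ci * RtoC d * cis (a x))%C.
Proof.
  intros H. assert (Hex : ex_derive a x) by (exists d; exact H).
  split; cbn.
  - auto_derive; [auto|]. change (Derive a x) with (Derive (fun y => a y) x).
    replace (Derive (fun y => a y) x) with d by (symmetry; apply is_derive_unique, H). ring.
  - auto_derive; [auto|]. change (Derive a x) with (Derive (fun y => a y) x).
    replace (Derive (fun y => a y) x) with d by (symmetry; apply is_derive_unique, H). ring.
Qed.

Lemma Cmod_cis_minus a b : Cmod (cis b - cis a) <= 2 * Rabs (b - a).
Proof.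
  replace (2 * Rabs (b - a)) with (2 * 1 * Rabs (b - a)) by ring.
  apply (cder_lipschitz cis (fun x => Ci * RtoC 1 * cis x)%C 1 (Rabs a + Rabs b)).
  - intros s _. apply (cder_cis (fun y => y)). apply @is_derive_id.
  - intros s _. rewrite !Cmod_mult, Cmod_Ci, Cmod_1, Cmod_cis. lra.
  - pose proof (Rabs_pos b); lra.
  - pose proof (Rabs_pos a); lra.
Qed.

Lemma exp_le x y : x <= y -> exp x <= exp y.
Proof. intros [H| ->]; [left; now apply exp_increasing|right; reflexivity]. Qed.

(** * Linear systems with rapidly decaying matrices *)

Definition delta (N k : Z) : C := if Z.eq_dec k N then RtoC 1 else RtoC 0.

Section Picard.

Variables (K : R -> Z -> Z -> C) (D : R) (p : nat) (N : Z).
Hypothesis HD : 0 <= D.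
Hypothesis HK : forall t k m, Cmod (K t k m) <= D * / br (k - m) ^ (p + 3).
Hypothesis HKlip : forall s t k m,
  Cmod (K t k m - K s k m) <= D * Rabs (t - s) * / br (k - m) ^ (p + 3).

Definition Lop (t : R) (f : Z -> C) (k : Z) : C := zsum (fun m => K t k m * f m)%C.

Lemma Lop_conv t f B k :
  (forall m, Cmod (f m) <= B * / br m ^ p) ->
  cconv (fun n => csum n (fun m => K t k m * f m)%C) (Lop t f k) /\
  (forall n, Cmod (Lop t f k - csum n (fun m => K t k m * f m)%C)
     <= 4 * (D * B * / br k ^ p) * br k / (INR n + 1)) /\
  Cmod (Lop t f k) <= 4 * (D * B * / br k ^ p).
Proof.
  intros Hf. pose proof (decay_nonneg f B p Hf).
  apply (zsum_shift _ k (D * B * / br k ^ p)). intros m.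
  apply kernel_weight; auto.
Qed.

(** Changing the vector and the time of the kernel are treated together: this one estimate serves
    the contraction (s = t) and the continuity in time (f and g two values of one curve). *)
Lemma Lop_diff s t f g B B' B'' k :
  (forall m, Cmod (f m) <= B * / br m ^ p) ->
  (forall m, Cmod (g m) <= B' * / br m ^ p) ->
  (forall m, Cmod (f m - g m) <= B'' * / br m ^ p) ->
  Cmod (Lop t f k - Lop s g k) <= 4 * (D * (B'' + B' * Rabs (t - s)) * / br k ^ p).
Proof.
  intros Hf Hg Hfg.
  pose proof (decay_nonneg g B' p Hg) as HB'.
  pose proof (decay_nonneg (fun m => f m - g m)%C B'' p Hfg) as HB''.
  destruct (Lop_conv t f B k Hf) as [Cf _]. destruct (Lop_conv s g B' k Hg) as [Cg _].
  rewrite <- (zsum_minus _ _ _ _ Cf Cg).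
  apply (zsum_shift _ k). intros m.
  replace (K t k m * f m - K s k m * g m)%C
    with (K t k m * (f m - g m) + (K t k m - K s k m) * g m)%C by ring.
  eapply Rle_trans; [apply Cmod_triangle|].
  pose proof (kernel_weight _ _ D B'' k m p HD HB'' (HK t k m) (Hfg m)).
  assert (HDt : 0 <= D * Rabs (t - s)) by (apply Rmult_le_pos; [assumption|apply Rabs_pos]).
  pose proof (kernel_weight _ _ (D * Rabs (t - s)) B' k m p HDt HB' (HKlip s t k m) (Hg m)).
  lra.
Qed.

Let B0 := br N ^ p.
(** In the weighted norm [Lop] has norm at most 4 D, and [cder_exp_bound] adds 2 / lam. The choice
    16 D <= lam gives the contraction factor 1 / 2 and keeps all iterates below twice the size of
    the datum; the added 1 covers D = 0. *)
Let lam := 16 * D + 1.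

Fixpoint picard (n : nat) (t : R) (k : Z) : C :=
  match n with
  | O => delta N k
  | S n => (delta N k - Ci * cprim (fun s => Lop s (picard n s) k) t)%C
  end.

Let lam_pos : 0 < lam.
Proof. unfold lam; lra. Qed.

Let B0_pos : 0 < B0.
Proof. apply br_pow_pos. Qed.

Lemma exp_ge_1 t : 1 <= exp (lam * Rabs t).
Proof.
  rewrite <- exp_0. apply exp_le. apply Rmult_le_pos; [lra|apply Rabs_pos].
Qed.

Lemma delta_bound k : Cmod (delta N k) <= B0 * / br k ^ p.
Proof.
  unfold delta. destruct (Z.eq_dec k N) as [->|_].
  - rewrite Cmod_1. unfold B0. rewrite Rinv_r; [lra|]. apply Rgt_not_eq, br_pow_pos.
  - rewrite Cmod_0. pose proof (inv_br_pow_pos k p). nra.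
Qed.

(** Bounds shared by all iterates and inherited by their limit. The Lipschitz part makes s -> Lop s
    (f s) k continuous, so that the integral in the next iterate can be differentiated. *)
Definition reg (f : R -> Z -> C) : Prop :=
  (forall t k, Cmod (f t k) <= 2 * B0 * exp (lam * Rabs t) * / br k ^ p) /\
  (forall T, 0 <= T -> forall s t k, Rabs s <= T -> Rabs t <= T ->
    Cmod (f t k - f s k) <= 16 * D * B0 * exp (lam * T) * Rabs (t - s) * / br k ^ p).

Lemma reg_ccont f k : reg f -> ccont (fun s => Lop s (f s) k).
Proof.
  intros [Hb Hl]. apply lipschitz_ccont. intros T.
  set (T' := Rabs T). assert (HT : 0 <= T') by apply Rabs_pos.
  exists (4 * (D * (16 * D * B0 * exp (lam * T') + 2 * B0 * exp (lam * T'))) * / br k ^ p).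
  intros s t Hs Ht. pose proof (Rle_abs T) as HTT.
  assert (Hb' : forall x m, Rabs x <= T -> Cmod (f x m) <= 2 * B0 * exp (lam * T') * / br m ^ p).
  { intros x m Hx. eapply Rle_trans; [apply Hb|].
    apply Rmult_le_compat_r; [left; apply inv_br_pow_pos|].
    apply Rmult_le_compat_l; [lra|]. apply exp_le, Rmult_le_compat_l; unfold T'; lra. }
  eapply Rle_trans; [apply (Lop_diff s t (f t) (f s) (2 * B0 * exp (lam * T'))
    (2 * B0 * exp (lam * T')) (16 * D * B0 * exp (lam * T') * Rabs (t - s)) k)|].
  - intros m; now apply Hb'.
  - intros m; now apply Hb'.
  - intros m. apply Hl; unfold T' in *; lra.
  - apply Req_le. ring.
Qed.

Lemma picard_cder n t k :
  reg (picard n) -> cder (fun s => picard (S n) s k) t (- Ci * Lop t (picard n t) k)%C.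
Proof.
  intros H. cbn [picard]. eapply cder_eq.
  - apply cder_minus; [apply cder_const|]. apply cder_scal, cder_cprim.
    now apply reg_ccont.
  - ring.
Qed.

Lemma Cmod_mCi z : Cmod (- Ci * z) = Cmod z.
Proof. rewrite Cmod_mult, Cmod_opp, Cmod_Ci. ring. Qed.

Lemma picard_0 n k : picard n 0 k = delta N k.
Proof. destruct n; cbn [picard]; [reflexivity|]. rewrite cprim_0. ring. Qed.

Lemma picard_reg n : reg (picard n).
Proof.
  induction n as [|n IH].
  - split.
    + intros t k. eapply Rle_trans; [apply delta_bound|].
      apply Rmult_le_compat_r; [left; apply inv_br_pow_pos|].
      pose proof (exp_ge_1 t). nra.
    + intros T HT s t k _ _. cbn [picard].
      replace (delta N k - delta N k)%C with (RtoC 0) by ring. rewrite Cmod_0.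
      apply Rmult_le_pos; [|left; apply inv_br_pow_pos].
      apply Rmult_le_pos; [|apply Rabs_pos].
      apply Rmult_le_pos; [nra|left; apply exp_pos].
  - assert (Hd : forall t k, Cmod (- Ci * Lop t (picard n t) k)
      <= 8 * D * B0 * / br k ^ p * exp (lam * Rabs t)).
    { intros t k. rewrite Cmod_mCi.
      eapply Rle_trans; [apply (Lop_conv t (picard n t) (2 * B0 * exp (lam * Rabs t)) k)|].
      - intros m. apply IH.
      - apply Req_le; ring. }
    split.
    + intros t k.
      replace (picard (S n) t k) with (delta N k + (picard (S n) t k - picard (S n) 0 k))%C
        by (rewrite picard_0; ring).
      eapply Rle_trans; [apply Cmod_triangle|].
      pose proof (delta_bound k).
      pose proof (cder_exp_bound (fun s => picard (S n) s k) _ lam (8 * D * B0 * / br k ^ p)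
        lam_pos (fun s => picard_cder n s k IH) (fun s => Hd s k) t) as H1.
      pose proof (exp_ge_1 t). pose proof (inv_br_pow_pos k p).
      assert (2 * (8 * D * B0 * / br k ^ p / lam) <= B0 * / br k ^ p).
      { replace (2 * (8 * D * B0 * / br k ^ p / lam)) with ((B0 * / br k ^ p) * (16 * D / lam))
          by (field; split; [apply Rgt_not_eq, br_pow_pos|lra]).
        assert (16 * D / lam <= 1) by (apply Rle_div_l; unfold lam; lra).
        assert (0 < B0 * / br k ^ p) by nra. nra. }
      assert (0 < B0 * / br k ^ p) by nra.
      cbv beta in H1.
      apply Rle_trans with (B0 * / br k ^ p + B0 * / br k ^ p * exp (lam * Rabs t)).
      * apply Rplus_le_compat; [assumption|]. eapply Rle_trans; [exact H1|].
        apply Rmult_le_compat_r; [left; apply exp_pos|assumption].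
      * nra.
    + intros T HT s t k Hs Ht.
      eapply Rle_trans; [apply (cder_lipschitz (fun s => picard (S n) s k) _
        (8 * D * B0 * / br k ^ p * exp (lam * T)) T (fun s _ => picard_cder n s k IH)); auto|].
      * intros x Hx. eapply Rle_trans; [apply Hd|].
        apply Rmult_le_compat_l.
        { apply Rmult_le_pos; [nra|left; apply inv_br_pow_pos]. }
        apply exp_le, Rmult_le_compat_l; lra.
      * apply Req_le; ring.
Qed.

Lemma picard_step n t k :
  Cmod (picard (S n) t k - picard n t k) <= B0 * (/ 2) ^ n * exp (lam * Rabs t) * / br k ^ p.
Proof.
  assert (Hlam : 2 * (4 * D) / lam <= / 2) by (apply Rle_div_l; unfold lam; lra).
  revert t k. induction n as [|n IH]; intros t k; pose proof (inv_br_pow_pos k p).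
  - replace (picard 1 t k - picard 0 t k)%C with (picard 1 t k - picard 1 0 k)%C
      by (rewrite picard_0; reflexivity).
    pose proof (cder_exp_bound (fun s => picard 1 s k) _ lam (4 * D * B0 * / br k ^ p)
        lam_pos (fun s => picard_cder 0 s k (picard_reg 0))) as H1. cbv beta in H1.
    eapply Rle_trans; [apply H1|].
    + intros s. rewrite Cmod_mCi.
      eapply Rle_trans; [apply (Lop_conv s (picard 0 s) B0 k)|].
      * intros m. apply delta_bound.
      * pose proof (exp_ge_1 s).
        assert (0 <= 4 * D * B0 * / br k ^ p) by (repeat apply Rmult_le_pos; lra). nra.
    + replace (2 * (4 * D * B0 * / br k ^ p / lam) * exp (lam * Rabs t))
        with ((2 * (4 * D) / lam) * (B0 * / br k ^ p * exp (lam * Rabs t)))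
        by (field; split; [apply Rgt_not_eq, br_pow_pos|lra]).
      assert (0 <= B0 * / br k ^ p * exp (lam * Rabs t)).
      { apply Rmult_le_pos; [nra|left; apply exp_pos]. }
      rewrite pow_O. nra.
  - set (F := fun s => (picard (S (S n)) s k - picard (S n) s k)%C).
    assert (HF : forall s, cder F s (- Ci * (Lop s (picard (S n) s) k - Lop s (picard n s) k))%C).
    { intros s. eapply cder_eq; [apply cder_minus; apply picard_cder, picard_reg|]. ring. }
    assert (HF0 : F 0 = RtoC 0) by (unfold F; rewrite !picard_0; ring).
    replace (picard (S (S n)) t k - picard (S n) t k)%C with (F t - F 0)%C
      by (rewrite HF0; unfold F; ring).
    pose proof (cder_exp_bound F _ lam (4 * D * (B0 * (/ 2) ^ n) * / br k ^ p)
        lam_pos HF) as H1. cbv beta in H1.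
    eapply Rle_trans; [apply H1|].
    + intros s. rewrite Cmod_mCi.
      eapply Rle_trans; [apply (Lop_diff s s (picard (S n) s) (picard n s)
        (2 * B0 * exp (lam * Rabs s)) (2 * B0 * exp (lam * Rabs s))
        (B0 * (/ 2) ^ n * exp (lam * Rabs s)))|].
      * intros; apply picard_reg.
      * intros; apply picard_reg.
      * intros; apply IH.
      * rewrite Rminus_diag, Rabs_R0. apply Req_le; ring.
    + replace (2 * (4 * D * (B0 * (/ 2) ^ n) * / br k ^ p / lam) * exp (lam * Rabs t))
        with ((2 * (4 * D) / lam) * (B0 * (/ 2) ^ n * / br k ^ p * exp (lam * Rabs t)))
        by (field; split; [apply Rgt_not_eq, br_pow_pos|lra]).
      assert (0 < (/ 2) ^ n) by (apply pow_lt; lra).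
      assert (0 <= B0 * (/ 2) ^ n * / br k ^ p * exp (lam * Rabs t)).
      { apply Rmult_le_pos; [|left; apply exp_pos]. apply Rmult_le_pos; [|lra]. nra. }
      cbn [pow]. nra.
Qed.

Lemma picard_cauchy n q t k : (n <= q)%nat ->
  Cmod (picard q t k - picard n t k) <= (2 * B0 * exp (lam * Rabs t) * / br k ^ p) * (/ 2) ^ n.
Proof.
  intros Hq. set (A := 2 * B0 * exp (lam * Rabs t) * / br k ^ p).
  assert (HA : 0 <= A).
  { unfold A. apply Rmult_le_pos; [|left; apply inv_br_pow_pos].
    apply Rmult_le_pos; [lra|left; apply exp_pos]. }
  (* Each step is at most A / 2 times 2^{-q}, which is exactly A (2^{-q} - 2^{-(q+1)}), so the bound
     telescopes. *)
  assert (H : Cmod (picard q t k - picard n t k) <= A * ((/ 2) ^ n - (/ 2) ^ q)).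
  { induction Hq as [|q Hq IH].
    - replace (picard n t k - picard n t k)%C with (RtoC 0) by ring. rewrite Cmod_0. nra.
    - replace (picard (S q) t k - picard n t k)%C
        with ((picard (S q) t k - picard q t k) + (picard q t k - picard n t k))%C by ring.
      eapply Rle_trans; [apply Cmod_triangle|].
      pose proof (picard_step q t k) as H1.
      replace (B0 * (/ 2) ^ q * exp (lam * Rabs t) * / br k ^ p)
        with (A * ((/ 2) ^ q * / 2)) in H1 by (unfold A; field; apply Rgt_not_eq, br_pow_pos).
      cbn [pow]. nra. }
  assert (0 < (/ 2) ^ q) by (apply pow_lt; lra). nra.
Qed.

Lemma half_pow_small A eps : 0 < eps -> exists n : nat, A * (/ 2) ^ n < eps.
Proof.
  intros He. destruct (pow_lt_1_zero (/ 2) ltac:(rewrite Rabs_pos_eq; lra) (eps / (Rabs A + 1)))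
    as [n Hn].
  - apply Rdiv_lt_0_compat; [assumption|pose proof (Rabs_pos A); lra].
  - exists n. specialize (Hn n (le_n n)). apply Rlt_div_r in Hn; [|pose proof (Rabs_pos A); lra].
    rewrite Rabs_pos_eq in Hn by (left; apply pow_lt; lra).
    assert (0 < (/ 2) ^ n) by (apply pow_lt; lra). pose proof (Rle_abs A). nra.
Qed.

Definition picard_lim (t : R) (k : Z) : C := clim (fun n => picard n t k).

Lemma picard_lim_conv t k :
  cconv (fun n => picard n t k) (picard_lim t k) /\
  forall n, Cmod (picard_lim t k - picard n t k)
    <= (2 * B0 * exp (lam * Rabs t) * / br k ^ p) * (/ 2) ^ n.
Proof.
  destruct (cconv_cauchy (fun n => picard n t k)
    (fun n => (2 * B0 * exp (lam * Rabs t) * / br k ^ p) * (/ 2) ^ n)) as [l [Hl H]].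
  - intros. now apply half_pow_small.
  - intros; now apply picard_cauchy.
  - unfold picard_lim. rewrite (clim_unique _ _ Hl). auto.
Qed.

Lemma picard_lim_reg : reg picard_lim.
Proof.
  split.
  - intros t k. destruct (picard_lim_conv t k) as [H _].
    replace (picard_lim t k) with (picard_lim t k - 0)%C by ring.
    apply (cconv_le _ _ _ _ 0%nat H). intros n _.
    replace (picard n t k - 0)%C with (picard n t k) by ring. apply picard_reg.
  - intros T HT s t k Hs Ht.
    replace (picard_lim t k - picard_lim s k)%C with (picard_lim t k - picard_lim s k - 0)%C by ring.
    apply (cconv_le (fun n => picard n t k - picard n s k)%C _ _ _ 0%nat).
    + apply cconv_minus; apply picard_lim_conv.
    + intros n _. replace (picard n t k - picard n s k - 0)%C with (picard n t k - picard n s k)%C by ring.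
      now apply picard_reg.
Qed.

(** Both sides are limits of the shifted sequence of iterates. The convergence of the integrals
    comes from [cder_exp_bound] applied to the difference of the two primitives. *)
Lemma picard_lim_eq t k :
  picard_lim t k = (delta N k - Ci * cprim (fun s => Lop s (picard_lim s) k) t)%C.
Proof.
  apply (cconv_unique (fun n => picard (S n) t k)).
  - intros eps He. destruct (picard_lim_conv t k) as [H _]. destruct (H eps He) as [n0 Hn0].
    exists n0. intros n Hn. apply Hn0. lia.
  - intros eps He.
    set (A := 2 * (4 * D * (2 * B0) * / br k ^ p / lam) * exp (lam * Rabs t)).
    destruct (half_pow_small A eps He) as [n0 Hn0]. exists n0. intros n Hn.
    cbn [picard].
    set (F := fun s => (cprim (fun s => Lop s (picard n s) k) s
                        - cprim (fun s => Lop s (picard_lim s) k) s)%C).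
    match goal with |- Cmod ?z < _ => replace z with (- Ci * (F t - F 0))%C
      by (unfold F; rewrite !cprim_0; ring) end.
    rewrite Cmod_mCi.
    eapply Rle_lt_trans; [apply (cder_exp_bound F
      (fun s => Lop s (picard n s) k - Lop s (picard_lim s) k)%C lam
      (4 * D * (2 * B0) * / br k ^ p * (/ 2) ^ n) lam_pos)|].
    + intros s. apply cder_minus; apply cder_cprim, reg_ccont; [apply picard_reg|apply picard_lim_reg].
    + intros s. eapply Rle_trans; [apply (Lop_diff s s (picard n s) (picard_lim s)
        (2 * B0 * exp (lam * Rabs s)) (2 * B0 * exp (lam * Rabs s))
        (2 * B0 * exp (lam * Rabs s) * (/ 2) ^ n))|].
      * intros; apply picard_reg.
      * intros; apply picard_lim_reg.
      * intros m. rewrite Cmod_minus_sym. eapply Rle_trans; [apply picard_lim_conv|].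
        apply Req_le; ring.
      * rewrite Rminus_diag, Rabs_R0. apply Req_le; ring.
    + eapply Rle_lt_trans; [|exact Hn0].
      replace (2 * (4 * D * (2 * B0) * / br k ^ p * (/ 2) ^ n / lam) * exp (lam * Rabs t))
        with (A * (/ 2) ^ n)
        by (unfold A; field; split; [apply Rgt_not_eq, br_pow_pos|lra]).
      apply Rmult_le_compat_l.
      * unfold A. apply Rmult_le_pos; [|left; apply exp_pos].
        apply Rmult_le_pos; [lra|]. apply Rmult_le_pos; [|left; now apply Rinv_0_lt_compat].
        apply Rmult_le_pos; [nra|left; apply inv_br_pow_pos].
      * assert (E : (/ 2) ^ n = (/ 2) ^ n0 * (/ 2) ^ (n - n0))
          by (rewrite <- pow_add; f_equal; lia).
        rewrite E. assert (0 < (/ 2) ^ n0) by (apply pow_lt; lra).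
        assert ((/ 2) ^ (n - n0) <= 1).
        { rewrite <- (pow1 (n - n0)). apply pow_incr; lra. }
        nra.
Qed.

Lemma linear_system_solution :
  exists u : R -> Z -> C,
    (forall k, u 0 k = delta N k) /\
    (forall T, exists B, 0 <= B /\ forall t k, Rabs t <= T -> Cmod (u t k) <= B * / br k ^ p) /\
    (forall t k, cder (fun s => u s k) t (- Ci * Lop t (u t) k)%C).
Proof.
  exists picard_lim. split; [|split].
  - intros k. rewrite picard_lim_eq, cprim_0. ring.
  - intros T. exists (2 * B0 * exp (lam * T)). split.
    + apply Rmult_le_pos; [lra|left; apply exp_pos].
    + intros t k Ht. eapply Rle_trans; [apply picard_lim_reg|].
      apply Rmult_le_compat_r; [left; apply inv_br_pow_pos|].
      apply Rmult_le_compat_l; [lra|]. apply exp_le, Rmult_le_compat_l; lra.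
  - intros t k. eapply cder_ext; [intros s; symmetry; apply picard_lim_eq|].
    eapply cder_eq.
    + apply cder_minus; [apply cder_const|]. apply cder_scal, cder_cprim, reg_ccont, picard_lim_reg.
    + ring.
Qed.

End Picard.

(** * Fourier coefficients *)

Lemma continuous_Rmult (f g : R -> R) x :
  continuous f x -> continuous g x -> continuous (fun y => f y * g y) x.
Proof. apply (continuous_mult f g). Qed.

Lemma continuous_Rplus (f g : R -> R) x :
  continuous f x -> continuous g x -> continuous (fun y => f y + g y) x.
Proof. apply (continuous_plus f g). Qed.

Lemma continuous_Rminus (f g : R -> R) x :
  continuous f x -> continuous g x -> continuous (fun y => f y - g y) x.
Proof. apply (continuous_minus f g). Qed.

Lemma is_derive_continuous (f : R -> R) x d : is_derive f x d -> continuous f x.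
Proof. intros H. apply (ex_derive_continuous f). now exists d. Qed.

Lemma continuous_lin c x : continuous (fun x => c * x) x.
Proof. apply continuous_Rmult; [apply continuous_const|apply continuous_id]. Qed.

Lemma continuous_shift (f : R -> R) a x : (forall y, continuous f y) -> continuous (fun x => f (x + a)) x.
Proof.
  intros H. apply (continuous_comp (fun x => x + a) f); [|apply H].
  apply continuous_Rplus; [apply continuous_id|apply continuous_const].
Qed.

Lemma continuous_cos_R (a : R -> R) x : continuous a x -> continuous (fun y => cos (a y)) x.
Proof.
  intros H. apply (continuous_comp a cos); [exact H|]. apply continuity_pt_filterlim, continuity_cos.
Qed.

Lemma continuous_sin_R (a : R -> R) x : continuous a x -> continuous (fun y => sin (a y)) x.
Proof.
  intros H. apply (continuous_comp a sin); [exact H|]. apply continuity_pt_filterlim, continuity_sin.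
Qed.

Lemma ccont_mult f g : ccont f -> ccont g -> ccont (fun x => f x * g x)%C.
Proof.
  intros Hf Hg x. destruct (Hf x), (Hg x). split; cbn.
  - apply continuous_Rminus; apply continuous_Rmult; assumption.
  - apply continuous_Rplus; apply continuous_Rmult; assumption.
Qed.

Lemma ccont_plus f g : ccont f -> ccont g -> ccont (fun x => f x + g x)%C.
Proof. intros Hf Hg x. destruct (Hf x), (Hg x). split; cbn; apply continuous_Rplus; assumption. Qed.

Lemma ccont_minus f g : ccont f -> ccont g -> ccont (fun x => f x - g x)%C.
Proof. intros Hf Hg x. destruct (Hf x), (Hg x). split; cbn; apply continuous_Rminus; assumption. Qed.

Lemma ccont_const c : ccont (fun _ => c).
Proof. intros x. split; apply continuous_const. Qed.

Lemma ccont_conj f : ccont f -> ccont (fun x => Cconj (f x)).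
Proof.
  intros Hf x. destruct (Hf x) as [H1 H2]. split; cbn; [exact H1|].
  apply (continuous_opp (fun y => snd (f y))), H2.
Qed.

Lemma ccont_RtoC (f : R -> R) : (forall x, continuous f x) -> ccont (fun x => RtoC (f x)).
Proof. intros H x. split; cbn; [apply H|apply continuous_const]. Qed.

Lemma ccont_cis (a : R -> R) : (forall x, continuous a x) -> ccont (fun x => cis (a x)).
Proof.
  intros H x. split; cbn.
  - apply continuous_cos_R, H.
  - apply continuous_sin_R, H.
Qed.

Lemma ccont_csum n (f : Z -> R -> C) : (forall k, ccont (f k)) -> ccont (fun x => csum n (fun k => f k x)).
Proof.
  intros H. induction n as [|n IH]; cbn [csum]; [apply ccont_const|].
  apply ccont_plus; [exact IH|]. apply ccont_plus; apply H.
Qed.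

Lemma ccont_mode k : ccont (fun x => cis (- (IZR k * x))).
Proof.
  apply ccont_cis. intros x. apply (continuous_opp (fun x => IZR k * x)), continuous_lin.
Qed.

Ltac ccont_auto := repeat
  match goal with
  | |- ccont (fun _ => ?c) => apply (ccont_const c)
  | |- ccont (fun x => Cplus (@?f x) (@?g x)) => apply (ccont_plus f g)
  | |- ccont (fun x => Cminus (@?f x) (@?g x)) => apply (ccont_minus f g)
  | |- ccont (fun x => Cmult (@?f x) (@?g x)) => apply (ccont_mult f g)
  | |- ccont (fun x => Cconj (@?f x)) => apply (ccont_conj f)
  | |- ccont (fun x => cis (- (IZR ?k * x))) => apply (ccont_mode k)
  | |- ccont (fun x => cis (?c * x)) => apply (ccont_cis (fun x => c * x)); intros; apply continuous_lin
  | H : ccont ?f |- ccont ?f => exact H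
  | H : ccont ?f |- ccont (fun x => ?f x) => exact H
  end.

Definition CI (f : R -> C) : C :=
  (RInt (fun x => fst (f x)) 0 (2 * PI), RInt (fun x => snd (f x)) 0 (2 * PI)).

Lemma ex_RInt_cont (f : R -> R) a b : (forall x, continuous f x) -> ex_RInt f a b.
Proof. intros H. apply (ex_RInt_continuous f). auto. Qed.

Lemma RInt_ext_all (f g : R -> R) a b : (forall x, f x = g x) -> RInt f a b = RInt g a b.
Proof. intros H. apply RInt_ext. auto. Qed.

Lemma RInt_Rplus (f g : R -> R) a b :
  (forall x, continuous f x) -> (forall x, continuous g x) ->
  RInt (fun x => f x + g x) a b = RInt f a b + RInt g a b.
Proof. intros Hf Hg. apply (RInt_plus f g); now apply ex_RInt_cont. Qed.

Lemma RInt_Rminus (f g : R -> R) a b :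
  (forall x, continuous f x) -> (forall x, continuous g x) ->
  RInt (fun x => f x - g x) a b = RInt f a b - RInt g a b.
Proof. intros Hf Hg. apply (RInt_minus f g); now apply ex_RInt_cont. Qed.

Lemma RInt_Rscal (f : R -> R) c a b :
  (forall x, continuous f x) -> RInt (fun x => c * f x) a b = c * RInt f a b.
Proof. intros Hf. apply (RInt_scal f a b c). now apply ex_RInt_cont. Qed.

Lemma CI_ext f g : (forall x, f x = g x) -> CI f = CI g.
Proof. intros H. unfold CI. f_equal; apply RInt_ext_all; intros x; now rewrite H. Qed.

Lemma CI_plus f g : ccont f -> ccont g -> CI (fun x => f x + g x)%C = (CI f + CI g)%C.
Proof.
  intros Hf Hg. unfold CI, Cplus; cbn [fst snd].
  f_equal.
  - apply (RInt_Rplus (fun x => fst (f x)) (fun x => fst (g x))); [apply Hf|apply Hg].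
  - apply (RInt_Rplus (fun x => snd (f x)) (fun x => snd (g x))); [apply Hf|apply Hg].
Qed.

Lemma CI_minus f g : ccont f -> ccont g -> CI (fun x => f x - g x)%C = (CI f - CI g)%C.
Proof.
  intros Hf Hg. unfold CI, Cminus, Copp, Cplus; cbn [fst snd].
  f_equal.
  - apply (RInt_Rminus (fun x => fst (f x)) (fun x => fst (g x))); [apply Hf|apply Hg].
  - apply (RInt_Rminus (fun x => snd (f x)) (fun x => snd (g x))); [apply Hf|apply Hg].
Qed.

Lemma CI_scal c f : ccont f -> CI (fun x => c * f x)%C = (c * CI f)%C.
Proof.
  intros Hf. unfold CI, Cmult; cbn [fst snd].
  assert (H1 : forall x, continuous (fun y => fst (f y)) x) by apply Hf.
  assert (H2 : forall x, continuous (fun y => snd (f y)) x) by apply Hf.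
  assert (HR : forall (h : R -> R) d, (forall x, continuous h x) -> forall x, continuous (fun y => d * h y) x)
    by (intros; apply continuous_Rmult; auto using continuous_const).
  apply injective_projections; cbn [fst snd].
  - rewrite <- (RInt_Rscal (fun x => fst (f x))), <- (RInt_Rscal (fun x => snd (f x))) by assumption.
    apply (RInt_Rminus (fun x => fst c * fst (f x)) (fun x => snd c * snd (f x))); apply HR; assumption.
  - rewrite <- (RInt_Rscal (fun x => fst (f x))), <- (RInt_Rscal (fun x => snd (f x))) by assumption.
    apply (RInt_Rplus (fun x => fst c * snd (f x)) (fun x => snd c * fst (f x))); apply HR; assumption.
Qed.

Lemma CI_conj f : ccont f -> CI (fun x => Cconj (f x)) = Cconj (CI f).
Proof.
  intros Hf. unfold CI, Cconj; cbn [fst snd]. f_equal.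
  apply (RInt_opp (fun x => snd (f x))). apply ex_RInt_cont. apply Hf.
Qed.

Lemma CI_0 : CI (fun _ => RtoC 0) = RtoC 0.
Proof.
  replace (CI (fun _ => RtoC 0)) with (CI (fun _ => 0 * 0)%C) by (apply CI_ext; intros; ring).
  rewrite CI_scal by apply ccont_const. ring.
Qed.

Lemma CI_csum n (f : Z -> R -> C) :
  (forall k, ccont (f k)) -> CI (fun x => csum n (fun k => f k x)) = csum n (fun k => CI (f k)).
Proof.
  intros H. induction n as [|n IH]; cbn [csum]; [apply CI_0|].
  rewrite CI_plus; [|now apply ccont_csum|apply ccont_plus; apply H].
  rewrite CI_plus by apply H. now rewrite IH.
Qed.

Lemma RInt_abs_bound (f : R -> R) M :
  (forall x, continuous f x) -> (forall x, Rabs (f x) <= M) ->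
  Rabs (RInt f 0 (2 * PI)) <= 2 * PI * M.
Proof.
  intros Hf HM. pose proof PI_RGT_0.
  replace (2 * PI * M) with ((2 * PI - 0) * M) by ring.
  apply abs_RInt_le_const; [lra|now apply ex_RInt_cont|auto].
Qed.

Lemma CI_bound f M : ccont f -> (forall x, Cmod (f x) <= M) -> Cmod (CI f) <= 4 * PI * M.
Proof.
  intros Hf HM. eapply Rle_trans; [apply Cmod_le_sum|]. unfold CI; cbn [fst snd].
  assert (Rabs (RInt (fun x => fst (f x)) 0 (2 * PI)) <= 2 * PI * M).
  { apply RInt_abs_bound; [apply Hf|]. intros x. eapply Rle_trans; [apply Rabs_fst_le|auto]. }
  assert (Rabs (RInt (fun x => snd (f x)) 0 (2 * PI)) <= 2 * PI * M).
  { apply RInt_abs_bound; [apply Hf|]. intros x. eapply Rle_trans; [apply Rabs_snd_le|auto]. }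
  lra.
Qed.

Lemma RInt_deriv (F f : R -> R) :
  (forall x, is_derive F x (f x)) -> (forall x, continuous f x) ->
  RInt f 0 (2 * PI) = F (2 * PI) - F 0.
Proof.
  intros HF Hf. apply is_RInt_unique. apply (is_RInt_derive F f); auto.
Qed.

Lemma CI_deriv F f :
  (forall x, cder F x (f x)) -> ccont f -> CI f = (F (2 * PI)%R - F 0%R)%C.
Proof.
  intros HF Hf. unfold CI, Cminus, Copp, Cplus; cbn [fst snd]. f_equal.
  - apply (RInt_deriv (fun x => fst (F x))); [apply HF|apply Hf].
  - apply (RInt_deriv (fun x => snd (F x))); [apply HF|apply Hf].
Qed.

Lemma cis_2PI_Z k : cis (IZR k * (2 * PI)) = RtoC 1.
Proof.
  assert (Hn : forall n : nat, cis (INR n * (2 * PI)) = RtoC 1).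
  { induction n as [|n IH].
    - rewrite Rmult_0_l. apply cis_0.
    - rewrite S_INR, Rmult_plus_distr_r, cis_plus, IH, Rmult_1_l.
      unfold cis. rewrite cos_2PI, sin_2PI. change (1, 0) with (RtoC 1). ring. }
  destruct (Z_le_gt_dec 0 k) as [H|H].
  - rewrite <- (Z2Nat.id k) by lia. rewrite <- INR_IZR_INZ. apply Hn.
  - replace (IZR k) with (- IZR (- k)) by (rewrite opp_IZR; ring).
    rewrite <- (Z2Nat.id (- k)) by lia. rewrite <- INR_IZR_INZ, <- Ropp_mult_distr_l, <- cis_conj, Hn.
    unfold Cconj, RtoC; cbn. f_equal; ring.
Qed.

Lemma cder_cis_lin c x : cder (fun x => cis (c * x)) x (Ci * RtoC c * cis (c * x))%C.
Proof. apply (cder_cis (fun y => c * y)). auto_derive; [auto|ring]. Qed.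

Lemma CI_cis l : CI (fun x => cis (IZR l * x)) = (2 * PI * delta 0 l)%C.
Proof.
  unfold delta. destruct (Z.eq_dec l 0) as [->|Hl].
  - unfold CI. apply injective_projections; cbn -[RInt].
    + rewrite (RInt_ext_all _ (fun _ => 1)) by (intros; rewrite Rmult_0_l, cos_0; reflexivity).
      rewrite RInt_const. unfold scal; cbn; unfold mult; cbn. ring.
    + rewrite (RInt_ext_all _ (fun _ => 0)) by (intros; rewrite Rmult_0_l, sin_0; reflexivity).
      rewrite RInt_const. unfold scal; cbn; unfold mult; cbn. ring.
  - assert (Hl' : IZR l <> 0) by (now apply not_0_IZR).
    assert (H : CI (fun x => Ci * RtoC (IZR l) * cis (IZR l * x))%C = RtoC 0).
    { rewrite (CI_deriv (fun x => cis (IZR l * x)) _ (fun x => cder_cis_lin (IZR l) x)).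
      - rewrite cis_2PI_Z, Rmult_0_r, cis_0. ring.
      - apply ccont_mult; [apply ccont_const|]. apply ccont_cis. intros; apply continuous_lin. }
    rewrite CI_scal in H by (apply ccont_cis; intros; apply continuous_lin).
    assert (Hc : (Ci * RtoC (IZR l))%C <> 0).
    { intros E. apply (f_equal Cmod) in E. rewrite Cmod_mult, Cmod_Ci, Cmod_R, Cmod_0, Rmult_1_l in E.
      apply Rabs_eq_0 in E. auto. }
    replace (CI (fun x => cis (IZR l * x)))
      with (/ (Ci * RtoC (IZR l)) * (Ci * RtoC (IZR l) * CI (fun x => cis (IZR l * x))))%C.
    + rewrite H. ring.
    + rewrite Cmult_assoc, Cinv_l by assumption. ring.
Qed.

(** Same normalisation as [fourier], which only takes real functions, whereas the packet is
    complex-valued. *)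
Definition cf (G : R -> C) (k : Z) : C :=
  (/ RtoC (2 * PI) * CI (fun x => G x * cis (- (IZR k * x))))%C.

Lemma twoPI_neq_0 : RtoC (2 * PI) <> 0.
Proof. intros E. apply RtoC_inj in E. pose proof PI_RGT_0. lra. Qed.

Lemma CI_cf G k : CI (fun x => G x * cis (- (IZR k * x)))%C = (RtoC (2 * PI) * cf G k)%C.
Proof. unfold cf. rewrite Cmult_assoc, Cinv_r by apply twoPI_neq_0. ring. Qed.

Lemma cf_ext G H k : (forall x, G x = H x) -> cf G k = cf H k.
Proof. intros E. unfold cf. f_equal. apply CI_ext. intros x. now rewrite E. Qed.

Lemma cf_bound G M k : ccont G -> (forall x, Cmod (G x) <= M) -> Cmod (cf G k) <= 2 * M.
Proof.
  intros HG HM. pose proof PI_RGT_0.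
  unfold cf. rewrite Cmod_mult, Cmod_inv, Cmod_R, Rabs_pos_eq by (try apply twoPI_neq_0; lra).
  apply (Rmult_le_reg_l (2 * PI)); [lra|].
  rewrite <- Rmult_assoc, Rinv_r, Rmult_1_l by lra.
  replace (2 * PI * (2 * M)) with (4 * PI * M) by ring.
  apply CI_bound; [apply ccont_mult; [assumption|apply ccont_mode]|].
  intros x. rewrite Cmod_mult, Cmod_cis, Rmult_1_r. auto.
Qed.

Lemma fourier_cf (v : R -> R) k :
  (forall x, continuous v x) -> fourier v k = cf (fun x => RtoC (v x)) k.
Proof.
  intros Hv. pose proof PI_RGT_0. unfold fourier, cf, CI.
  rewrite <- RtoC_inv by lra. unfold Cmult, RtoC; cbn [fst snd].
  assert (Hs : forall x : R, continuous (fun x : R => v x * sin (IZR k * x)) x).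
  { intros x. apply continuous_Rmult; [apply Hv|]. apply continuous_sin_R, continuous_lin. }
  rewrite (RInt_ext_all (fun x => v x * cos (- (IZR k * x)) - 0 * sin (- (IZR k * x)))
    (fun x => v x * cos (IZR k * x))) by (intros; rewrite cos_neg; ring).
  rewrite (RInt_ext_all (fun x => v x * sin (- (IZR k * x)) + 0 * cos (- (IZR k * x)))
    (fun x => (-1) * (v x * sin (IZR k * x)))) by (intros; rewrite sin_neg; ring).
  rewrite (RInt_Rscal _ _ _ _ Hs). apply injective_projections; cbn [fst snd]; [field; lra|].
  field; lra.
Qed.

Lemma csum_delta_out n k f :
  ~ (- Z.of_nat n <= k < Z.of_nat n)%Z -> csum n (fun m => f m * delta k m)%C = RtoC 0.
Proof.
  induction n as [|n IH]; intros H; cbn [csum]; [reflexivity|].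
  rewrite IH by lia. unfold delta.
  destruct (Z.eq_dec (Z.of_nat n) k); [lia|]. destruct (Z.eq_dec (- Z.of_nat (S n)) k); [lia|]. ring.
Qed.

Lemma csum_delta n k f :
  (- Z.of_nat n <= k < Z.of_nat n)%Z -> csum n (fun m => f m * delta k m)%C = f k.
Proof.
  induction n as [|n IH]; intros H; cbn [csum]; [lia|]. unfold delta at 2 3.
  destruct (Z.eq_dec (Z.of_nat n) k) as [<-|H1].
  - rewrite csum_delta_out by lia. destruct (Z.eq_dec (- Z.of_nat (S n)) (Z.of_nat n)); [lia|]. ring.
  - destruct (Z.eq_dec (- Z.of_nat (S n)) k) as [<-|H2].
    + rewrite csum_delta_out by lia. ring.
    + rewrite IH by lia. ring.
Qed.

Lemma fst_csum n f : fst (csum n f) = rsum n (fun k => fst (f k)).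
Proof. induction n as [|n IH]; cbn [csum rsum]; [reflexivity|]. rewrite <- IH. reflexivity. Qed.

Lemma fst_mul_conj (z : C) : fst (z * Cconj z)%C = Cmod z ^ 2.
Proof. rewrite Cmod2_alt. unfold Re, Im; cbn. ring. Qed.

(** The integral of |G - S|^2 is nonnegative, where S is the partial Fourier sum of G. Pairing S
    with G and with itself gives the same value, since G and S have the same coefficients in the
    window. The bound M^2 replaces the mean of |G|^2. *)
Lemma bessel G M n :
  ccont G -> (forall x, Cmod (G x) <= M) -> rsum n (fun k => Cmod (cf G k) ^ 2) <= M ^ 2.
Proof.
  intros HG HM. pose proof PI_RGT_0 as HPI.
  set (S := fun x => csum n (fun k => cf G k * cis (IZR k * x))%C).
  set (T := csum n (fun k => cf G k * Cconj (cf G k))%C).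
  assert (He : forall k, ccont (fun x => cis (IZR k * x)))
    by (intros k; apply ccont_cis; intros; apply continuous_lin).
  assert (HS : ccont S).
  { apply (ccont_csum n (fun k x => cf G k * cis (IZR k * x))%C). intros k.
    apply ccont_mult; [apply ccont_const|apply He]. }
  assert (HScoef : forall k, (- Z.of_nat n <= k < Z.of_nat n)%Z -> cf S k = cf G k).
  { intros k Hk. unfold cf at 1.
    rewrite (CI_ext _ (fun x => csum n (fun m => cf G m * cis (IZR (m - k) * x))%C)).
    - rewrite (CI_csum n (fun m x => cf G m * cis (IZR (m - k) * x))%C)
        by (intros m; apply ccont_mult; [apply ccont_const|apply He]).
      rewrite (csum_ext n _ (fun m => (RtoC (2 * PI) * cf G m) * delta k m)%C).
      + rewrite csum_delta by assumption.
        rewrite Cmult_assoc, Cinv_l by apply twoPI_neq_0. ring.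
      + intros m _. rewrite CI_scal by apply He. rewrite CI_cis.
        unfold delta. destruct (Z.eq_dec (m - k) 0), (Z.eq_dec m k); try lia;
          rewrite ?RtoC_mult; ring.
    - intros x. unfold S. rewrite <- csum_scal_r. apply csum_ext. intros m _.
      rewrite <- Cmult_assoc, <- cis_plus. do 2 f_equal. rewrite minus_IZR. ring. }
  assert (HconjS : forall x, Cconj (S x) = csum n (fun k => Cconj (cf G k) * cis (- (IZR k * x)))%C).
  { intros x. unfold S. rewrite csum_conj. apply csum_ext. intros k _.
    now rewrite Cmult_conj, cis_conj. }
  assert (Hpair : forall F, ccont F -> CI (fun x => F x * Cconj (S x))%C
    = csum n (fun k => Cconj (cf G k) * (RtoC (2 * PI) * cf F k))%C).
  { intros F HF.
    rewrite (CI_ext _ (fun x => csum n (fun k => Cconj (cf G k) * (F x * cis (- (IZR k * x))))%C)).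
    - rewrite (CI_csum n (fun k x => Cconj (cf G k) * (F x * cis (- (IZR k * x))))%C).
      + apply csum_ext. intros k _. rewrite CI_scal, CI_cf; [reflexivity|].
        apply ccont_mult; [assumption|apply ccont_mode].
      + intros k. apply ccont_mult; [apply ccont_const|].
        apply ccont_mult; [assumption|apply ccont_mode].
    - intros x. rewrite HconjS, <- csum_scal. apply csum_ext. intros k _. ring. }
  assert (HGS : CI (fun x => G x * Cconj (S x))%C = (RtoC (2 * PI) * T)%C).
  { rewrite Hpair by assumption. unfold T. rewrite <- csum_scal. apply csum_ext. intros; ring. }
  assert (HSS : CI (fun x => S x * Cconj (S x))%C = (RtoC (2 * PI) * T)%C).
  { rewrite Hpair by assumption. unfold T. rewrite <- csum_scal. apply csum_ext.
    intros k Hk. rewrite HScoef by assumption. ring. }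
  assert (HSG : CI (fun x => S x * Cconj (G x))%C = Cconj (RtoC (2 * PI) * T)%C).
  { rewrite <- HGS, <- CI_conj by (apply ccont_mult; [assumption|now apply ccont_conj]).
    apply CI_ext. intros x. rewrite Cmult_conj, Cconj_conj. ring. }
  assert (HH : CI (fun x => (G x - S x) * Cconj (G x - S x))%C
    = (CI (fun x => G x * Cconj (G x)) - Cconj (RtoC (2 * PI) * T))%C).
  { rewrite (CI_ext _ (fun x => (G x * Cconj (G x) - G x * Cconj (S x))
        - (S x * Cconj (G x) - S x * Cconj (S x)))%C)
      by (intros x; rewrite Cminus_conj; ring).
    rewrite !CI_minus, HGS, HSS, HSG; [ring| | | | | |];
      ccont_auto. }
  assert (Hpos : 0 <= fst (CI (fun x => (G x - S x) * Cconj (G x - S x))%C)).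
  { unfold CI; cbn [fst]. apply RInt_ge_0; [lra| |].
    - assert (Hc : ccont (fun x => (G x - S x) * Cconj (G x - S x))%C) by ccont_auto.
      apply ex_RInt_cont. intros x. exact (proj1 (Hc x)).
    - intros x _. rewrite fst_mul_conj. apply pow2_ge_0. }
  rewrite HH in Hpos.
  assert (Hle : fst (CI (fun x => G x * Cconj (G x))%C) <= 2 * PI * M ^ 2).
  { unfold CI; cbn [fst]. eapply Rle_trans; [apply Rle_abs|]. apply RInt_abs_bound.
    - assert (Hc : ccont (fun x => G x * Cconj (G x))%C) by ccont_auto.
      intros x. exact (proj1 (Hc x)).
    - intros x. rewrite fst_mul_conj, Rabs_pos_eq by apply pow2_ge_0.
      apply pow_incr. split; [apply Cmod_ge_0|auto]. }
  assert (HT : fst (Cconj (RtoC (2 * PI) * T)%C) = 2 * PI * rsum n (fun k => Cmod (cf G k) ^ 2)).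
  { cbn [Cconj fst snd RtoC Cmult]. unfold T. rewrite fst_csum.
    rewrite Rmult_0_l, Rminus_0_r. f_equal.
    apply Rle_antisym; apply rsum_le; intros k _; rewrite fst_mul_conj; lra. }
  unfold Cminus, Cplus, Copp in Hpos; cbn [fst] in Hpos. rewrite HT in Hpos.
  apply (Rmult_le_reg_l (2 * PI)); lra.
Qed.

(** * Smooth periodic functions and the decay of their Fourier coefficients *)

Lemma periodic_Z (f : R -> R) :
  (forall x, f (x + 2 * PI) = f x) -> forall k x, f (x + IZR k * (2 * PI)) = f x.
Proof.
  intros H.
  assert (Hn : forall (n : nat) x, f (x + INR n * (2 * PI)) = f x).
  { induction n as [|n IH]; intros x.
    - f_equal. simpl. ring.
    - rewrite S_INR. replace (x + (INR n + 1) * (2 * PI)) with (x + INR n * (2 * PI) + 2 * PI) by ring.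
      now rewrite H. }
  intros k x. destruct (Z_le_gt_dec 0 k) as [Hk|Hk].
  - rewrite <- (Z2Nat.id k), <- INR_IZR_INZ by lia. apply Hn.
  - rewrite <- (Hn (Z.to_nat (- k))). f_equal.
    rewrite INR_IZR_INZ, Z2Nat.id, opp_IZR by lia. ring.
Qed.

Lemma periodic_bounded (f : R -> R) :
  (forall x, f (x + 2 * PI) = f x) -> (forall x, continuous f x) ->
  exists M, 0 <= M /\ forall x, Rabs (f x) <= M.
Proof.
  intros Hp Hc. pose proof PI_RGT_0.
  assert (Hc' : forall x, 0 <= x <= 2 * PI -> continuity_pt f x)
    by (intros; apply continuity_pt_filterlim, Hc).
  destruct (continuity_ab_maj f 0 (2 * PI)) as [a [Ha _]]; [lra|auto|].
  destruct (continuity_ab_min f 0 (2 * PI)) as [b [Hb _]]; [lra|auto|].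
  exists (Rabs (f a) + Rabs (f b)). split.
  - pose proof (Rabs_pos (f a)); pose proof (Rabs_pos (f b)); lra.
  - intros x. set (k := Int_part (x / (2 * PI))).
    destruct (base_Int_part (x / (2 * PI))) as [H1 H2]. fold k in H1, H2.
    rewrite <- (periodic_Z f Hp (- k) x). rewrite opp_IZR.
    set (y := x + - IZR k * (2 * PI)).
    assert (Hy : 0 <= y <= 2 * PI).
    { unfold y. replace x with (x / (2 * PI) * (2 * PI)) by (field; lra).
      split; nra. }
    specialize (Ha y Hy). specialize (Hb y Hy). apply Rabs_le.
    pose proof (Rle_abs (f a)). pose proof (Rabs_pos (f a)). pose proof (Rabs_pos (f b)).
    pose proof (Rle_abs (- f b)). rewrite Rabs_Ropp in *. lra.
Qed.

Lemma smooth_is_derive v x : smooth_periodic v -> is_derive v x (Derive v x).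
Proof. intros [H _]. apply Derive_correct. apply (H 1%nat x). Qed.

Lemma smooth_continuous v x : smooth_periodic v -> continuous v x.
Proof. intros H. eapply is_derive_continuous. now apply smooth_is_derive. Qed.

Lemma smooth_Derive v : smooth_periodic v -> smooth_periodic (Derive v).
Proof.
  intros Hv. pose proof Hv as [H Hp]. split.
  - intros [|n] x; [exact I|].
    apply (ex_derive_ext (Derive_n v (S n))).
    + intros t. rewrite <- (Nat.add_1_r n). symmetry. apply (Derive_n_comp v n 1 t).
    + apply (H (S (S n)) x).
  - intros x. transitivity (Derive (fun x => v (x + 2 * PI)) x); [|apply Derive_ext, Hp].
    symmetry. apply is_derive_unique.
    replace (Derive v (x + 2 * PI)) with (scal 1 (Derive v (x + 2 * PI)))
      by (unfold scal; cbn; unfold mult; cbn; ring).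
    apply (is_derive_comp v (fun x => x + 2 * PI)); [now apply smooth_is_derive|].
    auto_derive; auto.
Qed.

Lemma smooth_bounded v : smooth_periodic v -> exists M, 0 <= M /\ forall x, Rabs (v x) <= M.
Proof.
  intros H. apply periodic_bounded; [apply H|]. intros; now apply smooth_continuous.
Qed.

Lemma fourier_Derive v n :
  smooth_periodic v -> fourier (Derive v) n = (Ci * RtoC (IZR n) * fourier v n)%C.
Proof.
  intros Hv. pose proof (smooth_Derive v Hv) as Hv'.
  assert (Hc : forall w, smooth_periodic w -> ccont (fun x => RtoC (w x)))
    by (intros w Hw; apply ccont_RtoC; intros; now apply smooth_continuous).
  rewrite !fourier_cf by (intros; now apply smooth_continuous).
  set (F := fun x => (RtoC (v x) * cis (- (IZR n * x)))%C).
  assert (HF : forall x, cder F x (RtoC (Derive v x) * cis (- (IZR n * x))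
      - (Ci * RtoC (IZR n)) * (RtoC (v x) * cis (- (IZR n * x))))%C).
  { intros x. eapply cder_eq.
    - apply (cder_mult (fun x => RtoC (v x)) (fun x => cis (- (IZR n * x))) x (RtoC (Derive v x))
        (Ci * RtoC (- IZR n) * cis (- (IZR n * x)))%C).
      + split; cbn; [now apply smooth_is_derive|apply @is_derive_const].
      + apply (cder_cis (fun y => - (IZR n * y))). auto_derive; [auto|ring].
    - rewrite RtoC_opp. ring. }
  assert (H : CI (fun x => RtoC (Derive v x) * cis (- (IZR n * x))
      - (Ci * RtoC (IZR n)) * (RtoC (v x) * cis (- (IZR n * x))))%C = RtoC 0).
  { rewrite (CI_deriv F _ HF).
    - unfold F. rewrite <- (proj2 Hv 0), Rplus_0_l, Rmult_0_r, Ropp_0, cis_0.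
      rewrite <- cis_conj, cis_2PI_Z. unfold Cconj, RtoC, Cminus, Cmult, Cplus, Copp; cbn.
      f_equal; ring.
    - ccont_auto; apply Hc; assumption. }
  rewrite CI_minus, CI_scal, !CI_cf in H.
  2-4: ccont_auto; apply Hc; assumption.
  set (a := cf (fun x => RtoC (Derive v x)) n) in *. set (b := cf (fun x => RtoC (v x)) n) in *.
  replace a with (/ RtoC (2 * PI) * ((RtoC (2 * PI) * a - Ci * IZR n * (RtoC (2 * PI) * b))
    + Ci * IZR n * (RtoC (2 * PI) * b)))%C.
  - rewrite H. pose proof twoPI_neq_0. field. assumption.
  - pose proof twoPI_neq_0. field. assumption.
Qed.

(** Each derivative gains a factor |n|, and 1 + |n| <= 2 |n| for n nonzero; the zero mode is covered
    by the sup-norm constant D0. The induction is over all functions since it is applied to the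
    derivative of [v]. *)
Lemma fourier_decay q : forall v, smooth_periodic v ->
  exists D, 0 <= D /\ forall n, Cmod (fourier v n) <= D * / br n ^ q.
Proof.
  assert (Hb : forall v, smooth_periodic v -> exists D, 0 <= D /\ forall n, Cmod (fourier v n) <= D).
  { intros v Hv. destruct (smooth_bounded v Hv) as [M [HM H]].
    exists (2 * M). split; [lra|]. intros n.
    rewrite fourier_cf by (intros; now apply smooth_continuous).
    apply cf_bound; [apply ccont_RtoC; intros; now apply smooth_continuous|].
    intros x. rewrite Cmod_R. apply H. }
  induction q as [|q IH]; intros v Hv; destruct (Hb v Hv) as [D0 [HD0 H0]].
  - exists D0. split; [assumption|]. intros n. cbn [pow]. rewrite Rinv_1, Rmult_1_r. auto.
  - destruct (IH (Derive v) (smooth_Derive v Hv)) as [D [HD H]].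
    exists (D0 + 2 * D). split; [lra|]. intros n.
    destruct (Z.eq_dec n 0) as [->|Hn].
    + replace (br 0) with 1 by (unfold br; simpl; ring). rewrite pow1, Rinv_1.
      specialize (H0 0%Z). lra.
    + specialize (H n). rewrite fourier_Derive, !Cmod_mult, Cmod_Ci, Cmod_R, Rmult_1_l in H by assumption.
      assert (Hn1 : 1 <= Rabs (IZR n)) by (rewrite <- abs_IZR; apply IZR_le; lia).
      assert (Hbr : br n = 1 + Rabs (IZR n)) by (unfold br; now rewrite abs_IZR).
      apply (Rmult_le_reg_l (br n)); [apply br_pos|].
      replace (br n * ((D0 + 2 * D) * / br n ^ S q)) with ((D0 + 2 * D) * / br n ^ q)
        by (cbn [pow]; field; split; apply Rgt_not_eq; [apply br_pow_pos|apply br_pos]).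
      pose proof (inv_br_pow_pos n q). pose proof (Cmod_ge_0 (fourier v n)).
      assert (br n * Cmod (fourier v n) <= 2 * (Rabs (IZR n) * Cmod (fourier v n)))
        by (rewrite Hbr; nra).
      assert (0 <= D0 * / br n ^ q) by (apply Rmult_le_pos; lra). lra.
Qed.

Lemma rsum_bounded_term_small (f : Z -> R) B :
  (forall k, 0 <= f k) -> (forall n, rsum n f <= B) ->
  forall eps, 0 < eps -> exists n0 : nat, forall k, (Z.of_nat n0 <= Z.abs k)%Z -> f k < eps.
Proof.
  intros Hf HB eps He.
  assert (Hg : Un_growing (fun n => rsum n f))
    by (intros n; apply rsum_incr; auto).
  assert (Hub : has_ub (fun n => rsum n f)).
  { exists B. intros x [n ->]. apply HB. }
  destruct (growing_cv _ Hg Hub) as [l Hl].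
  destruct (CV_Cauchy _ (exist _ l Hl) eps He) as [N HN].
  assert (Hstep : forall n, (N <= n)%nat -> f (Z.of_nat n) < eps /\ f (- Z.of_nat (S n))%Z < eps).
  { intros n Hn. specialize (HN (S n) n ltac:(lia) ltac:(lia)). unfold Rdist in HN. cbn [rsum] in HN.
    pose proof (Hf (Z.of_nat n)). pose proof (Hf (- Z.of_nat (S n))%Z).
    apply Rabs_def2 in HN. lra. }
  exists (S N). intros k Hk. destruct (Z_le_gt_dec 0 k).
  - replace k with (Z.of_nat (Z.to_nat k)) by lia. apply Hstep. lia.
  - replace k with (- Z.of_nat (S (Z.to_nat (- k) - 1)))%Z by lia. apply Hstep. lia.
Qed.

(** By Bessel's inequality the squared coefficients have bounded partial sums, hence tend to 0. *)
Lemma riemann_lebesgue G M :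
  ccont G -> (forall x, Cmod (G x) <= M) ->
  forall eps, 0 < eps -> exists n0 : nat, forall k, (Z.of_nat n0 <= Z.abs k)%Z -> Cmod (cf G k) < eps.
Proof.
  intros HG HM eps He.
  destruct (rsum_bounded_term_small (fun k => Cmod (cf G k) ^ 2) (M ^ 2)
    (fun k => pow2_ge_0 _) (fun n => bessel G M n HG HM) (eps ^ 2)) as [n0 Hn0].
  - now apply pow_lt.
  - exists n0. intros k Hk. specialize (Hn0 k Hk). pose proof (Cmod_ge_0 (cf G k)). nra.
Qed.

(** * Pointwise Fourier inversion by Chernoff's quotient *)

Lemma slope_continuous (f : R -> R) d :
  is_derive f 0 d -> f 0 = 0 ->
  continuous (fun x => if Req_EM_T x 0 then d else f x / x) 0.
Proof.
  intros Hf H0. apply is_derive_Reals in Hf.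
  apply filterlim_locally. intros eps. destruct (Hf eps (cond_pos eps)) as [del Hdel].
  exists del. intros y Hy. change (Rabs (y - 0) < del) in Hy. rewrite Rminus_0_r in Hy.
  destruct (Req_EM_T 0 0) as [_|]; [|lra].
  destruct (Req_EM_T y 0) as [->|Hy0]; [apply ball_center|].
  specialize (Hdel y Hy0 Hy). rewrite Rplus_0_l, H0, Rminus_0_r in Hdel. exact Hdel.
Qed.

(* [- cotq / 2] is the imaginary part of the Chernoff quotient
   [(v x - v x0) / (cis (x - x0) - 1)], with its removable singularities filled in. *)
Definition cotq (v : R -> R) (x0 x : R) : R :=
  if Req_EM_T (sin ((x - x0) / 2)) 0 then 2 * Derive v x0
  else (v x - v x0) * cos ((x - x0) / 2) / sin ((x - x0) / 2).

Lemma cotq_periodic v x0 x : smooth_periodic v -> cotq v x0 (x + 2 * PI) = cotq v x0 x.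
Proof.
  intros Hv. unfold cotq. rewrite (proj2 Hv).
  replace (x + 2 * PI - x0) with ((x - x0) + 2 * PI) by ring.
  replace (((x - x0) + 2 * PI) / 2) with ((x - x0) / 2 + PI) by field.
  rewrite neg_sin, neg_cos.
  destruct (Req_EM_T (- sin ((x - x0) / 2)) 0), (Req_EM_T (sin ((x - x0) / 2)) 0);
    try reflexivity; try lra. field; lra.
Qed.

(** Dividing numerator and denominator by x - x0 leaves the slopes [A] of [v] and [B] of sin (x /
    2), both continuous at 0, with B 0 = 1 / 2. The neighbourhood of radius pi contains no other
    zero of the sine. *)
Lemma cotq_continuous_x0 v x0 : smooth_periodic v -> continuous (cotq v x0) x0.
Proof.
  intros Hv. pose proof PI_RGT_0.
  set (A := fun x => if Req_EM_T x 0 then Derive v x0 else (v (x + x0) - v x0) / x).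
  set (B := fun x => if Req_EM_T x 0 then / 2 else sin (x / 2) / x).
  assert (HA : continuous A 0).
  { apply (slope_continuous (fun x => v (x + x0) - v x0)).
    - assert (Hd : is_derive v (0 + x0) (Derive v x0))
        by (rewrite Rplus_0_l; now apply smooth_is_derive).
      replace (Derive v x0) with (scal 1 (Derive v x0) - 0)
        by (unfold scal; cbn; unfold mult; cbn; ring).
      apply (is_derive_minus (fun x => v (x + x0)) (fun _ => v x0)); [|apply @is_derive_const].
      apply (is_derive_comp v (fun x => x + x0)); [exact Hd|auto_derive; auto].
    - rewrite Rplus_0_l. ring. }
  assert (HB : continuous B 0).
  { apply (slope_continuous (fun x => sin (x / 2))).
    - auto_derive; [auto|]. replace (0 * / 2) with 0 by ring. rewrite cos_0. field.
    - replace (0 / 2) with 0 by field. apply sin_0. }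
  assert (HB0 : B 0 = / 2) by (unfold B; destruct (Req_EM_T 0 0); lra).
  apply (continuous_ext_loc _ (fun x => A (x - x0) * / B (x - x0) * cos ((x - x0) / 2))).
  - exists (mkposreal PI H). intros x Hx. change (Rabs (x - x0) < PI) in Hx.
    unfold A, B, cotq. match goal with |- ?a = ?b => change (@eq R a b) end.
    destruct (Req_EM_T (x - x0) 0) as [E|E].
    + rewrite E. replace (0 / 2) with 0 by field. rewrite sin_0, cos_0.
      destruct (Req_EM_T 0 0); [field|lra].
    + assert (Hs : sin ((x - x0) / 2) <> 0).
      { apply Rabs_def2 in Hx. destruct (Rlt_dec 0 (x - x0)).
        - apply Rgt_not_eq, sin_gt_0; lra.
        - replace ((x - x0) / 2) with (- ((x0 - x) / 2)) by field. rewrite sin_neg.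
          assert (0 < sin ((x0 - x) / 2)) by (apply sin_gt_0; lra). lra. }
      destruct (Req_EM_T (sin ((x - x0) / 2)) 0); [lra|].
      assert (Exx : forall z : R, z - x0 + x0 = z) by (intros; ring). rewrite Exx.
      field. split; assumption.
  - assert (Hshift : continuous (fun x => x - x0) x0).
    { apply continuous_Rminus; [apply continuous_id|apply continuous_const]. }
    assert (E0 : x0 - x0 = 0) by ring.
    apply continuous_Rmult; [apply continuous_Rmult|].
    + apply (continuous_comp (fun x => x - x0) A); [assumption|]. now rewrite E0.
    + apply (continuous_comp (fun x => x - x0) (fun y => / B y)); [assumption|]. rewrite E0.
      apply (continuous_comp B Rinv); [assumption|]. rewrite HB0.
      apply continuity_pt_filterlim, (continuity_pt_inv (fun x => x)); [|lra].
      apply derivable_continuous_pt, derivable_pt_id.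
    + apply continuous_cos_R, continuous_Rmult; [assumption|apply continuous_const].
Qed.

Lemma sin_half_zero tau : sin (tau / 2) = 0 -> exists l : Z, tau = IZR l * (2 * PI).
Proof.
  intros H. apply sin_eq_0_0 in H. destruct H as [l Hl]. exists l. lra.
Qed.

(** The zeros of the sine are the translates of [x0] by whole periods, so periodicity brings them
    back to [x0]; elsewhere the sine stays nonzero nearby. *)
Lemma cotq_continuous v x0 x : smooth_periodic v -> continuous (cotq v x0) x.
Proof.
  intros Hv. destruct (Req_EM_T (sin ((x - x0) / 2)) 0) as [E|E].
  - apply sin_half_zero in E. destruct E as [l Hl].
    apply (continuous_ext (fun y => cotq v x0 (y + IZR (- l) * (2 * PI)))).
    + intros y. apply periodic_Z. intros; now apply cotq_periodic.
    + apply (continuous_comp (fun y => y + IZR (- l) * (2 * PI)) (cotq v x0)).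
      * apply continuous_Rplus; [apply continuous_id|apply continuous_const].
      * replace (x + IZR (- l) * (2 * PI)) with x0 by (rewrite opp_IZR; lra).
        now apply cotq_continuous_x0.
  - assert (Hh : continuous (fun y => (y - x0) / 2) x).
    { apply continuous_Rmult; [|apply continuous_const].
      apply continuous_Rminus; [apply continuous_id|apply continuous_const]. }
    assert (Hs : continuous (fun y => sin ((y - x0) / 2)) x).
    { now apply continuous_sin_R. }
    apply (continuous_ext_loc _ (fun y => (v y - v x0) * cos ((y - x0) / 2) * / sin ((y - x0) / 2))).
    + assert (Hpos : 0 < Rabs (sin ((x - x0) / 2))) by now apply Rabs_pos_lt.
      apply (filter_imp (fun y => ball (sin ((x - x0) / 2)) (mkposreal _ Hpos) (sin ((y - x0) / 2)))).
      * intros y Hy. unfold cotq. destruct (Req_EM_T (sin ((y - x0) / 2)) 0) as [E'|]; [|reflexivity].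
        rewrite E' in Hy. change (Rabs (0 - sin ((x - x0) / 2)) < Rabs (sin ((x - x0) / 2))) in Hy.
        rewrite Rminus_0_l, Rabs_Ropp in Hy. lra.
      * apply (Hs (fun z => ball (sin ((x - x0) / 2)) (mkposreal _ Hpos) z)). apply locally_ball.
    + apply continuous_Rmult; [apply continuous_Rmult|].
      * apply continuous_Rminus; [now apply smooth_continuous|apply continuous_const].
      * now apply continuous_cos_R.
      * apply (continuous_comp (fun y => sin ((y - x0) / 2)) Rinv); [assumption|].
        apply continuity_pt_filterlim, (continuity_pt_inv (fun x => x)); [|assumption].
        apply derivable_continuous_pt, derivable_pt_id.
Qed.

(** With h = (x - x0) / 2 one has 1 / (e^{2ih} - 1) = - 1/2 - (i/2) cot h. Where sin h = 0 both
    sides vanish, by periodicity of [v]. *)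
Lemma chernoff_quotient v x0 x : smooth_periodic v ->
  RtoC (v x - v x0) = (((- (v x - v x0) / 2)%R, (- cotq v x0 x / 2)%R) * (cis (x - x0) - 1))%C.
Proof.
  intros Hv. unfold cotq.
  set (h := (x - x0) / 2). replace (x - x0) with (2 * h) by (unfold h; field).
  destruct (Req_EM_T (sin h) 0) as [E|E].
  - assert (Ex : v x = v x0).
    { apply sin_half_zero in E. destruct E as [l Hl].
      replace x with (x0 + IZR l * (2 * PI)) by lra. apply periodic_Z, Hv. }
    assert (Ec : cis (2 * h) = RtoC 1).
    { pose proof (sin2_cos2 h) as H1. rewrite E in H1. unfold Rsqr in H1.
      unfold cis. rewrite cos_2a, sin_2a, E. unfold RtoC. f_equal; lra. }
    rewrite Ec, Ex. apply injective_projections; cbn [RtoC fst snd Cmult Cminus Cplus Copp]; field.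
  - unfold cis. rewrite cos_2a, sin_2a.
    assert (H1 : sin h * sin h + cos h * cos h = 1) by (pose proof (sin2_cos2 h); unfold Rsqr in *; lra).
    set (a := v x - v x0). set (q := a * cos h / sin h).
    assert (Hq : q * sin h = a * cos h) by (unfold q; field; assumption).
    clearbody q. apply injective_projections; cbn [RtoC fst snd Cmult Cminus Cplus Copp].
    + transitivity (a / 2 * (1 + sin h * sin h - cos h * cos h) + q * sin h * cos h); [|field].
      rewrite Hq. replace (sin h * sin h) with (1 - cos h * cos h) by lra. field.
    + transitivity (- (q * sin h) * sin h * - 1 - a * cos h * sin h).
      * rewrite Hq. ring.
      * transitivity (- a * (sin h * cos h) + q / 2 * ((sin h * sin h + cos h * cos h)
          + (sin h * sin h - cos h * cos h))); [field|]. rewrite H1. field.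
Qed.

Section Inversion.

Variables (v : R -> R) (Hv : smooth_periodic v) (x0 : R).

Let g (x : R) : C := ((- (v x - v x0) / 2)%R, (- cotq v x0 x / 2)%R).

Let g_cont : ccont g.
Proof.
  intros x. split; cbn; (apply continuous_Rmult; [|apply continuous_const]).
  - apply (continuous_opp (fun x => v x - v x0)). apply continuous_Rminus.
    + now apply smooth_continuous.
    + apply continuous_const.
  - apply (continuous_opp (cotq v x0)). now apply cotq_continuous.
Qed.

Lemma chernoff_bounded : exists M, forall x, Cmod (g x) <= M.
Proof.
  destruct (smooth_bounded v Hv) as [M1 [_ H1]].
  destruct (periodic_bounded (cotq v x0)) as [M2 [_ H2]].
  - intros; now apply cotq_periodic.
  - intros; now apply cotq_continuous.
  - exists (2 * M1 + M2). intros x. eapply Rle_trans; [apply Cmod_le_sum|]. unfold g; cbn [fst snd].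
    pose proof (H1 x). pose proof (H1 x0). pose proof (H2 x).
    assert (Rabs (- (v x - v x0) / 2) <= M1).
    { apply Rabs_le. repeat match goal with H : Rabs _ <= _ |- _ => apply Rabs_le_between in H end. lra. }
    assert (Rabs (- cotq v x0 x / 2) <= M2).
    { apply Rabs_le. repeat match goal with H : Rabs _ <= _ |- _ => apply Rabs_le_between in H end. lra. }
    pose proof (Rabs_pos (v x)). lra.
Qed.

Let gam (l : Z) : C := (cis (IZR l * x0) * cf g l)%C.

(** In v(x) = v(x0) + g(x) (e^{i(x - x0)} - 1) multiplication by e^{ix} shifts Fourier indices by
    one, so the terms of the Fourier series of [v] at [x0] become differences of consecutive
    [gam]. *)
Lemma fourier_telescope l :
  (fourier v l * cis (IZR l * x0))%C = (RtoC (v x0) * delta 0 l + (gam (l - 1) - gam l))%C.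
Proof.
  rewrite fourier_cf by (intros; now apply smooth_continuous).
  assert (H : cf (fun x => RtoC (v x)) l
    = (RtoC (v x0) * delta 0 l + (cis (- x0) * cf g (l - 1) - cf g l))%C).
  { unfold cf. rewrite (CI_ext _ (fun x => RtoC (v x0) * cis (IZR (- l) * x)
      + (cis (- x0) * (g x * cis (- (IZR (l - 1) * x))) - g x * cis (- (IZR l * x))))%C).
    - rewrite CI_plus, CI_minus, !CI_scal, CI_cis.
      2-7: ccont_auto.
      replace (delta 0 (- l)) with (delta 0 l)
        by (unfold delta; destruct (Z.eq_dec l 0), (Z.eq_dec (- l) 0); try reflexivity; lia).
      rewrite !RtoC_mult. assert (RtoC 2 * RtoC PI <> 0)%C by (rewrite <- RtoC_mult; apply twoPI_neq_0).
      assert (RtoC PI <> 0) by (intros E; rewrite E in H; apply H; ring).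
      assert (RtoC 2 <> 0) by (intros E; rewrite E in H; apply H; ring).
      field; assumption.
    - intros x. assert (Ex : RtoC (v x) = (RtoC (v x0) + g x * (cis (x - x0) - 1))%C).
      { unfold g. rewrite <- (chernoff_quotient v x0 x Hv), RtoC_minus. ring. }
      rewrite Ex.
      replace (cis (IZR (- l) * x)) with (cis (- (IZR l * x))) by (f_equal; rewrite opp_IZR; ring).
      replace (cis (- (IZR (l - 1) * x))) with (cis x * cis (- (IZR l * x)))%C
        by (rewrite <- cis_plus; f_equal; rewrite minus_IZR; ring).
      replace (cis (x - x0)) with (cis x * cis (- x0))%C by (rewrite <- cis_plus; f_equal; ring).
      ring. }
  rewrite H. unfold gam.
  replace (cis (IZR (l - 1) * x0)) with (cis (IZR l * x0) * cis (- x0))%C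
    by (rewrite <- cis_plus; f_equal; rewrite minus_IZR; ring).
  unfold delta. destruct (Z.eq_dec l 0) as [->|]; [|ring].
  rewrite Rmult_0_l, cis_0. ring.
Qed.

Lemma fourier_partial_sum k n :
  csum n (fun m => fourier v (k - m) * cis (IZR (k - m) * x0))%C
  = (RtoC (v x0) * csum n (fun m => 1 * delta k m)
     + (gam (k - Z.of_nat n) - gam (k + Z.of_nat n)))%C.
Proof.
  induction n as [|n IH]; cbn [csum].
  - replace (k - Z.of_nat 0)%Z with (k + Z.of_nat 0)%Z by lia. ring.
  - rewrite IH, !fourier_telescope.
    replace (k - Z.of_nat n - 1)%Z with (k - Z.of_nat (S n))%Z by lia.
    replace (k - - Z.of_nat (S n) - 1)%Z with (k + Z.of_nat n)%Z by lia.
    replace (k - - Z.of_nat (S n))%Z with (k + Z.of_nat (S n))%Z by lia.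
    replace (delta 0 (k - Z.of_nat n)) with (delta k (Z.of_nat n))
      by (unfold delta; destruct (Z.eq_dec (Z.of_nat n) k), (Z.eq_dec (k - Z.of_nat n) 0); try reflexivity; lia).
    replace (delta 0 (k + Z.of_nat (S n))) with (delta k (- Z.of_nat (S n)))
      by (unfold delta; destruct (Z.eq_dec (- Z.of_nat (S n)) k), (Z.eq_dec (k + Z.of_nat (S n)) 0);
          try reflexivity; lia).
    ring.
Qed.

(** The limit is identified by telescoping and the Riemann-Lebesgue lemma for the bounded continuous
    [g]; the rate, uniform in [x0], comes from the decay of the coefficients alone. The window is
    centred at 0 in [m], not in k - m, because a truncated matrix row has this shape. *)
Lemma fourier_inversion D k n :
  (forall l, Cmod (fourier v l) <= D * / br l ^ 3) ->
  Cmod (RtoC (v x0) - csum n (fun m => fourier v (k - m) * cis (IZR (k - m) * x0))%C)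
    <= 4 * D * br k / (INR n + 1).
Proof.
  intros HD.
  destruct (zsum_shift (fun m => fourier v (k - m) * cis (IZR (k - m) * x0))%C k D) as [Hc [Ht _]].
  { intros m. rewrite Cmod_mult, Cmod_cis, Rmult_1_r. apply HD. }
  replace (RtoC (v x0)) with (zsum (fun m => fourier v (k - m) * cis (IZR (k - m) * x0))%C);
    [apply Ht|].
  apply (cconv_unique _ _ _ Hc). intros eps He.
  destruct chernoff_bounded as [M HM].
  destruct (riemann_lebesgue g M g_cont HM (eps / 2)) as [n0 Hn0]; [lra|].
  exists (n0 + Z.to_nat (Z.abs k) + 1)%nat. intros q Hq.
  rewrite fourier_partial_sum, csum_delta by lia.
  replace (RtoC (v x0) * 1 + (gam (k - Z.of_nat q) - gam (k + Z.of_nat q)) - RtoC (v x0))%C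
    with (gam (k - Z.of_nat q) - gam (k + Z.of_nat q))%C by ring.
  eapply Rle_lt_trans; [apply Cmod_triangle|]. rewrite Cmod_opp. unfold gam.
  rewrite !Cmod_mult, !Cmod_cis, !Rmult_1_l.
  pose proof (Hn0 (k - Z.of_nat q)%Z ltac:(lia)). pose proof (Hn0 (k + Z.of_nat q)%Z ltac:(lia)). lra.
Qed.

End Inversion.

(** * Pairings of solutions *)

Section Pairing.

Variables (X Y lX lY : R -> Z -> C) (A B : R -> Z -> Z -> C) (chi : Z -> C).
Variables (t CX CY E : R) (G g : R -> R).
Hypothesis Ht : 0 <= t.
Hypothesis HE : 0 <= E.
Hypothesis HCX : 0 <= CX.
Hypothesis HCY : 0 <= CY.
Hypothesis Hchi : forall k, Cmod (chi k) <= 1.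
Hypothesis HX : forall s k, 0 <= s <= t -> Cmod (X s k) <= CX.
Hypothesis HY : forall s k, 0 <= s <= t -> Cmod (Y s k) <= CY * / br k ^ 3.
Hypothesis HdX : forall s k, 0 <= s <= t -> cder (fun s => X s k) s (- Ci * lX s k)%C.
Hypothesis HdY : forall s k, 0 <= s <= t -> cder (fun s => Y s k) s (- Ci * lY s k)%C.
Hypothesis HlX : forall s k n, 0 <= s <= t ->
  Cmod (lX s k - csum n (fun m => A s k m * X s m)%C) <= E * br k / (INR n + 1).
Hypothesis HlY : forall s k n, 0 <= s <= t ->
  Cmod (lY s k - csum n (fun m => B s k m * Y s m)%C) <= E * / br k ^ 2 / (INR n + 1).
Hypothesis HG : forall s, 0 <= s <= t -> is_derive G s (g s).
Hypothesis Hg : forall s n, 0 <= s <= t ->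
  Cmod (csum n (fun k => csum n (fun m =>
    Cconj (X s m) * Y s k * (chi k * Cconj (A s k m) - chi m * B s m k))%C)) <= g s.

(** The sequences play different roles: [X] is only bounded, [Y] decays. The generators enter
    through truncated matrix sums with explicit errors, so every exchange of sums is finite. *)
Definition pairing n s : C := csum n (fun k => chi k * (Cconj (X s k) * Y s k))%C.

Lemma pairing_cder n s : 0 <= s <= t ->
  cder (pairing n) s
    (Ci * csum n (fun k => chi k * (Cconj (lX s k) * Y s k - Cconj (X s k) * lY s k)))%C.
Proof.
  intros Hs. eapply cder_eq.
  - apply (cder_csum n (fun s k => chi k * (Cconj (X s k) * Y s k))%C). intros k.
    apply cder_scal, cder_mult; [apply cder_conj, HdX, Hs|apply HdY, Hs].
  - rewrite <- csum_scal. apply csum_ext. intros k _.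
    rewrite Cmult_conj, Copp_conj.
    replace (Cconj Ci) with (- Ci)%C by (unfold Cconj, Ci, Copp; cbn; f_equal; ring).
    ring.
Qed.

(** Renaming the indices in the second double sum brings out the common factor conj(X_m) Y_k. Its
    coefficient measures the failure of [A] to be the adjoint of [B], together with the commutator
    with the multiplier [chi]. *)
Lemma pairing_main n s :
  csum n (fun k => chi k * (Cconj (csum n (fun m => A s k m * X s m)) * Y s k
     - Cconj (X s k) * csum n (fun m => B s k m * Y s m)))%C
  = csum n (fun k => csum n (fun m =>
      Cconj (X s m) * Y s k * (chi k * Cconj (A s k m) - chi m * B s m k))%C).
Proof.
  rewrite (csum_ext n _ (fun k => csum n (fun m => chi k * Cconj (A s k m) * Cconj (X s m) * Y s k)
     - csum n (fun m => chi k * Cconj (X s k) * B s k m * Y s m))%C).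
  - rewrite csum_minus.
    rewrite (csum_switch n n (fun k m => chi k * Cconj (X s k) * B s k m * Y s m)%C).
    rewrite <- csum_minus. apply csum_ext. intros k _. rewrite <- csum_minus.
    apply csum_ext. intros m _. ring.
  - intros k _. rewrite csum_conj, <- csum_scal_r, <- csum_scal, <- csum_minus, <- csum_scal, <- csum_minus.
    apply csum_ext. intros m _. rewrite Cmult_conj. ring.
Qed.

(** The truncation error of [lX] grows like [br k], but it meets the cubic decay of [Y]; that of
    [lY] decays quadratically and meets the bounded [X]. Both leave a summable [/ br k ^ 2], with
    sum at most 4. *)
Lemma pairing_der_bound n s : 0 <= s <= t ->
  Cmod (csum n (fun k => chi k * (Cconj (lX s k) * Y s k - Cconj (X s k) * lY s k))%C)
  <= g s + 4 * E * (CX + CY) / (INR n + 1).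
Proof.
  intros Hs. assert (Hn : 0 < INR n + 1) by (pose proof (pos_INR n); lra).
  set (aX := fun k => csum n (fun m => A s k m * X s m)%C).
  set (aY := fun k => csum n (fun m => B s k m * Y s m)%C).
  rewrite (csum_ext n _ (fun k => chi k * (Cconj (aX k) * Y s k - Cconj (X s k) * aY k)
    + chi k * (Cconj (lX s k - aX k) * Y s k - Cconj (X s k) * (lY s k - aY k)))%C)
    by (intros; rewrite Cminus_conj; ring).
  rewrite csum_plus. eapply Rle_trans; [apply Cmod_triangle|]. apply Rplus_le_compat.
  - unfold aX, aY. rewrite pairing_main. now apply Hg.
  - eapply Rle_trans; [apply (Cmod_csum_le _ _ (fun k => (E * (CX + CY) / (INR n + 1)) * / br k ^ 2))|].
    + intros k _. rewrite Cmod_mult. pose proof (Cmod_ge_0 (chi k)). pose proof (Hchi k).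
      pose proof (HlX s k n Hs) as H1. pose proof (HlY s k n Hs) as H2.
      pose proof (HX s k Hs) as H3. pose proof (HY s k Hs) as H4.
      fold (aX k) in H1. fold (aY k) in H2.
      assert (H5 : Cmod (Cconj (lX s k - aX k) * Y s k)%C <= (E * CY / (INR n + 1)) * / br k ^ 2).
      { rewrite Cmod_mult, Cmod_conj.
        replace (E * CY / (INR n + 1) * / br k ^ 2)
          with ((E * br k / (INR n + 1)) * (CY * / br k ^ 3))
          by (field; split; first [lra | apply Rgt_not_eq, br_pos]).
        apply Rmult_le_compat; auto using Cmod_ge_0. }
      assert (H6 : Cmod (Cconj (X s k) * (lY s k - aY k))%C <= (E * CX / (INR n + 1)) * / br k ^ 2).
      { rewrite Cmod_mult, Cmod_conj.
        replace (E * CX / (INR n + 1) * / br k ^ 2)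
          with (CX * (E * / br k ^ 2 / (INR n + 1)))
          by (field; split; first [lra | apply Rgt_not_eq, br_pos]).
        apply Rmult_le_compat; auto using Cmod_ge_0. }
      pose proof (Cmod_triangle (Cconj (lX s k - aX k) * Y s k)%C (- (Cconj (X s k) * (lY s k - aY k)))%C) as H7.
      rewrite Cmod_opp in H7. fold (Cconj (lX s k - aX k) * Y s k - Cconj (X s k) * (lY s k - aY k))%C in H7.
      replace (E * (CX + CY) / (INR n + 1) * / br k ^ 2)
        with (E * CY / (INR n + 1) * / br k ^ 2 + E * CX / (INR n + 1) * / br k ^ 2)
        by (field; split; first [lra | apply Rgt_not_eq, br_pos]).
      pose proof (Cmod_ge_0 (Cconj (lX s k - aX k) * Y s k - Cconj (X s k) * (lY s k - aY k))%C).
      nra.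
    + rewrite rsum_scal. pose proof (rsum_inv_br2_0 n).
      replace (4 * E * (CX + CY) / (INR n + 1)) with ((E * (CX + CY) / (INR n + 1)) * 4) by (field; lra).
      apply Rmult_le_compat_l; [|assumption].
      apply Rmult_le_pos; [nra|left; now apply Rinv_0_lt_compat].
Qed.

Lemma pairing_bound n :
  Cmod (pairing n t - pairing n 0) <= 2 * (G t - G 0 + 4 * E * (CX + CY) / (INR n + 1) * t).
Proof.
  set (c := 4 * E * (CX + CY) / (INR n + 1)).
  eapply Rle_trans; [apply (cder_bound (pairing n)
    (fun s => Ci * csum n (fun k => chi k * (Cconj (lX s k) * Y s k - Cconj (X s k) * lY s k)))%C
    (fun s => G s + c * s) (fun s => g s + c) 0 t Ht)|].
  - intros s Hs. apply pairing_cder, Hs.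
  - intros s Hs. apply (is_derive_plus G (fun s => c * s)); [now apply HG|].
    auto_derive; [auto|ring].
  - intros s Hs. rewrite Cmod_mult, Cmod_Ci, Rmult_1_l. now apply pairing_der_bound.
  - apply Req_le; ring.
Qed.

End Pairing.

Lemma decay_weaken z C k p q : (q <= p)%nat -> 0 <= C -> z <= C * / br k ^ p -> z <= C * / br k ^ q.
Proof.
  intros Hq HC Hz. eapply Rle_trans; [exact Hz|]. apply Rmult_le_compat_l; [assumption|].
  apply Rinv_le_contravar; [apply br_pow_pos|]. apply Rle_pow; [apply br_ge_1|assumption].
Qed.

Lemma Lop_tail K D p B f t k n :
  (3 <= p)%nat -> 0 <= D -> 0 <= B ->
  (forall t k m, Cmod (K t k m) <= D * / br (k - m) ^ (p + 3)) ->
  (forall m, Cmod (f m) <= B * / br m ^ p) ->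
  Cmod (Lop K t f k - csum n (fun m => K t k m * f m)%C) <= (4 * D * B) * / br k ^ 2 / (INR n + 1).
Proof.
  intros Hp HD HB HK Hf. destruct (Lop_conv K D p HD HK t f B k Hf) as [_ [H _]].
  eapply Rle_trans; [apply H|]. assert (Hn : 0 < INR n + 1) by (pose proof (pos_INR n); lra).
  apply Rmult_le_compat_r; [left; now apply Rinv_0_lt_compat|].
  replace p with (S (p - 1)) by lia. cbn [pow].
  replace (4 * (D * B * / (br k * br k ^ (p - 1))) * br k) with ((4 * D * B) * / br k ^ (p - 1))
    by (field; split; apply Rgt_not_eq; [apply br_pow_pos|apply br_pos]).
  apply (decay_weaken _ _ k (p - 1) 2); [lia| |lra]. repeat apply Rmult_le_pos; lra.
Qed.

(** Pairing [u] with itself, without cut-off: for a Hermitian matrix the double sum vanishes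
    identically, so only truncation errors remain and they disappear as the window grows. The
    initial pairing is 1 or 0 according to whether [N] lies in the window. *)
Lemma l2_bound (K : R -> Z -> Z -> C) D p N (u : R -> Z -> C) :
  (3 <= p)%nat -> 0 <= D ->
  (forall t k m, Cmod (K t k m) <= D * / br (k - m) ^ (p + 3)) ->
  (forall t k m, Cconj (K t k m) = K t m k) ->
  (forall k, u 0 k = delta N k) ->
  (forall T, exists B, 0 <= B /\ forall t k, Rabs t <= T -> Cmod (u t k) <= B * / br k ^ p) ->
  (forall t k, cder (fun s => u s k) t (- Ci * Lop K t (u t) k)%C) ->
  forall t n, 0 <= t -> rsum n (fun k => Cmod (u t k) ^ 2) <= 1.
Proof.
  intros Hp HD HK Hh Hu0 Hub Hud t n Ht.
  destruct (Hub t) as [B [HB Hu]].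
  assert (Hs : forall s, 0 <= s <= t -> Rabs s <= t) by (intros s Hs; rewrite Rabs_pos_eq; lra).
  set (E := 4 * D * B). assert (HE : 0 <= E) by (unfold E; repeat apply Rmult_le_pos; lra).
  assert (Hpair : forall n, Cmod (pairing u u (fun _ => RtoC 1) n t - pairing u u (fun _ => RtoC 1) n 0)
    <= 2 * (0 - 0 + 4 * E * (B + B) / (INR n + 1) * t)).
  { intros q. apply (pairing_bound u u (fun s k => Lop K s (u s) k) (fun s k => Lop K s (u s) k) K K
      (fun _ => RtoC 1) t B B E (fun _ => 0) (fun _ => 0)); auto.
    - intros _. rewrite Cmod_1. lra.
    - intros s k H. eapply Rle_trans; [apply (decay_weaken _ B k p 0); [lia|assumption|apply Hu; auto]|].
      cbn [pow]. rewrite Rinv_1. lra.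
    - intros s k H. apply (decay_weaken _ B k p 3); auto.
    - intros s k n' H. eapply Rle_trans; [apply (Lop_tail K D p B); auto|].
      apply Rmult_le_compat_r; [left; apply Rinv_0_lt_compat; pose proof (pos_INR n'); lra|].
      apply Rmult_le_compat_l; [assumption|]. pose proof (inv_br_pow_le_1 k 2). pose proof (br_ge_1 k). lra.
    - intros s k n' H. apply (Lop_tail K D p B); auto.
    - intros s _. apply @is_derive_const.
    - intros s n' H. rewrite (csum_ext n' _ (fun _ => 0 * 0)%C).
      + rewrite csum_scal, Cmult_0_l, Cmod_0. lra.
      + intros k _. rewrite (csum_ext n' _ (fun _ => 0 * 0)%C).
        * rewrite csum_scal. ring.
        * intros m _. rewrite Hh. ring. }
  assert (Hp0 : forall n, Cmod (pairing u u (fun _ => RtoC 1) n 0) <= 1).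
  { intros q. unfold pairing. rewrite (csum_ext q _ (fun k => 1 * delta N k)%C).
    - destruct (Z_le_dec (- Z.of_nat q) N) as [H1|H1]; [destruct (Z_lt_dec N (Z.of_nat q)) as [H2|H2]|].
      + rewrite csum_delta by lia. rewrite Cmod_1. lra.
      + rewrite csum_delta_out by lia. rewrite Cmod_0. lra.
      + rewrite csum_delta_out by lia. rewrite Cmod_0. lra.
    - intros k _. rewrite Hu0. unfold delta. destruct (Z.eq_dec k N);
        apply injective_projections; cbn; ring. }
  apply le_epsilon. intros eps He.
  destruct (inv_INR_small (2 * (4 * E * (B + B)) * t) eps He) as [q Hq].
  set (n' := Nat.max n q).
  apply Rle_trans with (rsum n' (fun k => Cmod (u t k) ^ 2)).
  - apply rsum_incr; [intros; apply pow2_ge_0|lia].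
  - replace (rsum n' (fun k => Cmod (u t k) ^ 2)) with (fst (pairing u u (fun _ => RtoC 1) n' t)).
    + eapply Rle_trans; [apply Rle_abs|]. eapply Rle_trans; [apply Rabs_fst_le|].
      replace (pairing u u (fun _ => RtoC 1) n' t)
        with (pairing u u (fun _ => RtoC 1) n' 0
          + (pairing u u (fun _ => RtoC 1) n' t - pairing u u (fun _ => RtoC 1) n' 0))%C by ring.
      eapply Rle_trans; [apply Cmod_triangle|]. specialize (Hp0 n'). specialize (Hpair n').
      assert (2 * (0 - 0 + 4 * E * (B + B) / (INR n' + 1) * t) <= 2 * (4 * E * (B + B)) * t / (INR q + 1)).
      { pose proof (pos_INR q). assert (INR q <= INR n') by (apply le_INR; lia).
        replace (2 * (0 - 0 + 4 * E * (B + B) / (INR n' + 1) * t))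
          with ((2 * (4 * E * (B + B)) * t) * / (INR n' + 1)) by (field; lra).
        apply Rmult_le_compat_l; [|apply Rinv_le_contravar; lra].
        repeat apply Rmult_le_pos; lra. }
      lra.
    + unfold pairing. rewrite fst_csum. apply Rle_antisym; apply rsum_le; intros k _;
        rewrite <- fst_mul_conj; apply Req_le; cbn; ring.
Qed.

(** * Non-stationary phase *)

Lemma RInt_point_0 (f : R -> R) a : RInt f a a = 0.
Proof. exact (RInt_point a f). Qed.

(* Integrating by parts twice against [e^{i Ph}] amounts to the explicit primitive [P] below. *)
Lemma nonstationary_phase (phi phi1 phi2 Ph h h1 h2 : R -> R) a B kap :
  0 < a -> 0 <= B -> 0 <= kap ->
  (forall y, is_derive phi y (phi1 y)) -> (forall y, is_derive phi1 y (phi2 y)) ->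
  (forall y, is_derive Ph y (h y)) -> (forall y, is_derive h y (h1 y)) ->
  (forall y, is_derive h1 y (h2 y)) ->
  (forall y, Rabs (phi y) <= B) -> (forall y, Rabs (phi1 y) <= B) -> (forall y, Rabs (phi2 y) <= B) ->
  (forall y, Rabs (h1 y) <= kap * a) -> (forall y, Rabs (h2 y) <= kap * a) ->
  (forall y, a <= h y \/ locally y (fun z => phi z = 0 /\ phi1 z = 0)) ->
  phi (2 * PI) = phi 0 -> phi1 (2 * PI) = phi1 0 -> h (2 * PI) = h 0 -> h1 (2 * PI) = h1 0 ->
  cos (Ph (2 * PI)) = cos (Ph 0) -> sin (Ph (2 * PI)) = sin (Ph 0) ->
  Rabs (RInt (fun y => phi y * cos (Ph y)) 0 (2 * PI))
    <= 2 * PI * (B * (1 + 4 * kap + 3 * kap ^ 2) / a ^ 2).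
Proof.
  intros Ha HB Hkap Dphi Dphi1 DPh Dh Dh1 Bphi Bphi1 Bphi2 Bh1 Bh2 Hdich Ep Ep1 Eh Eh1 Ec Es.
  pose proof PI_RGT_0.
  (* [f2] is what is left after two integrations by parts: P' = (phi + f2) cos Ph. Each of its terms
     carries two more inverse powers of the phase derivative [h] than derivatives of [h]
     upstairs. *)
  set (f2 := fun y => phi2 y / h y ^ 2 - 3 * h1 y * phi1 y / h y ^ 3 - h2 y * phi y / h y ^ 3
                      + 3 * h1 y ^ 2 * phi y / h y ^ 4).
  set (P := fun y => phi y / h y * sin (Ph y) + (phi1 y / h y - h1 y * phi y / h y ^ 2) / h y * cos (Ph y)).
  set (c := B * (1 + 4 * kap + 3 * kap ^ 2) / a ^ 2).
  assert (Hc : 0 <= c).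
  { unfold c. apply Rmult_le_pos; [nra|]. left. apply Rinv_0_lt_compat. nra. }
  assert (Hphi2 : forall y, locally y (fun z => phi z = 0 /\ phi1 z = 0) -> phi2 y = 0).
  { intros y Hy. rewrite <- (is_derive_unique _ _ _ (Dphi1 y)).
    rewrite (Derive_ext_loc phi1 (fun _ => 0)); [apply Derive_const|].
    revert Hy. apply filter_imp. tauto. }
  assert (DP : forall y, is_derive P y (phi y * cos (Ph y) + f2 y * cos (Ph y))).
  { intros y. destruct (Hdich y) as [Hy|Hy].
    - assert (Hh : h y <> 0) by lra.
      pose proof (is_derive_unique _ _ _ (Dphi y)) as E1.
      pose proof (is_derive_unique _ _ _ (Dphi1 y)) as E2.
      pose proof (is_derive_unique _ _ _ (DPh y)) as E3.
      pose proof (is_derive_unique _ _ _ (Dh y)) as E4.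
      pose proof (is_derive_unique _ _ _ (Dh1 y)) as E5.
      unfold P. auto_derive.
      + repeat split; try (eexists; eauto; fail); try assumption.
        repeat apply Rmult_integral_contrapositive_currified; auto with real.
      + change (Derive (fun x => phi x) y) with (Derive phi y).
        change (Derive (fun x => phi1 x) y) with (Derive phi1 y).
        change (Derive (fun x => Ph x) y) with (Derive Ph y).
        change (Derive (fun x => h x) y) with (Derive h y).
        change (Derive (fun x => h1 x) y) with (Derive h1 y).
        rewrite E1, E2, E3, E4, E5. unfold f2. field. assumption.
    (* Off the support of phi nothing is known about [h], which may vanish there; all numerators are
       0, so whatever value is given to a division by 0 is harmless. *)
    - pose proof (locally_singleton _ _ Hy) as [Z1 Z2].
      replace (phi y * cos (Ph y) + f2 y * cos (Ph y)) with 0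
        by (unfold f2; rewrite Z1, Z2, (Hphi2 y Hy); unfold Rdiv; ring).
      apply (is_derive_ext_loc (fun _ => 0)); [|apply @is_derive_const].
      assert (HP : forall q, phi q = 0 -> phi1 q = 0 -> 0 = P q)
        by (intros q E1 E2; unfold P; rewrite E1, E2; unfold Rdiv; ring).
      revert Hy. apply filter_imp. intros z [E1 E2]. now apply HP. }
  assert (Hf2 : forall y, Rabs (f2 y * cos (Ph y)) <= c).
  { intros y. rewrite Rabs_mult.
    assert (Hcos : Rabs (cos (Ph y)) <= 1) by (apply Rabs_le; apply COS_bound).
    assert (Rabs (f2 y) <= c); [|pose proof (Rabs_pos (f2 y)); pose proof (Rabs_pos (cos (Ph y))); nra].
    destruct (Hdich y) as [Hy|Hy].
    - assert (Hh : 0 < h y) by lra.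
      set (q := / h y). assert (Hq0 : 0 < q) by (apply Rinv_0_lt_compat; lra).
      assert (Hqa : q * a <= 1).
      { unfold q. apply (Rmult_le_reg_l (h y)); [lra|]. rewrite <- Rmult_assoc, Rinv_r by lra. lra. }
      assert (Hqa' : q <= / a).
      { unfold q. apply Rinv_le_contravar; lra. }
      assert (Hq2 : q * q <= / a ^ 2).
      { replace (/ a ^ 2) with (/ a * / a) by (field; lra). apply Rmult_le_compat; lra. }
      replace (f2 y) with ((q * q) * (phi2 y - 3 * (h1 y * q) * phi1 y - (h2 y * q) * phi y
        + 3 * (h1 y * q) ^ 2 * phi y)) by (unfold f2, q; field; lra).
      assert (X1 : Rabs (h1 y * q) <= kap).
      { rewrite Rabs_mult, (Rabs_pos_eq q) by lra.
        apply Rle_trans with (kap * a * q); [apply Rmult_le_compat_r; [lra|auto]|]. nra. }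
      assert (X2 : Rabs (h2 y * q) <= kap).
      { rewrite Rabs_mult, (Rabs_pos_eq q) by lra.
        apply Rle_trans with (kap * a * q); [apply Rmult_le_compat_r; [lra|auto]|]. nra. }
      rewrite Rabs_mult, Rabs_pos_eq by nra.
      replace c with (/ a ^ 2 * (B * (1 + 4 * kap + 3 * kap ^ 2))) by (unfold c; field; lra).
      apply Rmult_le_compat; [nra|apply Rabs_pos|assumption|].
      set (x1 := h1 y * q) in *. set (x2 := h2 y * q) in *.
      assert (Y1 : Rabs (3 * x1 * phi1 y) <= 3 * kap * B).
      { rewrite !Rabs_mult, (Rabs_pos_eq 3) by lra.
        apply Rmult_le_compat; auto using Rabs_pos.
        - apply Rmult_le_pos; [lra|apply Rabs_pos].
        - apply Rmult_le_compat_l; lra. }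
      assert (Y2 : Rabs (x2 * phi y) <= kap * B).
      { rewrite Rabs_mult. apply Rmult_le_compat; auto using Rabs_pos. }
      assert (Y3 : Rabs (3 * x1 ^ 2 * phi y) <= 3 * kap ^ 2 * B).
      { rewrite !Rabs_mult, (Rabs_pos_eq 3), <- RPow_abs by lra.
        apply Rmult_le_compat; auto using Rabs_pos.
        - apply Rmult_le_pos; [lra|apply pow_le, Rabs_pos].
        - apply Rmult_le_compat_l; [lra|]. apply pow_incr. split; [apply Rabs_pos|assumption]. }
      pose proof (Bphi2 y) as Y4.
      apply Rabs_le_between in Y1, Y2, Y3, Y4. apply Rabs_le. lra.
    - pose proof (locally_singleton _ _ Hy) as [Z1 Z2].
      replace (f2 y) with 0 by (unfold f2; rewrite Z1, Z2, (Hphi2 y Hy); unfold Rdiv; ring).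
      rewrite Rabs_R0. assumption. }
  assert (Hcont : forall y, continuous (fun y => phi y * cos (Ph y)) y).
  { intros y. apply continuous_Rmult; [eapply is_derive_continuous, Dphi|].
    apply continuous_cos_R. eapply is_derive_continuous, DPh. }
  (* P takes equal values at both ends, so the integral of phi cos Ph is minus that of f2 cos Ph,
     and only the sup bound [c] of the latter is needed. *)
  pose proof (mean_value_bound (fun y => P y - RInt (fun y => phi y * cos (Ph y)) 0 y) (fun y => c * y)
    (fun y => f2 y * cos (Ph y)) (fun _ => c) 0 (2 * PI)) as Hmv.
  assert (EP : P (2 * PI) = P 0) by (unfold P; rewrite Ep, Ep1, Eh, Eh1, Ec, Es; reflexivity).
  cbv beta in Hmv. rewrite EP, RInt_point_0 in Hmv.
  replace (Rabs (RInt (fun y => phi y * cos (Ph y)) 0 (2 * PI)))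
    with (Rabs (P 0 - RInt (fun y => phi y * cos (Ph y)) 0 (2 * PI) - (P 0 - 0))).
  - replace (2 * PI * c) with (c * (2 * PI) - c * 0) by ring. apply Hmv.
    + lra.
    + intros s _.
      replace (f2 s * cos (Ph s)) with ((phi s * cos (Ph s) + f2 s * cos (Ph s)) - phi s * cos (Ph s)) by ring.
      apply (is_derive_minus P (fun y => RInt (fun y => phi y * cos (Ph y)) 0 y)); [apply DP|].
      apply (is_derive_prim (fun y => phi y * cos (Ph y))). apply Hcont.
    + intros s _. auto_derive; [auto|ring].
    + intros s _. apply Hf2.
  - rewrite <- Rabs_Ropp. f_equal. ring.
Qed.

(** * Primitives of periodic functions *)

Lemma zero_derivative_constant (f : R -> R) : (forall x, is_derive f x 0) -> forall x y, f x = f y.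
Proof.
  intros H. assert (Hle : forall x y, x <= y -> f x = f y).
  { intros x y Hxy. pose proof (mean_value_bound f (fun _ => 0) (fun _ => 0) (fun _ => 0) x y Hxy) as Hm.
    assert (Rabs (f y - f x) <= 0 - 0).
    { apply Hm; auto.
      - intros; apply @is_derive_const.
      - intros; rewrite Rabs_R0; lra. }
    pose proof (Rabs_pos (f y - f x)). assert (E : Rabs (f y - f x) = 0) by lra.
    apply Rabs_eq_0 in E. lra. }
  intros x y. destruct (Rle_dec x y); [auto|]. symmetry. apply Hle; lra.
Qed.

Lemma is_derive_eq (f : R -> R) (x d d' : R) : is_derive f x d -> d = d' -> is_derive f x d'.
Proof. now intros H <-. Qed.

Section Primitive.

Variable f : R -> R.
Hypothesis Hp : forall x, f (x + 2 * PI) = f x.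
Hypothesis Hc : forall x, continuous f x.

Let F (x : R) : R := RInt f 0 x.
Let m : R := RInt f 0 (2 * PI) / (2 * PI).

Lemma is_derive_shift (g : R -> R) x a d : is_derive g (x + a) d -> is_derive (fun y => g (y + a)) x d.
Proof.
  intros H. replace d with (scal 1 d) by (unfold scal; cbn; unfold mult; cbn; ring).
  apply (is_derive_comp g (fun y => y + a)); [exact H|auto_derive; auto].
Qed.

Lemma prim_period x : F (x + 2 * PI) - F x = 2 * PI * m.
Proof.
  pose proof PI_RGT_0.
  rewrite (zero_derivative_constant (fun x => F (x + 2 * PI) - F x)) with (y := 0).
  - unfold F. rewrite Rplus_0_l, RInt_point_0. unfold m. field. lra.
  - intros y. apply is_derive_eq with (f (y + 2 * PI) - f y); [|rewrite Hp; apply Rminus_diag].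
    apply (is_derive_minus (fun y => F (y + 2 * PI)) F).
    + apply is_derive_shift. now apply is_derive_prim.
    + now apply is_derive_prim.
Qed.

Lemma prim_diff_period t x : F (x + 2 * PI + t) - F (x + 2 * PI) = F (x + t) - F x.
Proof.
  pose proof (prim_period x). pose proof (prim_period (x + t)).
  replace (x + 2 * PI + t) with (x + t + 2 * PI) by ring. lra.
Qed.

(** F(x) - m x is continuous and periodic, hence bounded. A primitive over a window of length t is
    therefore m t up to a bounded error, uniformly in the starting point. *)
Lemma prim_growth : exists M, 0 <= M /\ (forall x t, Rabs (F (x + t) - F x - m * t) <= M) /\
  forall x t, 0 <= t -> Rabs (F (x + t) - F x) <= M + Rabs m * t.
Proof.
  destruct (periodic_bounded (fun x => F x - m * x)) as [M [HM H]].
  - intros x. pose proof (prim_period x). lra.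
  - intros x. apply continuous_Rminus; [|apply continuous_lin].
    eapply is_derive_continuous. now apply is_derive_prim.
  - assert (HF : forall x t, Rabs (F (x + t) - F x - m * t) <= 2 * M).
    { intros x t. pose proof (H (x + t)) as H1. pose proof (H x) as H2. cbv beta in H1, H2.
      apply Rabs_le_between in H1. apply Rabs_le_between in H2. apply Rabs_le. lra. }
    exists (2 * M). split; [lra|]. split; [exact HF|]. intros x t Ht.
    rewrite <- (Rabs_pos_eq t Ht) at 2. rewrite <- Rabs_mult.
    replace (F (x + t) - F x) with ((F (x + t) - F x - m * t) + m * t) by ring.
    eapply Rle_trans; [apply Rabs_triang|]. pose proof (HF x t). lra.
Qed.

End Primitive.

Lemma Rabs_cos_le x : Rabs (cos x) <= 1.
Proof. apply Rabs_le; apply COS_bound. Qed.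

Lemma Rabs_sin_le x : Rabs (sin x) <= 1.
Proof. apply Rabs_le; apply SIN_bound. Qed.

Lemma Rabs_trig_comb (th A B : R) : Rabs (cos th * A + sin th * B) <= Rabs A + Rabs B.
Proof.
  eapply Rle_trans; [apply Rabs_triang|]. rewrite !Rabs_mult.
  pose proof (Rabs_cos_le th). pose proof (Rabs_sin_le th).
  pose proof (Rabs_pos A). pose proof (Rabs_pos B). nra.
Qed.

(** * The resonant phase *)

Section Phase.

Variables (v : R -> R) (j : Z).
Hypothesis Hv : smooth_periodic v.

Let c : R := IZR j.
Let v1 := Derive v.
Let v2 := Derive v1.
Let Hv1 : smooth_periodic v1.
Proof. now apply smooth_Derive. Qed.
Let Hv2 : smooth_periodic v2.
Proof. now apply smooth_Derive. Qed.

Definition ma : R := RInt (fun s => cos (IZR j * s) * v s) 0 (2 * PI) / (2 * PI).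
Definition mb : R := RInt (fun s => sin (IZR j * s) * v s) 0 (2 * PI) / (2 * PI).
Definition Pc (x : R) : R := RInt (fun s => cos (IZR j * s) * v s) 0 x.
Definition Ps (x : R) : R := RInt (fun s => sin (IZR j * s) * v s) 0 x.

(* [theta t y] is the integral of [cos (j s) v (y + s)] for [s] in [0, t], with the addition
   formula for [cos (j (s - y))] used to move [y] out of the integrand. *)
Definition theta (t y : R) : R :=
  cos (IZR j * y) * (Pc (y + t) - Pc y) + sin (IZR j * y) * (Ps (y + t) - Ps y).
(** The companion of [theta] with sin (j s) in place of cos (j s). Up to bounded terms, d/dy
    exchanges the two with a factor j in size, so derivatives of any order grow no faster than t. *)
Definition xi (t y : R) : R :=
  cos (IZR j * y) * (Ps (y + t) - Ps y) - sin (IZR j * y) * (Pc (y + t) - Pc y).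
Definition theta1 (t y : R) : R := IZR j * xi t y + cos (IZR j * t) * v (y + t) - v y.
Definition theta2 (t y : R) : R :=
  - IZR j ^ 2 * theta t y + IZR j * sin (IZR j * t) * v (y + t)
  + cos (IZR j * t) * Derive v (y + t) - Derive v y.
Definition theta3 (t y : R) : R :=
  - IZR j ^ 2 * theta1 t y + IZR j * sin (IZR j * t) * Derive v (y + t)
  + cos (IZR j * t) * Derive (Derive v) (y + t) - Derive (Derive v) y.

Lemma trig_period x : cos (c * (x + 2 * PI)) = cos (c * x) /\ sin (c * (x + 2 * PI)) = sin (c * x).
Proof.
  assert (E : cis (c * (x + 2 * PI)) = cis (c * x)).
  { rewrite Rmult_plus_distr_l, cis_plus. unfold c. rewrite cis_2PI_Z. ring. }
  split; [apply (f_equal fst E)|apply (f_equal snd E)].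
Qed.

Lemma Pc_cont x : continuous (fun s => cos (c * s) * v s) x.
Proof.
  apply continuous_Rmult; [|now apply smooth_continuous].
  apply continuous_cos_R, continuous_lin.
Qed.

Lemma Ps_cont x : continuous (fun s => sin (c * s) * v s) x.
Proof.
  apply continuous_Rmult; [|now apply smooth_continuous].
  apply continuous_sin_R, continuous_lin.
Qed.

Lemma is_derive_Pc x : is_derive Pc x (cos (c * x) * v x).
Proof. apply (is_derive_prim (fun s => cos (c * s) * v s)), Pc_cont. Qed.

Lemma is_derive_Ps x : is_derive Ps x (sin (c * x) * v x).
Proof. apply (is_derive_prim (fun s => sin (c * s) * v s)), Ps_cont. Qed.

Lemma is_derive_shift_diff (g g' : R -> R) t y :
  (forall x, is_derive g x (g' x)) -> is_derive (fun y => g (y + t) - g y) y (g' (y + t) - g' y).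
Proof.
  intros H. apply (is_derive_minus (fun y => g (y + t)) g); [|apply H].
  apply is_derive_shift, H.
Qed.

Lemma is_derive_cosc y : is_derive (fun y => cos (c * y)) y (- c * sin (c * y)).
Proof. auto_derive; [auto|ring]. Qed.

Lemma is_derive_sinc y : is_derive (fun y => sin (c * y)) y (c * cos (c * y)).
Proof. auto_derive; [auto|ring]. Qed.

Lemma theta_derive t y : is_derive (theta t) y (theta1 t y).
Proof.
  eapply is_derive_eq.
  - apply (is_derive_plus (fun y => cos (c * y) * (Pc (y + t) - Pc y))
      (fun y => sin (c * y) * (Ps (y + t) - Ps y)));
      apply is_derive_Rmult; [apply is_derive_cosc| |apply is_derive_sinc|];
      apply is_derive_shift_diff; [apply is_derive_Pc|apply is_derive_Ps].
  - unfold theta1, xi, plus; simpl. fold c.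
    rewrite Rmult_plus_distr_l, cos_plus, sin_plus.
    transitivity (c * (cos (c * y) * (Ps (y + t) - Ps y) - sin (c * y) * (Pc (y + t) - Pc y))
      + (cos (c * t) * v (y + t) - v y) * ((sin (c * y))² + (cos (c * y))²));
      [unfold Rsqr; ring|rewrite sin2_cos2; ring].
Qed.

Lemma xi_derive t y : is_derive (xi t) y (- c * theta t y + sin (c * t) * v (y + t)).
Proof.
  eapply is_derive_eq.
  - apply (is_derive_minus (fun y => cos (c * y) * (Ps (y + t) - Ps y))
      (fun y => sin (c * y) * (Pc (y + t) - Pc y)));
      apply is_derive_Rmult; [apply is_derive_cosc| |apply is_derive_sinc|];
      apply is_derive_shift_diff; [apply is_derive_Ps|apply is_derive_Pc].
  - unfold theta, minus, plus, opp; simpl. fold c.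
    rewrite Rmult_plus_distr_l, cos_plus, sin_plus.
    transitivity (- c * (cos (c * y) * (Pc (y + t) - Pc y) + sin (c * y) * (Ps (y + t) - Ps y))
      + sin (c * t) * v (y + t) * ((sin (c * y))² + (cos (c * y))²));
      [unfold Rsqr; ring|rewrite sin2_cos2; ring].
Qed.

Lemma is_derive_Rscal (g : R -> R) a x d : is_derive g x d -> is_derive (fun y => a * g y) x (a * d).
Proof. intros H. apply (is_derive_scal g x a d H). Qed.

Lemma theta1_derive t y : is_derive (theta1 t) y (theta2 t y).
Proof.
  eapply is_derive_eq.
  - apply (is_derive_minus (fun y => c * xi t y + cos (c * t) * v (y + t)) v);
      [|now apply smooth_is_derive].
    apply (is_derive_plus (fun y => c * xi t y) (fun y => cos (c * t) * v (y + t)));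
      apply is_derive_Rscal; [apply xi_derive|]. apply is_derive_shift. now apply smooth_is_derive.
  - unfold theta2, minus, plus, opp; simpl. fold c. ring.
Qed.

Lemma theta2_derive t y : is_derive (theta2 t) y (theta3 t y).
Proof.
  eapply is_derive_eq.
  - apply (is_derive_minus (fun y => - c ^ 2 * theta t y + c * sin (c * t) * v (y + t)
      + cos (c * t) * v1 (y + t)) v1); [|now apply smooth_is_derive].
    apply (is_derive_plus (fun y => - c ^ 2 * theta t y + c * sin (c * t) * v (y + t))
      (fun y => cos (c * t) * v1 (y + t))).
    + apply (is_derive_plus (fun y => - c ^ 2 * theta t y) (fun y => c * sin (c * t) * v (y + t)));
        apply is_derive_Rscal; [apply theta_derive|]. apply is_derive_shift. now apply smooth_is_derive.
    + apply is_derive_Rscal, is_derive_shift. now apply smooth_is_derive.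
  - unfold theta3, minus, plus, opp; simpl. fold c. unfold v1. ring.
Qed.

Lemma theta_time_derive t y :
  is_derive (fun t => theta t y) t (cos (c * t) * v (y + t)).
Proof.
  assert (H : forall (g g' : R -> R), (forall x, is_derive g x (g' x)) ->
    is_derive (fun t => g (y + t) - g y) t (g' (y + t))).
  { intros g g' Hg. eapply is_derive_eq.
    - apply (is_derive_minus (fun t => g (y + t)) (fun _ => g y)); [|apply @is_derive_const].
      apply (is_derive_ext (fun t => g (t + y))); [intros; f_equal; apply Rplus_comm|].
      apply is_derive_shift. rewrite (Rplus_comm t y). apply Hg.
    - unfold minus, plus, opp, zero; simpl. ring. }
  eapply is_derive_eq.
  - apply (is_derive_plus (fun t => cos (c * y) * (Pc (y + t) - Pc y))
      (fun t => sin (c * y) * (Ps (y + t) - Ps y))); apply is_derive_Rscal;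
      apply H; [apply is_derive_Pc|apply is_derive_Ps].
  - unfold plus; simpl. rewrite Rmult_plus_distr_l, cos_plus, sin_plus.
    transitivity (cos (c * t) * v (y + t) * ((sin (c * y))² + (cos (c * y))²));
      [unfold Rsqr; ring|rewrite sin2_cos2; ring].
Qed.

Lemma theta_0 y : theta 0 y = 0.
Proof. unfold theta. rewrite Rplus_0_r. ring. Qed.

Lemma Pc_diff_period t y : Pc (y + 2 * PI + t) - Pc (y + 2 * PI) = Pc (y + t) - Pc y.
Proof.
  assert (Hp : forall x, cos (c * (x + 2 * PI)) * v (x + 2 * PI) = cos (c * x) * v x).
  { intros x. rewrite (proj1 (trig_period x)), (proj2 Hv). reflexivity. }
  apply (prim_diff_period _ Hp Pc_cont).
Qed.

Lemma Ps_diff_period t y : Ps (y + 2 * PI + t) - Ps (y + 2 * PI) = Ps (y + t) - Ps y.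
Proof.
  assert (Hp : forall x, sin (c * (x + 2 * PI)) * v (x + 2 * PI) = sin (c * x) * v x).
  { intros x. rewrite (proj2 (trig_period x)), (proj2 Hv). reflexivity. }
  apply (prim_diff_period _ Hp Ps_cont).
Qed.

Lemma theta_period t y : theta t (y + 2 * PI) = theta t y.
Proof.
  unfold theta. fold c. destruct (trig_period y) as [-> ->].
  now rewrite Pc_diff_period, Ps_diff_period.
Qed.

Lemma xi_period t y : xi t (y + 2 * PI) = xi t y.
Proof.
  unfold xi. fold c. destruct (trig_period y) as [-> ->].
  now rewrite Pc_diff_period, Ps_diff_period.
Qed.

Lemma smooth_shift_period w t y : smooth_periodic w -> w (y + 2 * PI + t) = w (y + t).
Proof.
  intros [_ H]. replace (y + 2 * PI + t) with (y + t + 2 * PI) by ring. apply H.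
Qed.

Lemma theta1_period t y : theta1 t (y + 2 * PI) = theta1 t y.
Proof.
  unfold theta1. rewrite xi_period, (smooth_shift_period v), (proj2 Hv) by assumption. reflexivity.
Qed.

Lemma theta2_period t y : theta2 t (y + 2 * PI) = theta2 t y.
Proof.
  unfold theta2. fold v1.
  rewrite theta_period, (smooth_shift_period v), (smooth_shift_period v1), (proj2 Hv1) by assumption.
  reflexivity.
Qed.

(* The frequency [- theta1] drifts at speed [drift y]. *)
Definition drift (y : R) : R := IZR j * (ma * sin (IZR j * y) - mb * cos (IZR j * y)).

(** Only the means [ma] and [mb] of the resonant integrands produce growth, by [prim_growth]. The
    second and third derivatives reduce to -j^2 times [theta] and [theta1] plus bounded terms. This
    keeps the curvature of the phase comparable with its slope, as non-stationary phase uniform in t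
    requires. *)
Lemma phase_bounds : exists M, 0 < M /\ forall t y, 0 <= t ->
  t * drift y - M <= - theta1 t y /\
  Rabs (theta2 t y) <= M * (1 + t) /\ Rabs (theta3 t y) <= M * (1 + t).
Proof.
  destruct (prim_growth (fun s => cos (c * s) * v s)) as [M1 [HM1 [H1 G1]]].
  { intros x. rewrite (proj1 (trig_period x)), (proj2 Hv). reflexivity. }
  { exact Pc_cont. }
  destruct (prim_growth (fun s => sin (c * s) * v s)) as [M2 [HM2 [H2 G2]]].
  { intros x. rewrite (proj2 (trig_period x)), (proj2 Hv). reflexivity. }
  { exact Ps_cont. }
  destruct (smooth_bounded v Hv) as [V0 [HV0 B0]].
  destruct (smooth_bounded v1 Hv1) as [V1 [HV1 B1]].
  destruct (smooth_bounded v2 Hv2) as [V2 [HV2 B2]].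
  fold (ma) in H1. fold (mb) in H2.
  set (C := Rabs c). assert (HC : 0 <= C) by apply Rabs_pos.
  set (D := Rabs ma + Rabs mb + M1 + M2).
  assert (HD : 0 <= D) by (unfold D; pose proof (Rabs_pos ma); pose proof (Rabs_pos mb); lra).
  assert (Hdc : forall t y, 0 <= t -> Rabs (Pc (y + t) - Pc y) + Rabs (Ps (y + t) - Ps y) <= D * (1 + t)).
  { intros t y Ht. pose proof (G1 y t Ht) as G1'. pose proof (G2 y t Ht) as G2'.
    change (Rabs (Pc (y + t) - Pc y) <= M1 + Rabs ma * t) in G1'.
    change (Rabs (Ps (y + t) - Ps y) <= M2 + Rabs mb * t) in G2'.
    pose proof (Rabs_pos ma); pose proof (Rabs_pos mb). unfold D. nra. }
  assert (Hth : forall t y, 0 <= t -> Rabs (theta t y) <= D * (1 + t)).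
  { intros t y Ht. eapply Rle_trans; [apply Rabs_trig_comb|]. now apply Hdc. }
  assert (Hxi : forall t y, 0 <= t -> Rabs (xi t y) <= D * (1 + t)).
  { intros t y Ht. eapply Rle_trans; [|apply (Hdc t y Ht)]. unfold xi.
    replace (cos (IZR j * y) * (Ps (y + t) - Ps y) - sin (IZR j * y) * (Pc (y + t) - Pc y))
      with (cos (IZR j * y) * (Ps (y + t) - Ps y) + sin (IZR j * y) * (- (Pc (y + t) - Pc y))) by ring.
    eapply Rle_trans; [apply Rabs_trig_comb|]. rewrite Rabs_Ropp. lra. }
  assert (Hlow : forall (w : R -> R) W0 a (t y : R), 0 <= W0 -> (forall x, Rabs (w x) <= W0) -> Rabs a <= 1 ->
    Rabs (a * w (y + t)) <= W0).
  { intros w W0 a t y HW0 Hw Ha. rewrite Rabs_mult. pose proof (Rabs_pos (w (y + t))).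
    pose proof (Hw (y + t)). pose proof (Rabs_pos a). nra. }
  assert (Hth1 : forall t y, 0 <= t -> Rabs (theta1 t y) <= (C * D + 2 * V0) * (1 + t)).
  { intros t y Ht. unfold theta1. fold c.
    assert (Rabs (c * xi t y) <= C * (D * (1 + t))).
    { rewrite Rabs_mult. apply Rmult_le_compat_l; [assumption|auto]. }
    pose proof (Hlow v V0 (cos (c * t)) t y HV0 B0 (Rabs_cos_le _)). pose proof (B0 y).
    repeat match goal with H : Rabs _ <= _ |- _ => apply Rabs_le_between in H end.
    apply Rabs_le. nra. }
  set (M := C * (M1 + M2) + 2 * V0 + C ^ 2 * D + C * V0 + 2 * V1
    + C ^ 2 * (C * D + 2 * V0) + C * V1 + 2 * V2 + 1).
  assert (P1 : 0 <= C * (M1 + M2)) by (apply Rmult_le_pos; lra).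
  assert (P2 : 0 <= C ^ 2 * D) by (apply Rmult_le_pos; [apply pow2_ge_0|lra]).
  assert (P3 : 0 <= C * V0) by (apply Rmult_le_pos; lra).
  assert (P4 : 0 <= C ^ 2 * (C * D + 2 * V0)) by (apply Rmult_le_pos; [apply pow2_ge_0|nra]).
  assert (P5 : 0 <= C * V1) by (apply Rmult_le_pos; lra).
  assert (HM : 0 < M) by (unfold M; lra).
  exists M. split; [assumption|]. intros t y Ht. split; [|split].
  - pose proof (H1 y t) as H1'. pose proof (H2 y t) as H2'.
    change (Rabs (Pc (y + t) - Pc y - ma * t) <= M1) in H1'.
    change (Rabs (Ps (y + t) - Ps y - mb * t) <= M2) in H2'.
    set (e1 := Pc (y + t) - Pc y - ma * t) in *. set (e2 := Ps (y + t) - Ps y - mb * t) in *.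
    assert (Exi : - theta1 t y = t * drift y + c * (cos (c * y) * (- e2) + sin (c * y) * e1)
      - cos (c * t) * v (y + t) + v y).
    { unfold theta1, xi, drift, e1, e2. fold c. ring. }
    rewrite Exi.
    assert (Rabs (c * (cos (c * y) * (- e2) + sin (c * y) * e1)) <= C * (M1 + M2)).
    { rewrite Rabs_mult. apply Rmult_le_compat_l; [assumption|].
      eapply Rle_trans; [apply Rabs_trig_comb|]. rewrite Rabs_Ropp. lra. }
    pose proof (Hlow v V0 (cos (c * t)) t y HV0 B0 (Rabs_cos_le _)). pose proof (B0 y).
    repeat match goal with H : Rabs _ <= _ |- _ => apply Rabs_le_between in H end.
    unfold M. lra.
  - unfold theta2. fold c v1.
    assert (Q1 : Rabs (- c ^ 2 * theta t y) <= C ^ 2 * (D * (1 + t))).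
    { rewrite Rabs_mult, Rabs_Ropp, <- RPow_abs. apply Rmult_le_compat_l; [apply pow2_ge_0|auto]. }
    assert (Q2 : Rabs (c * sin (c * t) * v (y + t)) <= C * V0).
    { rewrite Rmult_assoc, Rabs_mult. apply Rmult_le_compat_l; [assumption|]. apply Hlow; auto using Rabs_sin_le. }
    pose proof (Hlow v1 V1 (cos (c * t)) t y HV1 B1 (Rabs_cos_le _)) as Q3. pose proof (B1 y) as Q4.
    apply Rabs_le_between in Q1, Q2, Q3, Q4. apply Rabs_le. unfold M. nra.
  - unfold theta3. fold c v1 v2.
    assert (Q1 : Rabs (- c ^ 2 * theta1 t y) <= C ^ 2 * ((C * D + 2 * V0) * (1 + t))).
    { rewrite Rabs_mult, Rabs_Ropp, <- RPow_abs. apply Rmult_le_compat_l; [apply pow2_ge_0|auto]. }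
    assert (Q2 : Rabs (c * sin (c * t) * v1 (y + t)) <= C * V1).
    { rewrite Rmult_assoc, Rabs_mult. apply Rmult_le_compat_l; [assumption|]. apply Hlow; auto using Rabs_sin_le. }
    pose proof (Hlow v2 V2 (cos (c * t)) t y HV2 B2 (Rabs_cos_le _)) as Q3. pose proof (B2 y) as Q4.
    apply Rabs_le_between in Q1, Q2, Q3, Q4. apply Rabs_le. unfold M. nra.
Qed.

End Phase.

(** * The travelling wave packet *)

Lemma cf_scal c G k : ccont G -> cf (fun y => c * G y)%C k = (c * cf G k)%C.
Proof.
  intros HG. unfold cf. rewrite (CI_ext _ (fun x => c * (G x * cis (- (IZR k * x))))%C)
    by (intros; ring).
  rewrite CI_scal by ccont_auto. ring.
Qed.

Lemma cf_minus G H k : ccont G -> ccont H -> cf (fun y => G y - H y)%C k = (cf G k - cf H k)%C.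
Proof.
  intros HG HH. unfold cf.
  rewrite (CI_ext _ (fun x => G x * cis (- (IZR k * x)) - H x * cis (- (IZR k * x)))%C)
    by (intros; ring).
  rewrite CI_minus by ccont_auto. ring.
Qed.

Lemma cf_csum n (G : Z -> R -> C) k : (forall m, ccont (G m)) ->
  cf (fun y => csum n (fun m => G m y)) k = csum n (fun m => cf (G m) k).
Proof.
  intros HG. unfold cf. rewrite (CI_ext _ (fun x => csum n (fun m => G m x * cis (- (IZR k * x)))%C))
    by (intros; now rewrite csum_scal_r).
  rewrite (CI_csum n (fun m x => G m x * cis (- (IZR k * x)))%C).
  - now rewrite csum_scal.
  - intros m. pose proof (HG m). ccont_auto.
Qed.

Lemma cf_shift G k m : cf (fun y => cis (IZR (k - m) * y) * G y)%C k = cf G m.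
Proof.
  unfold cf. f_equal. apply CI_ext. intros x.
  replace (cis (- (IZR m * x))) with (cis (IZR (k - m) * x) * cis (- (IZR k * x)))%C
    by (rewrite <- cis_plus; f_equal; rewrite minus_IZR; ring). ring.
Qed.

(** * A twice continuously differentiable cut-off *)

Lemma is_derive_pos_sqr x : is_derive (fun x => Rmax 0 x ^ 2) x (2 * Rmax 0 x).
Proof.
  destruct (Rtotal_order x 0) as [Hx|[->|Hx]].
  - rewrite Rmax_left, Rmult_0_r by lra.
    apply (is_derive_ext_loc (fun _ => 0)); [|apply @is_derive_const].
    apply (filter_imp (fun y => y < 0)); [|now apply open_lt].
    intros y Hy. rewrite Rmax_left by lra. simpl. ring.
  - rewrite Rmax_left, Rmult_0_r by lra. apply is_derive_Reals. intros eps He.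
    exists (mkposreal eps He). intros h Hh Hlt. simpl in Hlt.
    rewrite Rplus_0_l, (Rmax_left 0 0) by lra.
    replace ((Rmax 0 h ^ 2 - 0 ^ 2) / h - 0) with (Rmax 0 h ^ 2 / h) by (field; assumption).
    unfold Rmax. destruct (Rle_dec 0 h).
    + replace (h ^ 2 / h) with h by (field; assumption). assumption.
    + replace (0 ^ 2 / h) with 0 by (field; assumption). now rewrite Rabs_R0.
  - rewrite Rmax_right by lra.
    apply (is_derive_ext_loc (fun y => y ^ 2)).
    + apply (filter_imp (fun y => 0 < y)); [|now apply open_gt].
      intros y Hy. rewrite Rmax_right by lra. reflexivity.
    + auto_derive; [auto|ring].
Qed.

Lemma is_derive_pos_cube x : is_derive (fun x => Rmax 0 x ^ 3) x (3 * Rmax 0 x ^ 2).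
Proof.
  assert (E : forall y : R, Rmax 0 y * y = Rmax 0 y ^ 2).
  { intros y. unfold Rmax. destruct (Rle_dec 0 y); ring. }
  assert (E3 : forall y : R, Rmax 0 y ^ 2 * y = Rmax 0 y ^ 3).
  { intros y. transitivity (Rmax 0 y * (Rmax 0 y * y)); [ring|]. rewrite E. ring. }
  apply (is_derive_ext (fun y : R => Rmax 0 y ^ 2 * y)); [exact E3|].
  eapply is_derive_eq; [apply is_derive_Rmult; [apply is_derive_pos_sqr|apply @is_derive_id]|].
  transitivity (2 * (Rmax 0 x * x) + Rmax 0 x ^ 2); [unfold one; simpl; ring|]. rewrite E. ring.
Qed.

Lemma continuous_pos x : continuous (fun x => Rmax 0 x) x.
Proof.
  apply lipschitz_continuous. intros T. exists 1. intros s t _ _. rewrite Rmult_1_l.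
  unfold Rmax. destruct (Rle_dec 0 t), (Rle_dec 0 s); unfold Rabs;
    repeat destruct Rcase_abs; lra.
Qed.

Lemma RInt_pos (f : R -> R) y0 :
  (forall x, continuous f x) -> (forall x, 0 <= f x) -> 0 <= y0 < 2 * PI -> 0 < f y0 ->
  0 < RInt f 0 (2 * PI).
Proof.
  intros Hc Hp Hy0 Hf.
  assert (Hex : forall a b, ex_RInt f a b) by (intros; now apply ex_RInt_cont).
  destruct (Hc y0 (fun z => 0 < z)) as [del Hdel]; [now apply open_gt|].
  set (b := Rmin (y0 + del / 2) (2 * PI)). pose proof (cond_pos del).
  assert (Hb : y0 < b <= 2 * PI) by (split; [apply Rmin_glb_lt; lra|apply Rmin_r]).
  rewrite <- (RInt_Chasles f 0 y0 (2 * PI)), <- (RInt_Chasles f y0 b (2 * PI)) by auto.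
  assert (0 <= RInt f 0 y0) by (apply RInt_ge_0; auto; lra).
  assert (0 <= RInt f b (2 * PI)) by (apply RInt_ge_0; auto; lra).
  assert (0 < RInt f y0 b).
  { apply RInt_gt_0; [lra| |intros; apply Hc].
    intros x Hx. apply Hdel. pose proof (Rmin_l (y0 + del / 2) (2 * PI)). fold b in H2.
    change (Rabs (x - y0) < del). rewrite Rabs_pos_eq; lra. }
  unfold plus; simpl. lra.
Qed.

Section Packet.

Variables (v : R -> R) (j : Z) (c0 y0 : R).
Hypothesis Hv : smooth_periodic v.
Hypothesis Hc0 : 0 < c0.
Hypothesis Hy0 : 0 <= y0 < 2 * PI.
Hypothesis Hsig : c0 < drift v j y0.

Let c := IZR j.
Let sg := drift v j.
Let sg1 (y : R) : R := c ^ 2 * (ma v j * cos (c * y) + mb v j * sin (c * y)).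

(** The cube of a positive part has two continuous derivatives, as many as there are integrations by
    parts, and it is localised where the drift is at least [c0] without any smooth bump function. *)
Definition phi (y : R) : R := Rmax 0 (drift v j y - c0) ^ 3.
Let phi1 (y : R) : R := 3 * Rmax 0 (sg y - c0) ^ 2 * sg1 y.
Let phi2 (y : R) : R := 6 * Rmax 0 (sg y - c0) * sg1 y ^ 2 - 3 * Rmax 0 (sg y - c0) ^ 2 * (c ^ 2 * sg y).

Lemma sg_derive y : is_derive sg y (sg1 y).
Proof. unfold sg, drift, sg1. fold c. auto_derive; [auto|ring]. Qed.

Lemma sg1_derive y : is_derive sg1 y (- c ^ 2 * sg y).
Proof. unfold sg, drift, sg1. fold c. auto_derive; [auto|ring]. Qed.

Lemma sg_shift_derive y : is_derive (fun y => sg y - c0) y (sg1 y).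
Proof.
  eapply is_derive_eq; [apply (is_derive_minus sg (fun _ => c0)); [apply sg_derive|apply @is_derive_const]|].
  unfold minus, plus, opp, zero; simpl. ring.
Qed.

Lemma is_derive_Rcomp (f g : R -> R) x d e :
  is_derive f (g x) d -> is_derive g x e -> is_derive (fun y => f (g y)) x (d * e).
Proof.
  intros Hf Hg. eapply is_derive_eq; [apply (is_derive_comp f g x d e Hf Hg)|].
  unfold scal; simpl; unfold mult; simpl. ring.
Qed.

Lemma phi_derive y : is_derive phi y (phi1 y).
Proof.
  apply (is_derive_Rcomp (fun x => Rmax 0 x ^ 3) (fun y => sg y - c0));
    [apply is_derive_pos_cube|apply sg_shift_derive].
Qed.

Lemma phi1_derive y : is_derive phi1 y (phi2 y).
Proof.
  eapply is_derive_eq.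
  - apply (is_derive_Rmult (fun y => 3 * Rmax 0 (sg y - c0) ^ 2) sg1); [|apply sg1_derive].
    apply is_derive_Rscal, (is_derive_Rcomp (fun x => Rmax 0 x ^ 2) (fun y => sg y - c0));
      [apply is_derive_pos_sqr|apply sg_shift_derive].
  - unfold phi2. ring.
Qed.

Lemma sg_period y : sg (y + 2 * PI) = sg y /\ sg1 (y + 2 * PI) = sg1 y.
Proof.
  unfold sg, sg1, drift. fold c. destruct (trig_period j y) as [E1 E2]. fold c in E1, E2.
  now rewrite E1, E2.
Qed.

Lemma phi_period y : phi (y + 2 * PI) = phi y /\ phi1 (y + 2 * PI) = phi1 y /\ phi2 (y + 2 * PI) = phi2 y.
Proof.
  unfold phi, phi1, phi2. fold sg. destruct (sg_period y) as [-> ->]. auto.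
Qed.

Lemma phi_bounds : exists B, 0 < B /\
  forall y, Rabs (phi y) <= B /\ Rabs (phi1 y) <= B /\ Rabs (phi2 y) <= B.
Proof.
  assert (Hm : forall y, continuous (fun y => Rmax 0 (sg y - c0)) y).
  { intros y. apply (continuous_comp (fun y => sg y - c0) (fun x => Rmax 0 x)); [|apply continuous_pos].
    eapply is_derive_continuous, sg_shift_derive. }
  assert (Hsg : forall y, continuous sg y) by (intros; eapply is_derive_continuous, sg_derive).
  assert (Hsg1 : forall y, continuous sg1 y) by (intros; eapply is_derive_continuous, sg1_derive).
  assert (Hpow : forall (f : R -> R) n, (forall y, continuous f y) -> forall y, continuous (fun y => f y ^ n) y).
  { intros f n Hf y. induction n as [|n IH]; cbn [pow]; [apply continuous_const|].
    now apply continuous_Rmult. }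
  destruct (periodic_bounded phi) as [B1 [HB1 H1]].
  { intros; apply phi_period. }
  { intros; eapply is_derive_continuous, phi_derive. }
  destruct (periodic_bounded phi1) as [B2 [HB2 H2]].
  { intros; apply phi_period. }
  { intros; eapply is_derive_continuous, phi1_derive. }
  destruct (periodic_bounded phi2) as [B3 [HB3 H3]].
  { intros; apply phi_period. }
  { intros y. unfold phi2. apply continuous_Rminus.
    - apply continuous_Rmult; [|now apply (Hpow sg1 2%nat)].
      apply continuous_Rmult; [apply continuous_const|apply Hm].
    - apply continuous_Rmult; [|apply continuous_Rmult; [apply continuous_const|apply Hsg]].
      apply continuous_Rmult; [apply continuous_const|].
      now apply (Hpow (fun y => Rmax 0 (sg y - c0)) 2%nat). }
  exists (B1 + B2 + B3 + 1). split; [lra|]. intros y.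
  specialize (H1 y). specialize (H2 y). specialize (H3 y). lra.
Qed.

Lemma phi_dichotomy y : c0 <= sg y \/ locally y (fun z => phi z = 0 /\ phi1 z = 0).
Proof.
  destruct (Rle_dec c0 (sg y)) as [H|H]; [now left|right].
  assert (Hc : continuous sg y) by (eapply is_derive_continuous, sg_derive).
  specialize (Hc (fun z => z < c0)).
  assert (Hl : locally y (fun z => sg z < c0)) by (apply Hc, open_lt; lra).
  revert Hl. apply filter_imp. intros z Hz.
  assert (E : forall q, sg q < c0 -> phi q = 0 /\ phi1 q = 0).
  { intros q Hq. unfold phi, phi1. fold sg. rewrite Rmax_left by lra. split; ring. }
  now apply E.
Qed.

(** Written in the moving variable y = x - t. This change multiplies the k-th coefficient by
    e^{ikt}, which for k >= 0 is exactly the passage from psi_k to u_k. *)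
Definition packet (N : Z) (t y : R) : C := (RtoC (phi y) * cis (IZR N * y - theta v j t y))%C.

Definition Wc (N : Z) (t : R) (k : Z) : C := cf (packet N t) k.

(** In the moving frame only multiplication by the potential cos (j t) v (y + t) is left, and the
    packet solves this equation exactly because that function is the time derivative of [theta]. *)
Definition lWc (N : Z) (t : R) (k : Z) : C :=
  cf (fun y => RtoC (cos (IZR j * t) * v (y + t)) * packet N t y)%C k.

(** The constant [e] lets one cosine integral represent both parts of a coefficient: e = 0 gives the
    real part and e = - PI / 2 the imaginary one. *)
Definition Ph (N k : Z) (e t y : R) : R := (IZR N - IZR k) * y - theta v j t y + e.

Definition osc (N k : Z) (e t : R) : R := RInt (fun y => phi y * cos (Ph N k e t y)) 0 (2 * PI).

Lemma phi_cont y : continuous phi y.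
Proof. eapply is_derive_continuous, phi_derive. Qed.

Lemma Ph_cont N k e t y : continuous (Ph N k e t) y.
Proof.
  apply continuous_Rplus; [|apply continuous_const].
  apply continuous_Rminus; [apply continuous_lin|].
  eapply is_derive_continuous. now apply theta_derive.
Qed.

Lemma packet_cont N t : ccont (packet N t).
Proof.
  apply ccont_mult; [apply ccont_RtoC, phi_cont|].
  apply (ccont_cis (fun y => IZR N * y - theta v j t y)). intros y.
  apply continuous_Rminus; [apply continuous_lin|].
  eapply is_derive_continuous. now apply theta_derive.
Qed.

Lemma cos_minus_PI2 x : cos (x + - (PI / 2)) = sin x.
Proof. replace (x + - (PI / 2)) with (- (PI / 2 - x)) by ring. rewrite cos_neg. apply cos_shift. Qed.

Lemma sin_minus_PI2 x : sin (x + - (PI / 2)) = - cos x.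
Proof. replace (x + - (PI / 2)) with (- (PI / 2 - x)) by ring. rewrite sin_neg, sin_shift. reflexivity. Qed.

Lemma cf_packet (w : R -> R) N t k :
  cf (fun y => RtoC (w y) * packet N t y)%C k =
  (RInt (fun y => w y * (phi y * cos (Ph N k 0 t y))) 0 (2 * PI) / (2 * PI),
   RInt (fun y => w y * (phi y * sin (Ph N k 0 t y))) 0 (2 * PI) / (2 * PI)).
Proof.
  pose proof PI_RGT_0. unfold cf.
  rewrite (CI_ext _ (fun y => (w y * (phi y * cos (Ph N k 0 t y)), w y * (phi y * sin (Ph N k 0 t y))))).
  - unfold CI. rewrite <- RtoC_inv by lra. unfold Cmult, RtoC; cbn [fst snd]. f_equal; field; lra.
  - intros y. unfold packet. rewrite <- !Cmult_assoc, <- cis_plus.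
    replace (IZR N * y - theta v j t y + - (IZR k * y)) with (Ph N k 0 t y) by (unfold Ph; ring).
    unfold cis, Cmult, RtoC; cbn [fst snd]. f_equal; ring.
Qed.

Lemma Wc_osc N t k : Wc N t k = (osc N k 0 t / (2 * PI), osc N k (- (PI / 2)) t / (2 * PI)).
Proof.
  unfold Wc. rewrite (cf_ext _ (fun y => RtoC 1 * packet N t y)%C) by (intros; ring).
  rewrite (cf_packet (fun _ => 1)). unfold osc. f_equal; f_equal; apply RInt_ext_all; intros y.
  - ring.
  - replace (Ph N k (- (PI / 2)) t y) with (Ph N k 0 t y + - (PI / 2)) by (unfold Ph; ring).
    rewrite cos_minus_PI2. ring.
Qed.

Lemma continuity_2d_1d (f : R -> R) (g : R -> R -> R) x y :
  (forall z, continuous f z) -> continuity_2d_pt g x y -> continuity_2d_pt (fun a b => f (g a b)) x y.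
Proof.
  intros Hf Hg. apply (continuity_1d_2d_pt_comp f g); [|assumption].
  apply continuity_pt_filterlim, Hf.
Qed.

Ltac cont2d :=
  repeat first
    [ apply continuity_2d_pt_id1 | apply continuity_2d_pt_id2 | apply continuity_2d_pt_const
    | match goal with
      | |- continuity_2d_pt (fun a b => @?f a b + @?g a b) _ _ => apply (continuity_2d_pt_plus f g)
      | |- continuity_2d_pt (fun a b => @?f a b - @?g a b) _ _ => apply (continuity_2d_pt_minus f g)
      | |- continuity_2d_pt (fun a b => @?f a b * @?g a b) _ _ => apply (continuity_2d_pt_mult f g)
      | H : forall z, continuous ?f z |- continuity_2d_pt (fun a b => ?f (@?g a b)) _ _ =>
          apply (continuity_2d_1d f g _ _ H)
      end ].

Lemma theta_cont_2d t y : continuity_2d_pt (fun t y => theta v j t y) t y.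
Proof.
  assert (HPc : forall z, continuous (Pc v j) z) by (intros; eapply is_derive_continuous; now apply is_derive_Pc).
  assert (HPs : forall z, continuous (Ps v j) z) by (intros; eapply is_derive_continuous; now apply is_derive_Ps).
  assert (Hcos : forall z, continuous cos z) by (intros; apply continuous_cos_R, continuous_id).
  assert (Hsin : forall z, continuous sin z) by (intros; apply continuous_sin_R, continuous_id).
  unfold theta. cont2d.
Qed.

Lemma osc_integrand_derive N k e t y :
  is_derive (fun t => phi y * cos (Ph N k e t y)) t
    (phi y * (sin (Ph N k e t y) * (cos (c * t) * v (y + t)))).
Proof.
  apply is_derive_Rscal. eapply is_derive_eq.
  - apply (is_derive_Rcomp cos (fun t => Ph N k e t y)).
    + apply is_derive_Reals, derivable_pt_lim_cos.
    + apply (is_derive_plus (fun t => (IZR N - IZR k) * y - theta v j t y) (fun _ => e));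
        [|apply @is_derive_const].
      apply (is_derive_minus (fun _ => (IZR N - IZR k) * y) (fun t => theta v j t y));
        [apply @is_derive_const|now apply theta_time_derive].
  - unfold minus, plus, opp, zero; simpl. fold c. ring.
Qed.

Lemma osc_derive N k e t :
  is_derive (osc N k e) t
    (RInt (fun y => (cos (c * t) * v (y + t)) * (phi y * sin (Ph N k e t y))) 0 (2 * PI)).
Proof.
  assert (HD : forall t y, Derive (fun t => phi y * cos (Ph N k e t y)) t
    = phi y * (sin (Ph N k e t y) * (cos (c * t) * v (y + t))))
    by (intros; apply is_derive_unique, osc_integrand_derive).
  assert (Hcos : forall z, continuous cos z) by (intros; apply continuous_cos_R, continuous_id).
  assert (Hsin : forall z, continuous sin z) by (intros; apply continuous_sin_R, continuous_id).
  assert (Hvc : forall z, continuous v z) by (intros; now apply smooth_continuous).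
  pose proof phi_cont as Hphi.
  eapply is_derive_eq.
  - apply (is_derive_RInt_param (fun t y => phi y * cos (Ph N k e t y)) 0 (2 * PI) t).
    + apply filter_forall. intros x y _. eexists. apply osc_integrand_derive.
    + intros y _. eapply continuity_2d_pt_ext; [intros; symmetry; apply HD|].
      unfold Ph. cont2d. apply theta_cont_2d.
    + apply filter_forall. intros x. apply ex_RInt_cont. intros y.
      apply continuous_Rmult; [apply phi_cont|apply continuous_cos_R, Ph_cont].
  - apply RInt_ext_all. intros y. rewrite HD. ring.
Qed.

Lemma Wc_cder N t k : cder (fun s => Wc N s k) t (- Ci * lWc N t k)%C.
Proof.
  pose proof PI_RGT_0.
  eapply cder_ext; [intros s; symmetry; apply Wc_osc|].
  unfold lWc. rewrite (cf_packet (fun y => cos (IZR j * t) * v (y + t))). fold c.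
  pose proof (osc_derive N k 0 t) as H0. pose proof (osc_derive N k (- (PI / 2)) t) as H1.
  split; cbn [fst snd].
  - eapply is_derive_eq.
    + apply (is_derive_ext (fun s => / (2 * PI) * osc N k 0 s)); [intros; unfold Rdiv; apply Rmult_comm|].
      apply is_derive_Rscal, H0.
    + unfold Ci, Copp, Cmult; cbn [fst snd]. field. lra.
  - eapply is_derive_eq.
    + apply (is_derive_ext (fun s => / (2 * PI) * osc N k (- (PI / 2)) s));
        [intros; unfold Rdiv; apply Rmult_comm|].
      apply is_derive_Rscal, H1.
    + rewrite (RInt_ext_all _ (fun y => (-1) * ((cos (c * t) * v (y + t)) * (phi y * cos (Ph N k 0 t y))))).
      * rewrite RInt_Rscal; [unfold Ci, Copp, Cmult; cbn [fst snd]; field; lra|].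
        intros y. apply continuous_Rmult.
        { apply continuous_Rmult; [apply continuous_const|].
          apply continuous_shift. intros; now apply smooth_continuous. }
        apply continuous_Rmult; [apply phi_cont|apply continuous_cos_R, Ph_cont].
      * intros y.
        replace (Ph N k (- (PI / 2)) t y) with (Ph N k 0 t y + - (PI / 2)) by (unfold Ph; ring).
        rewrite sin_minus_PI2. ring.
Qed.

Lemma packet_bound B N t y : (forall y, Rabs (phi y) <= B) -> Cmod (packet N t y) <= B.
Proof.
  intros H. unfold packet. rewrite Cmod_mult, Cmod_cis, Cmod_R, Rmult_1_r. apply H.
Qed.

(** On the support of [phi] the phase has slope at least N - k + c0 t - M. With A = N / 2 + c0 t,
    the conditions M <= N / 2 and k <= A / 2 leave at least A / 2, which is the [a] of the
    non-stationary phase estimate. *)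
Lemma osc_bound B M N k e t :
  0 < B -> (forall y, Rabs (phi y) <= B /\ Rabs (phi1 y) <= B /\ Rabs (phi2 y) <= B) ->
  0 < M -> (forall t y, 0 <= t -> t * sg y - M <= - theta1 v j t y /\
    Rabs (theta2 v j t y) <= M * (1 + t) /\ Rabs (theta3 v j t y) <= M * (1 + t)) ->
  0 <= t -> 2 * M <= IZR N -> 1 <= IZR N -> IZR k <= (IZR N / 2 + c0 * t) / 2 ->
  Rabs (osc N k e t) <= 2 * PI * (B * (1 + 4 * (M * (4 + 2 / c0)) + 3 * (M * (4 + 2 / c0)) ^ 2)
    / ((IZR N / 2 + c0 * t) / 2) ^ 2).
Proof.
  intros HB Hphi HM Hth Ht HN HN1 Hk.
  set (a := (IZR N / 2 + c0 * t) / 2) in *.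
  assert (Hct : 0 <= c0 * t) by (apply Rmult_le_pos; lra).
  assert (H2c : 0 < 2 / c0) by (apply Rdiv_lt_0_compat; lra).
  (* Origin of the factor 4 + 2 / c0: 4 a >= N >= 1 and (2 / c0) a >= t, so the growth 1 + t of the
     phase derivatives is absorbed by [a]. *)
  assert (Hkap : M * (1 + t) <= M * (4 + 2 / c0) * a).
  { rewrite Rmult_assoc. apply Rmult_le_compat_l; [lra|].
    replace ((4 + 2 / c0) * a) with (2 * (2 * a - c0 * t) + (2 / c0) * a + 2 * (c0 * t)) by ring.
    assert ((2 / c0) * a >= t).
    { unfold a. replace (2 / c0 * ((IZR N / 2 + c0 * t) / 2)) with (IZR N / 2 * / c0 + t) by (field; lra).
      assert (0 < / c0) by (apply Rinv_0_lt_compat; lra). nra. }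
    unfold a in *. lra. }
  assert (Eper : forall x y, cis x = cis y -> cos x = cos y /\ sin x = sin y)
    by (intros x y E; split; [apply (f_equal fst E)|apply (f_equal snd E)]).
  (* The phase itself is not periodic, but it increases over a period by 2 pi times the integer N -
     k. *)
  assert (EPh : cis (Ph N k e t (2 * PI)) = cis (Ph N k e t 0)).
  { unfold Ph. replace (theta v j t (2 * PI)) with (theta v j t 0)
      by (rewrite <- (theta_period v j Hv t 0); f_equal; ring).
    replace ((IZR N - IZR k) * (2 * PI) - theta v j t 0 + e)
      with (IZR (N - k) * (2 * PI) + ((IZR N - IZR k) * 0 - theta v j t 0 + e))
      by (rewrite minus_IZR; ring).
    rewrite cis_plus, cis_2PI_Z. ring. }
  destruct (Eper _ _ EPh) as [Ec Es].
  apply (nonstationary_phase phi phi1 phi2 (Ph N k e t)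
    (fun y => (IZR N - IZR k) - theta1 v j t y) (fun y => - theta2 v j t y) (fun y => - theta3 v j t y)).
  - unfold a. lra.
  - lra.
  - apply Rmult_le_pos; lra.
  - apply phi_derive.
  - apply phi1_derive.
  - intros y. eapply is_derive_eq.
    + apply (is_derive_plus (fun y => (IZR N - IZR k) * y - theta v j t y) (fun _ => e));
        [|apply @is_derive_const].
      apply (is_derive_minus (fun y => (IZR N - IZR k) * y) (theta v j t)); [|now apply theta_derive].
      apply is_derive_Rscal, @is_derive_id.
    + unfold minus, plus, opp, zero, one; simpl. ring.
  - intros y. eapply is_derive_eq.
    + apply (is_derive_minus (fun _ => IZR N - IZR k) (theta1 v j t));
        [apply @is_derive_const|now apply theta1_derive].
    + unfold minus, plus, opp, zero; simpl. ring.
  - intros y. apply (is_derive_opp (theta2 v j t)). now apply theta2_derive.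
  - intros; apply Hphi.
  - intros; apply Hphi.
  - intros; apply Hphi.
  - intros y. rewrite Rabs_Ropp. eapply Rle_trans; [apply Hth|]; assumption.
  - intros y. rewrite Rabs_Ropp. eapply Rle_trans; [apply Hth|]; assumption.
  - intros y. destruct (phi_dichotomy y) as [Hy|Hy]; [left|now right].
    destruct (Hth t y Ht) as [H1 _].
    assert (c0 * t <= t * sg y) by nra. unfold a in *. lra.
  - rewrite <- (Rplus_0_l (2 * PI)). apply phi_period.
  - rewrite <- (Rplus_0_l (2 * PI)). apply phi_period.
  - rewrite <- (Rplus_0_l (2 * PI)). now rewrite theta1_period.
  - rewrite <- (Rplus_0_l (2 * PI)). now rewrite theta2_period.
  - assumption.
  - assumption.
Qed.

(** Fourier matrix of multiplication by cos (j t) v (y + t). It is the matrix obtained from the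
    interaction picture when |D| is replaced by D: the phase is (k - m) t instead of (|k| - |m|)
    t. *)
Definition Akm (t : R) (k m : Z) : C :=
  (RtoC (cos (IZR j * t)) * (fourier v (k - m) * cis (IZR (k - m) * t)))%C.

(** Truncating the row [k] in [m] amounts to replacing v (y + t) by a partial Fourier sum before
    taking the coefficient. The inversion error is uniform in [y], so a sup bound on the packet is
    enough and no decay of its coefficients enters. *)
Lemma Wc_conv B D N t k n :
  (forall y, Rabs (phi y) <= B) -> (forall l, Cmod (fourier v l) <= D * / br l ^ 3) ->
  Cmod (lWc N t k - csum n (fun m => Akm t k m * Wc N t m)%C) <= 8 * D * B * br k / (INR n + 1).
Proof.
  intros HB HD. pose proof (packet_cont N t) as Hp.
  assert (Hn : 0 < INR n + 1) by (pose proof (pos_INR n); lra).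
  pose proof (decay_nonneg (fourier v) D 3 HD) as HD0.
  assert (Hvc : ccont (fun y => RtoC (v (y + t)))).
  { apply ccont_RtoC. intros y. apply continuous_shift. intros; now apply smooth_continuous. }
  assert (Hcis : forall m, ccont (fun y => cis (IZR (k - m) * (y + t)))).
  { intros m. apply (ccont_cis (fun y => IZR (k - m) * (y + t))). intros y.
    apply (continuous_shift (fun z => IZR (k - m) * z)), continuous_lin. }
  set (S := fun y => csum n (fun m => fourier v (k - m) * cis (IZR (k - m) * (y + t)))%C).
  assert (HS : ccont S).
  { apply (ccont_csum n (fun m y => fourier v (k - m) * cis (IZR (k - m) * (y + t)))%C).
    intros m. pose proof (Hcis m). ccont_auto. }
  assert (E1 : lWc N t k = (RtoC (cos (IZR j * t)) * cf (fun y => RtoC (v (y + t)) * packet N t y)%C k)%C).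
  { unfold lWc. rewrite <- cf_scal by ccont_auto. apply cf_ext. intros y. rewrite RtoC_mult. ring. }
  assert (E2 : csum n (fun m => Akm t k m * Wc N t m)%C
    = (RtoC (cos (IZR j * t)) * cf (fun y => S y * packet N t y)%C k)%C).
  { rewrite (cf_ext _ (fun y => csum n (fun m => (fourier v (k - m) * cis (IZR (k - m) * t))
      * (cis (IZR (k - m) * y) * packet N t y))%C)).
    - rewrite (cf_csum n (fun m y => (fourier v (k - m) * cis (IZR (k - m) * t))
        * (cis (IZR (k - m) * y) * packet N t y))%C).
      + rewrite <- csum_scal. apply csum_ext. intros m _. unfold Akm, Wc.
        rewrite cf_scal by ccont_auto. rewrite cf_shift. ring.
      + intros m. ccont_auto.
    - intros y. unfold S. rewrite <- csum_scal_r. apply csum_ext. intros m _.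
      rewrite Rmult_plus_distr_l, cis_plus. ring. }
  rewrite E1, E2.
  replace (cos (IZR j * t) * cf (fun y => v (y + t) * packet N t y) k
    - cos (IZR j * t) * cf (fun y => S y * packet N t y) k)%C
    with (cos (IZR j * t) * (cf (fun y => v (y + t) * packet N t y) k
      - cf (fun y => S y * packet N t y) k))%C by ring.
  rewrite <- cf_minus by ccont_auto. rewrite Cmod_mult, Cmod_R.
  pose proof (Rabs_cos_le (IZR j * t)) as Hcos.
  assert (Hb : Cmod (cf (fun y => v (y + t) * packet N t y - S y * packet N t y)%C k)
    <= 2 * (4 * D * br k / (INR n + 1) * B)).
  { apply cf_bound; [ccont_auto|]. intros y.
    replace (v (y + t) * packet N t y - S y * packet N t y)%C
      with ((RtoC (v (y + t)) - S y) * packet N t y)%C by ring.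
    rewrite Cmod_mult. apply Rmult_le_compat; try apply Cmod_ge_0; [|now apply packet_bound].
    apply (fourier_inversion v Hv (y + t) D k n HD). }
  replace (8 * D * B * br k / (INR n + 1)) with (2 * (4 * D * br k / (INR n + 1) * B)) by (field; lra).
  pose proof (Cmod_ge_0 (cf (fun y => v (y + t) * packet N t y - S y * packet N t y)%C k)).
  pose proof (Rabs_pos (cos (IZR j * t))). nra.
Qed.

(** At time 0 the packet is phi e^{iNy}; its N-th coefficient is the mean of [phi], the same for
    every N. *)
Lemma Wc_init N : Wc N 0 N = RtoC (RInt phi 0 (2 * PI) / (2 * PI)) /\ 0 < RInt phi 0 (2 * PI).
Proof.
  split.
  - rewrite Wc_osc. unfold RtoC. f_equal.
    + f_equal. apply RInt_ext_all. intros y. unfold Ph. rewrite theta_0.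
      replace ((IZR N - IZR N) * y - 0 + 0) with 0 by ring. rewrite cos_0. ring.
    + unfold osc. rewrite (RInt_ext_all _ (fun y => 0 * 0)).
      * rewrite RInt_Rscal by (intros; apply continuous_const). unfold Rdiv. ring.
      * intros y. unfold Ph. rewrite theta_0.
        replace ((IZR N - IZR N) * y - 0 + - (PI / 2)) with (- (PI / 2)) by ring.
        rewrite cos_neg, cos_PI2. ring.
  - apply (RInt_pos phi y0); [apply phi_cont| |assumption|].
    + intros x. unfold phi. apply pow_le, Rmax_l.
    + unfold phi. apply pow_lt. rewrite Rmax_right; lra.
Qed.

(** The order of quantifiers matters: [CW] and [p0] are fixed before N, which will be chosen large
    in terms of both. *)
Lemma wave_packet D :
  (forall l, Cmod (fourier v l) <= D * / br l ^ 3) ->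
  exists CW p0 N0, 0 < CW /\ 0 < p0 /\
  forall N, N0 <= IZR N -> exists W lW : R -> Z -> C,
    (forall t k, cder (fun s => W s k) t (- Ci * lW t k)%C) /\
    (forall t k, Cmod (W t k) <= CW) /\
    (forall t n, rsum n (fun k => Cmod (W t k) ^ 2) <= CW ^ 2) /\
    (forall t k, 0 <= t -> IZR k <= (IZR N / 2 + c0 * t) / 2 ->
      Cmod (W t k) <= CW / (IZR N / 2 + c0 * t) ^ 2) /\
    (forall t k n, Cmod (lW t k - csum n (fun m => Akm t k m * W t m)%C) <= CW * br k / (INR n + 1)) /\
    W 0 N = RtoC p0.
Proof.
  intros HD. pose proof PI_RGT_0.
  destruct phi_bounds as [B [HB Hphi]].
  destruct (phase_bounds v j Hv) as [M [HM Hth]].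
  pose proof (decay_nonneg (fourier v) D 3 HD) as HD0.
  set (Q := B * (1 + 4 * (M * (4 + 2 / c0)) + 3 * (M * (4 + 2 / c0)) ^ 2)).
  assert (HQ : 0 < Q).
  { unfold Q. assert (0 < 2 / c0) by (apply Rdiv_lt_0_compat; lra).
    assert (0 < M * (4 + 2 / c0)) by (apply Rmult_lt_0_compat; lra).
    apply Rmult_lt_0_compat; [assumption|]. nra. }
  assert (HB' : forall y, Rabs (phi y) <= B) by (intros; apply Hphi).
  assert (HDB : 0 <= 8 * D * B) by (apply Rmult_le_pos; lra).
  set (CW := 2 * B + 8 * Q + 8 * D * B).
  exists CW, (RInt phi 0 (2 * PI) / (2 * PI)), (2 * M + 1).
  split; [unfold CW; lra|]. split.
  { apply Rdiv_lt_0_compat; [apply (proj2 (Wc_init 0))|lra]. }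
  intros N HN. exists (Wc N), (lWc N). split; [|split; [|split; [|split; [|split]]]].
  - apply Wc_cder.
  - intros t k. apply Rle_trans with (2 * B); [|unfold CW; lra].
    apply cf_bound; [apply packet_cont|]. intros; now apply packet_bound.
  - intros t n. apply Rle_trans with (B ^ 2).
    + apply bessel; [apply packet_cont|]. intros; now apply packet_bound.
    + apply pow_incr. unfold CW. lra.
  - intros t k Ht Hk. rewrite Wc_osc. eapply Rle_trans; [apply Cmod_le_sum|]. cbn [fst snd].
    assert (HA : 0 < IZR N / 2 + c0 * t) by (assert (0 <= c0 * t) by (apply Rmult_le_pos; lra); lra).
    assert (Ho : forall e, Rabs (osc N k e t / (2 * PI)) <= 4 * Q / (IZR N / 2 + c0 * t) ^ 2).
    { intros e. unfold Rdiv at 1. rewrite Rabs_mult, (Rabs_pos_eq (/ (2 * PI))) by (left; apply Rinv_0_lt_compat; lra).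
      pose proof (osc_bound B M N k e t HB Hphi HM Hth Ht ltac:(lra) ltac:(lra) Hk) as H1. fold Q in H1.
      apply Rle_trans with (2 * PI * (Q / ((IZR N / 2 + c0 * t) / 2) ^ 2) * / (2 * PI)).
      - apply Rmult_le_compat_r; [left; apply Rinv_0_lt_compat; lra|assumption].
      - apply Req_le. field. split; lra. }
    pose proof (Ho 0). pose proof (Ho (- (PI / 2))).
    apply Rle_trans with (8 * Q / (IZR N / 2 + c0 * t) ^ 2).
    + replace (8 * Q / (IZR N / 2 + c0 * t) ^ 2)
        with (4 * Q / (IZR N / 2 + c0 * t) ^ 2 + 4 * Q / (IZR N / 2 + c0 * t) ^ 2) by (field; lra). lra.
    + apply Rmult_le_compat_r; [left; apply Rinv_0_lt_compat, pow_lt; assumption|unfold CW; lra].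
  - intros t k n. eapply Rle_trans; [now apply (Wc_conv B D)|].
    apply Rmult_le_compat_r; [left; apply Rinv_0_lt_compat; pose proof (pos_INR n); lra|].
    apply Rmult_le_compat_r; [left; apply br_pos|unfold CW; lra].
  - apply Wc_init.
Qed.

End Packet.

(** Here v_j = ma - i mb. Sampling |j| y at 0, pi/2, pi and 3 pi/2 gives |j| times mb or ma with
    both signs, and one of these four values is positive. The samples stay below 2 pi because |j| >=
    1. *)
Lemma drift_positive v j : (forall x, continuous v x) -> j <> 0%Z -> fourier v j <> RtoC 0 ->
  exists y0, 0 <= y0 < 2 * PI /\ 0 < drift v j y0.
Proof.
  intros Hv Hj Hf. pose proof PI_RGT_0.
  assert (Hab : ma v j <> 0 \/ mb v j <> 0).
  { destruct (Req_EM_T (ma v j) 0) as [Ea|]; [|now left].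
    destruct (Req_EM_T (mb v j) 0) as [Eb|]; [|now right].
    exfalso. apply Hf. unfold fourier, RtoC.
    rewrite (RInt_ext_all _ (fun s => cos (IZR j * s) * v s)) by (intros; ring).
    rewrite (RInt_ext_all (fun x => v x * sin _) (fun s => sin (IZR j * s) * v s)) by (intros; ring).
    change ((ma v j, - mb v j) = (0, 0)). rewrite Ea, Eb. f_equal. ring. }
  set (J := Rabs (IZR j)).
  assert (HJ : 1 <= J) by (unfold J; rewrite <- abs_IZR; apply IZR_le; lia).
  assert (Hrange : forall q, 0 <= q <= 3 / 2 -> 0 <= q * PI / J < 2 * PI).
  { intros q Hq. split.
    - apply Rmult_le_pos; [nra|left; apply Rinv_0_lt_compat; lra].
    - apply Rlt_div_l; [lra|]. nra. }
  assert (Hsg : exists s, (s = 1 \/ s = -1) /\ IZR j = s * J).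
  { unfold J, Rabs. destruct (Rcase_abs (IZR j)); [exists (-1)|exists 1]; split; auto; lra. }
  destruct Hsg as [s [Hs Ej]].
  assert (Hval : forall q, drift v j (q * PI / J)
    = s * J * (ma v j * (s * sin (q * PI)) - mb v j * cos (q * PI))).
  { intros q. unfold drift. rewrite Ej.
    replace (s * J * (q * PI / J)) with (s * (q * PI)) by (field; lra).
    destruct Hs as [-> | ->].
    - rewrite !Rmult_1_l. reflexivity.
    - replace (-1 * (q * PI)) with (- (q * PI)) by ring. rewrite sin_neg, cos_neg. ring. }
  assert (Hss : s * s = 1) by (destruct Hs as [-> | ->]; ring).
  destruct (Req_EM_T (mb v j) 0) as [Eb|Eb].
  - destruct Hab as [Ha|]; [|contradiction].
    destruct (Rlt_dec 0 (ma v j)) as [Hpos|Hneg].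
    + exists (1 / 2 * PI / J). split; [apply Hrange; lra|]. rewrite Hval, Eb.
      replace (1 / 2 * PI) with (PI / 2) by field. rewrite sin_PI2.
      replace (s * J * (ma v j * (s * 1) - 0 * cos (PI / 2))) with (s * s * (J * ma v j)) by ring.
      rewrite Hss. nra.
    + exists (3 / 2 * PI / J). split; [apply Hrange; lra|]. rewrite Hval, Eb.
      replace (3 / 2 * PI) with (3 * (PI / 2)) by field.
      rewrite sin_3PI2.
      replace (s * J * (ma v j * (s * -1) - 0 * cos (3 * (PI / 2)))) with (s * s * (J * - ma v j)) by ring.
      rewrite Hss. nra.
  - destruct (Rlt_dec 0 (s * mb v j)) as [Hpos|Hneg].
    + exists (1 * PI / J). split; [apply Hrange; lra|]. rewrite Hval.
      rewrite Rmult_1_l, sin_PI, cos_PI. 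
      replace (s * J * (ma v j * (s * 0) - mb v j * -1)) with (J * (s * mb v j)) by ring. nra.
    + exists (0 * PI / J). split; [apply Hrange; lra|]. rewrite Hval.
      rewrite Rmult_0_l, sin_0, cos_0.
      replace (s * J * (ma v j * (s * 0) - mb v j * 1)) with (J * - (s * mb v j)) by ring.
      assert (s * mb v j <> 0) by (destruct Hs as [-> | ->]; lra).
      assert (s * mb v j < 0) by lra. nra.
Qed.

(** * Sobolev norms *)

Lemma rsum_halves (f : Z -> R) n :
  rsum (S n) f = sum_n (fun i => f (Z.of_nat i)) n + sum_n (fun i => f (- Z.of_nat (S i))%Z) n.
Proof.
  induction n as [|n IH].
  - rewrite !sum_O. cbn [rsum]. ring.
  - rewrite !sum_Sn. remember (S n) as q. cbn [rsum]. rewrite IH. unfold plus; simpl. ring.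
Qed.

Lemma sum_n_nonneg_incr (a : nat -> R) : (forall n, 0 <= a n) ->
  forall n, sum_n a n <= sum_n a (S n).
Proof. intros H n. rewrite sum_Sn. unfold plus; simpl. pose proof (H (S n)). lra. Qed.

Lemma sum_n_nonneg (a : nat -> R) : (forall n, 0 <= a n) -> forall n, 0 <= sum_n a n.
Proof.
  intros H n. induction n as [|n IH]; [rewrite sum_O; apply H|].
  eapply Rle_trans; [exact IH|now apply sum_n_nonneg_incr].
Qed.

Lemma ex_series_bounded (a : nat -> R) M :
  (forall n, 0 <= a n) -> (forall n, sum_n a n <= M) -> ex_series a.
Proof.
  intros Ha HM. destruct (ex_finite_lim_seq_incr (sum_n a) M) as [l Hl].
  - now apply sum_n_nonneg_incr.
  - exact HM.
  - exists l. exact Hl.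
Qed.

Lemma sum_n_le_Series (a : nat -> R) n : (forall n, 0 <= a n) -> ex_series a -> sum_n a n <= Series a.
Proof.
  intros Ha Hex. apply (is_lim_seq_incr_compare (sum_n a)).
  - apply (Series_correct a Hex).
  - now apply sum_n_nonneg_incr.
Qed.

Lemma rsum_le_Series (f : Z -> R) n :
  (forall k, 0 <= f k) ->
  ex_series (fun i => f (Z.of_nat i)) -> ex_series (fun i => f (- Z.of_nat (S i))%Z) ->
  rsum n f <= Series (fun i => f (Z.of_nat i)) + Series (fun i => f (- Z.of_nat (S i))%Z).
Proof.
  intros Hf H1 H2. eapply Rle_trans; [apply (rsum_incr n (S n)); auto|].
  rewrite rsum_halves. apply Rplus_le_compat; apply sum_n_le_Series; auto.
Qed.

Lemma zseries_bounded (f : Z -> R) M :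
  (forall k, 0 <= f k) -> (forall n, rsum n f <= M) ->
  ex_series (fun i => f (Z.of_nat i)) /\ ex_series (fun i => f (- Z.of_nat (S i))%Z) /\
  Series (fun i => f (Z.of_nat i)) + Series (fun i => f (- Z.of_nat (S i))%Z) <= M.
Proof.
  intros Hf HM.
  set (a := fun i => f (Z.of_nat i)). set (b := fun i => f (- Z.of_nat (S i))%Z).
  assert (Ha : forall n, 0 <= a n) by (intros; apply Hf).
  assert (Hb : forall n, 0 <= b n) by (intros; apply Hf).
  assert (Hab : forall n, sum_n a n + sum_n b n <= M)
    by (intros n; unfold a, b; rewrite <- (rsum_halves f n); apply HM).
  assert (Ea : ex_series a).
  { apply (ex_series_bounded a M Ha). intros n. pose proof (Hab n). pose proof (sum_n_nonneg b Hb n). lra. }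
  assert (Eb : ex_series b).
  { apply (ex_series_bounded b M Hb). intros n. pose proof (Hab n). pose proof (sum_n_nonneg a Ha n). lra. }
  split; [assumption|]. split; [assumption|].
  pose proof (Series_correct a Ea) as La. pose proof (Series_correct b Eb) as Lb.
  assert (L : is_lim_seq (fun n => sum_n a n + sum_n b n) (Series a + Series b))
    by (apply is_lim_seq_plus'; assumption).
  apply (is_lim_seq_le _ _ _ _ Hab L (is_lim_seq_const M)).
Qed.

Lemma Hterm_nonneg r f k : 0 <= Hterm r f k.
Proof. apply pow2_ge_0. Qed.

Lemma Hweight_le r n k : r <= INR n -> Hweight r k <= br k ^ n.
Proof.
  intros Hr. unfold Hweight. rewrite <- Rpower_pow by apply br_pos.
  replace (IZR (Z.abs k) + 1) with (br k) by (unfold br; ring).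
  apply Rle_Rpower; [apply br_ge_1|assumption].
Qed.

(** After the weight has been paid for, the terms are dominated by E^2 / br k ^ 2, with sum at most
    4 E^2; the factor 2 pi of the norm then gives sqrt (8 PI). *)
Lemma Hr_bound r n f E :
  r <= INR n -> 0 <= E -> (forall k, Cmod (f k) <= E * / br k ^ (n + 2)) ->
  in_Hr r f /\ Hr_norm r f <= sqrt (8 * PI) * E.
Proof.
  intros Hr HE Hf. pose proof PI_RGT_0.
  assert (Ht : forall k, Hterm r f k <= E ^ 2 * / br k ^ 2).
  { intros k. unfold Hterm. pose proof (br_ge_1 k).
    apply Rle_trans with ((E * / br k ^ 1) ^ 2).
    - apply pow_incr. split.
      + apply Rmult_le_pos; [left; apply exp_pos|apply Cmod_ge_0].
      + apply Rle_trans with (br k ^ n * (E * / br k ^ (n + 2))).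
        * apply Rmult_le_compat; [left; apply exp_pos|apply Cmod_ge_0|now apply Hweight_le|apply Hf].
        * replace (br k ^ n * (E * / br k ^ (n + 2))) with (E * / br k ^ 2)
            by (rewrite pow_add; field; split; [lra|apply Rgt_not_eq, br_pow_pos]).
          apply (decay_weaken _ E k 2 1); [lia|assumption|lra].
    - apply Req_le. rewrite pow_1. field. lra. }
  destruct (zseries_bounded (Hterm r f) (E ^ 2 * 4)) as [H1 [H2 H3]].
  - intros; apply Hterm_nonneg.
  - intros q. eapply Rle_trans; [apply rsum_le; intros; apply Ht|].
    rewrite rsum_scal. apply Rmult_le_compat_l; [apply pow2_ge_0|apply rsum_inv_br2_0].
  - split; [split; assumption|]. unfold Hr_norm.
    rewrite <- (sqrt_pow2 E) by assumption. rewrite <- sqrt_mult by (try apply pow2_ge_0; lra).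
    apply sqrt_le_1_alt. nra.
Qed.

Lemma rsum_plus n f g : rsum n (fun k => f k + g k) = rsum n f + rsum n g.
Proof. induction n as [|n IH]; cbn [rsum]; [ring|rewrite IH; ring]. Qed.

Lemma fourier_conj v n : (forall x, continuous v x) -> Cconj (fourier v n) = fourier v (- n).
Proof.
  intros Hv. rewrite !fourier_cf by assumption. unfold cf.
  assert (Hc : ccont (fun x => RtoC (v x))) by now apply ccont_RtoC.
  rewrite Cmult_conj, <- CI_conj by ccont_auto. f_equal.
  - pose proof PI_RGT_0. rewrite <- RtoC_inv by lra. unfold Cconj, RtoC; cbn. f_equal; ring.
  - apply CI_ext. intros x. rewrite Cmult_conj, cis_conj. f_equal.
    + unfold Cconj, RtoC; cbn. f_equal; ring.
    + f_equal. rewrite opp_IZR. ring.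
Qed.

Lemma fourier_scal (v : R -> R) a n : (forall x, continuous v x) ->
  fourier (fun x => a * v x) n = (RtoC a * fourier v n)%C.
Proof.
  intros Hv. rewrite fourier_cf.
  - rewrite (cf_ext _ (fun x => RtoC a * RtoC (v x))%C) by (intros; apply RtoC_mult).
    rewrite cf_scal by now apply ccont_RtoC. now rewrite fourier_cf.
  - intros x. apply continuous_Rmult; [apply continuous_const|apply Hv].
Qed.

Lemma cconv_scal c s l : cconv s l -> cconv (fun n => c * s n)%C (c * l)%C.
Proof.
  intros H eps He. destruct (H (eps / (Cmod c + 1))) as [N HN].
  { apply Rdiv_lt_0_compat; [assumption|pose proof (Cmod_ge_0 c); lra]. }
  exists N. intros n Hn. specialize (HN n Hn).
  replace (c * s n - c * l)%C with (c * (s n - l))%C by ring. rewrite Cmod_mult.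
  pose proof (Cmod_ge_0 c). pose proof (Cmod_ge_0 (s n - l)).
  apply Rlt_div_r in HN; [|lra]. nra.
Qed.

(** * The interaction picture *)

Section HalfWave.

Variables (v : R -> R) (j : Z).
Hypothesis Hv : smooth_periodic v.

Let Hvc : forall x, continuous v x := fun x => smooth_continuous v x Hv.

(* Matrix of the potential in the unknowns [u_k = e^{i |k| t} psi_k]. *)
Definition Kkm (t : R) (k m : Z) : C :=
  (RtoC (cos (IZR j * t)) * (fourier v (k - m) * cis ((IZR (Z.abs k) - IZR (Z.abs m)) * t)))%C.

Lemma Kkm_bound t k m : Cmod (Kkm t k m) <= Cmod (fourier v (k - m)).
Proof.
  unfold Kkm. rewrite !Cmod_mult, Cmod_cis, Cmod_R, Rmult_1_r.
  pose proof (Rabs_cos_le (IZR j * t)). pose proof (Cmod_ge_0 (fourier v (k - m))). nra.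
Qed.

(** The oscillation frequency satisfies | |k| - |m| | <= |k - m|, so a time increment costs one
    power of [br (k - m)], to be absorbed by the decay of the Fourier coefficients of [v]. *)
Lemma Kkm_lipschitz s t k m :
  Cmod (Kkm t k m - Kkm s k m) <=
  Cmod (fourier v (k - m)) * (2 * (Rabs (IZR j) + 1) * br (k - m) * Rabs (t - s)).
Proof.
  set (w := IZR (Z.abs k) - IZR (Z.abs m)).
  assert (Hw : Rabs w <= br (k - m)).
  { unfold w, br. rewrite <- minus_IZR, <- abs_IZR.
    apply Rle_trans with (IZR (Z.abs (k - m))); [apply IZR_le; lia|lra]. }
  unfold Kkm. fold w.
  replace (cos (IZR j * t) * (fourier v (k - m) * cis (w * t))
    - cos (IZR j * s) * (fourier v (k - m) * cis (w * s)))%C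
    with (fourier v (k - m) * (cos (IZR j * t) * (cis (w * t) - cis (w * s))
      + RtoC (cos (IZR j * t) - cos (IZR j * s)) * cis (w * s)))%C by (rewrite RtoC_minus; ring).
  rewrite Cmod_mult. apply Rmult_le_compat_l; [apply Cmod_ge_0|].
  eapply Rle_trans; [apply Cmod_triangle|]. rewrite !Cmod_mult, !Cmod_R, Cmod_cis, Rmult_1_r.
  pose proof (Rabs_cos_le (IZR j * t)). pose proof (Rabs_pos (cos (IZR j * t))).
  pose proof (Cmod_cis_minus (w * s) (w * t)) as H1.
  pose proof (Cmod_cis_minus (IZR j * s) (IZR j * t)) as H2.
  pose proof (Rabs_fst_le (cis (IZR j * t) - cis (IZR j * s))) as H3.
  change (fst (cis (IZR j * t) - cis (IZR j * s))%C) with (cos (IZR j * t) - cos (IZR j * s)) in H3.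
  rewrite <- Rmult_minus_distr_l, Rabs_mult in H1, H2.
  pose proof (Rabs_pos (t - s)). pose proof (Rabs_pos (IZR j)). pose proof (br_ge_1 (k - m)).
  pose proof (Cmod_ge_0 (cis (w * t) - cis (w * s))).
  assert (Rabs (cos (IZR j * t)) * Cmod (cis (w * t) - cis (w * s)) <= 2 * (br (k - m) * Rabs (t - s))).
  { apply Rle_trans with (1 * Cmod (cis (w * t) - cis (w * s))); [now apply Rmult_le_compat_r|]. nra. }
  assert (Rabs (IZR j) * Rabs (t - s) <= Rabs (IZR j) * br (k - m) * Rabs (t - s)).
  { apply Rmult_le_compat_r; [assumption|]. nra. }
  lra.
Qed.

Lemma Kkm_hermitian t k m : Cconj (Kkm t k m) = Kkm t m k.
Proof.
  unfold Kkm. rewrite !Cmult_conj, cis_conj, fourier_conj by exact Hvc.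
  replace (- (k - m))%Z with (m - k)%Z by lia.
  replace (- ((IZR (Z.abs k) - IZR (Z.abs m)) * t)) with ((IZR (Z.abs m) - IZR (Z.abs k)) * t) by ring.
  f_equal. unfold Cconj, RtoC; cbn. f_equal; ring.
Qed.

Lemma mode_solution p N : (3 <= p)%nat -> exists (u : R -> Z -> C) D,
  0 <= D /\ (forall t k m, Cmod (Kkm t k m) <= D * / br (k - m) ^ (p + 3)) /\
  (forall k, u 0 k = delta N k) /\
  (forall T, exists B, 0 <= B /\ forall t k, Rabs t <= T -> Cmod (u t k) <= B * / br k ^ p) /\
  (forall t k, cder (fun s => u s k) t (- Ci * Lop Kkm t (u t) k)%C) /\
  (forall t n, 0 <= t -> rsum n (fun k => Cmod (u t k) ^ 2) <= 1).
Proof.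
  intros Hp.
  (* One power beyond p + 3, spent on the Lipschitz bound in time; the extra factor in [D] is the
     constant of that bound. *)
  destruct (fourier_decay (p + 4) v Hv) as [D0 [HD0 Hdec]].
  set (D := 2 * (Rabs (IZR j) + 1) * D0). pose proof (Rabs_pos (IZR j)).
  assert (HD : D0 <= D) by (unfold D; nra).
  assert (HK : forall t k m, Cmod (Kkm t k m) <= D * / br (k - m) ^ (p + 3)).
  { intros t k m. eapply Rle_trans; [apply Kkm_bound|].
    apply (decay_weaken _ D (k - m) (p + 4) (p + 3)); [lia|lra|].
    eapply Rle_trans; [apply Hdec|]. apply Rmult_le_compat_r; [left; apply inv_br_pow_pos|assumption]. }
  assert (HKl : forall s t k m,
    Cmod (Kkm t k m - Kkm s k m) <= D * Rabs (t - s) * / br (k - m) ^ (p + 3)).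
  { intros s t k m. eapply Rle_trans; [apply Kkm_lipschitz|].
    pose proof (br_pos (k - m)). pose proof (br_pow_pos (k - m) (p + 3)).
    replace (D * Rabs (t - s) * / br (k - m) ^ (p + 3))
      with ((D0 * / br (k - m) ^ (p + 4)) * (2 * (Rabs (IZR j) + 1) * br (k - m) * Rabs (t - s))).
    - apply Rmult_le_compat_r; [|apply Hdec].
      pose proof (Rabs_pos (t - s)). repeat apply Rmult_le_pos; lra.
    - unfold D. replace (p + 4)%nat with (S (p + 3)) by lia. cbn [pow].
      field. split; lra. }
  destruct (linear_system_solution Kkm D p N) as [u [Hu0 [Hub Hud]]]; try assumption; [lra|].
  exists u, D. split; [lra|]. split; [assumption|]. split; [assumption|].
  split; [assumption|]. split; [assumption|].
  apply (l2_bound Kkm D p N u); try assumption; [lra|apply Kkm_hermitian].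
Qed.

(** The exponent n0 + 3 is spent as follows: n0 for the Sobolev weight, two powers required by
    [Hr_bound], and one for the factor |k| that reappears in the time derivative when psi_k =
    e^{-i|k|t} u_k is shown to be continuous into H^r. *)
Lemma half_wave_of_modes r n0 (u : R -> Z -> C) D :
  r <= INR n0 -> 0 <= D ->
  (forall t k m, Cmod (Kkm t k m) <= D * / br (k - m) ^ (n0 + 3 + 3)) ->
  (forall T, exists B, 0 <= B /\ forall t k, Rabs t <= T -> Cmod (u t k) <= B * / br k ^ (n0 + 3)) ->
  (forall t k, cder (fun s => u s k) t (- Ci * Lop Kkm t (u t) k)%C) ->
  half_wave_Hr_solution (fun t x => cos (IZR j * t) * v x) r
    (fun t k => cis (- IZR (Z.abs k) * t) * u t k)%C.
Proof.
  intros Hr HD HK Hub Hud.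
  assert (Hder : forall t k, cder (fun s => cis (- IZR (Z.abs k) * s) * u s k)%C t
    (- Ci * (RtoC (IZR (Z.abs k)) * (cis (- IZR (Z.abs k) * t) * u t k)
      + cis (- IZR (Z.abs k) * t) * Lop Kkm t (u t) k))%C).
  { intros t k. eapply cder_eq.
    - apply cder_mult; [apply cder_cis_lin|apply Hud].
    - rewrite RtoC_opp. ring. }
  assert (Hmod : forall t k, Cmod (cis (- IZR (Z.abs k) * t) * u t k) = Cmod (u t k))
    by (intros; rewrite Cmod_mult, Cmod_cis; ring).
  split; [|split].
  - intros t. destruct (Hub (Rabs t)) as [B [HB Hu]].
    apply (Hr_bound r n0 _ B Hr HB). intros k. rewrite Hmod.
    apply (decay_weaken _ B k (n0 + 3) (n0 + 2)); [lia|assumption|]. apply Hu. lra.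
  - intros t eps He. destruct (Hub (Rabs t + 1)) as [B [HB Hu]].
    set (L := 2 * (B + 4 * (D * B))).
    assert (HDB : 0 <= D * B) by now apply Rmult_le_pos.
    assert (HL : 0 <= L) by (unfold L; lra).
    assert (Hq : 0 < sqrt (8 * PI) * L + 1).
    { pose proof (sqrt_pos (8 * PI)). nra. }
    exists (Rmin 1 (eps / (sqrt (8 * PI) * L + 1))). split.
    { apply Rmin_pos; [lra|]. apply Rdiv_lt_0_compat; assumption. }
    intros s Hs. pose proof (Rmin_l 1 (eps / (sqrt (8 * PI) * L + 1))).
    pose proof (Rmin_r 1 (eps / (sqrt (8 * PI) * L + 1))).
    assert (Hs1 : Rabs s <= Rabs t + 1).
    { replace s with ((s - t) + t) by ring. eapply Rle_trans; [apply Rabs_triang|]. lra. }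
    pose proof (Rabs_pos (s - t)).
    apply Rle_lt_trans with (sqrt (8 * PI) * (L * Rabs (s - t))).
    + apply (Hr_bound r n0); [assumption|now apply Rmult_le_pos|]. intros k.
      set (b := / br k ^ (n0 + 2)).
      assert (Hb : 0 < b) by apply inv_br_pow_pos.
      replace (L * Rabs (s - t) * b) with (2 * ((B + 4 * (D * B)) * b) * Rabs (s - t)) by (unfold L; ring).
      apply (cder_lipschitz (fun s => cis (- IZR (Z.abs k) * s) * u s k)%C _
        ((B + 4 * (D * B)) * b) (Rabs t + 1) (fun x _ => Hder x k)); [|lra|assumption].
      intros x Hx. rewrite Cmod_mCi. eapply Rle_trans; [apply Cmod_triangle|].
      rewrite Cmod_mult, Hmod, Cmod_mult, Cmod_cis, Rmult_1_l, Cmod_R, Rabs_pos_eq by (apply IZR_le; lia).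
      destruct (Lop_conv Kkm D (n0 + 3) HD HK x (u x) B k (fun m => Hu x m Hx)) as [_ [_ H3]].
      assert (Hbr : br k * / br k ^ (n0 + 3) = b).
      { unfold b. replace (n0 + 3)%nat with (S (n0 + 2)) by lia. cbn [pow].
        field. split; apply Rgt_not_eq; [apply br_pow_pos|apply br_pos]. }
      assert (IZR (Z.abs k) * Cmod (u x k) <= B * b).
      { apply Rle_trans with (br k * (B * / br k ^ (n0 + 3))).
        - apply Rmult_le_compat; [apply IZR_le; lia|apply Cmod_ge_0|unfold br; lra|now apply Hu].
        - rewrite <- Hbr. lra. }
      assert (Cmod (Lop Kkm x (u x) k) <= 4 * (D * B) * b).
      { apply (decay_weaken _ (4 * (D * B)) k (n0 + 3) (n0 + 2)); [lia|lra|lra]. }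
      lra.
    + assert (Hlt : Rabs (s - t) < eps / (sqrt (8 * PI) * L + 1)) by lra.
      apply Rlt_div_r in Hlt; [|assumption]. lra.
  - intros t k. destruct (Hub (Rabs t)) as [B [HB Hu]].
    assert (Hu' : forall m, Cmod (u t m) <= B * / br m ^ (n0 + 3)) by (intros; apply Hu; lra).
    set (a := fun m => (fourier (fun x => (cos (IZR j * t) * v x)%R) (k - m)
      * (cis (- IZR (Z.abs m) * t) * u t m))%C).
    assert (Ea : forall m, a m = (cis (- IZR (Z.abs k) * t) * (Kkm t k m * u t m))%C).
    { intros m. unfold a, Kkm. rewrite fourier_scal by exact Hvc.
      replace (- IZR (Z.abs m) * t) with (- IZR (Z.abs k) * t
        + (IZR (Z.abs k) - IZR (Z.abs m)) * t) by ring.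
      rewrite cis_plus. ring. }
    assert (Hza : zsum a = (cis (- IZR (Z.abs k) * t) * Lop Kkm t (u t) k)%C).
    { apply zsum_unique.
      destruct (Lop_conv Kkm D (n0 + 3) HD HK t (u t) B k Hu') as [Hc _].
      intros eps He. destruct (cconv_scal (cis (- IZR (Z.abs k) * t)) _ _ Hc eps He) as [N HN].
      exists N. intros n Hn. rewrite (csum_ext n _ _ (fun m _ => Ea m)), csum_scal. now apply HN. }
    exists (- Ci * (RtoC (IZR (Z.abs k)) * (cis (- IZR (Z.abs k) * t) * u t k)
      + cis (- IZR (Z.abs k) * t) * Lop Kkm t (u t) k))%C, (zsum a).
    split; [|split].
    + apply cder_is_derive, Hder.
    + apply (zsum_is_zsum a (D * B)). intros m. rewrite Ea, Cmod_mult, Cmod_cis, Rmult_1_l, Cmod_mult.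
      rewrite Rmult_assoc. apply Rmult_le_compat; try apply Cmod_ge_0.
      * eapply Rle_trans; [apply HK|]. pose proof (inv_br_pow_le_1 (k - m) (n0 + 3 + 3)). nra.
      * apply (decay_weaken _ B m (n0 + 3) 3); [lia|assumption|apply Hu'].
    + rewrite Hza. set (c1 := cis (- IZR (Z.abs k) * t)). set (l := Lop Kkm t (u t) k).
      replace (Ci * (- Ci * (RtoC (IZR (Z.abs k)) * (c1 * u t k) + c1 * l)))%C
        with (- (Ci * Ci) * (RtoC (IZR (Z.abs k)) * (c1 * u t k) + c1 * l))%C by ring.
      replace (Ci * Ci)%C with (- (1))%C by (unfold Ci, Cmult, Copp, RtoC; cbn; f_equal; ring). ring.
Qed.

End HalfWave.

(** * Correlation with the wave packet *)

(** Projection onto the frequencies where |D| and D coincide. *)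
Definition chi (k : Z) : C := if Z_le_gt_dec 0 k then RtoC 1 else RtoC 0.

Lemma Cmod_chi k : Cmod (chi k) <= 1.
Proof. unfold chi. destruct (Z_le_gt_dec 0 k); rewrite ?Cmod_1, ?Cmod_0; lra. Qed.

Lemma Akm_bound v j t k m : Cmod (Akm v j t k m) <= Cmod (fourier v (k - m)).
Proof.
  unfold Akm. rewrite !Cmod_mult, Cmod_cis, Cmod_R, Rmult_1_r.
  pose proof (Rabs_cos_le (IZR j * t)). pose proof (Cmod_ge_0 (fourier v (k - m))). nra.
Qed.

(* The transport and half-wave matrices differ only between frequencies of opposite signs,
   where [|k - m| = |k| + |m|]. *)
Lemma coupling_bound v j D t k m :
  smooth_periodic v -> (forall l, Cmod (fourier v l) <= D * / br l ^ 6) ->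
  Cmod (chi k * Cconj (Akm v j t k m) - chi m * Kkm v j t m k) <= D * / br k ^ 2 * / br m ^ 4.
Proof.
  intros Hv HD.
  assert (Hvc : forall x, continuous v x) by (intros; now apply smooth_continuous).
  pose proof (decay_nonneg (fourier v) D 6 HD) as HD0.
  assert (Hpos : 0 <= D * / br k ^ 2 * / br m ^ 4).
  { repeat apply Rmult_le_pos; [assumption|left; apply inv_br_pow_pos|left; apply inv_br_pow_pos]. }
  (* The six powers are split unevenly on purpose: two in [k] for summability, four in [m] because
     two of them will be consumed by the growth in [m] of the bound for the packet. *)
  assert (Hopp : forall l, br k <= br l -> br m <= br l -> Cmod (fourier v l) <= D * / br k ^ 2 * / br m ^ 4).
  { intros l Hk Hm. eapply Rle_trans; [apply HD|]. rewrite Rmult_assoc.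
    apply Rmult_le_compat_l; [assumption|]. rewrite <- Rinv_mult.
    pose proof (br_pos k). pose proof (br_pos m).
    apply Rinv_le_contravar; [apply Rmult_lt_0_compat; apply br_pow_pos|].
    replace (br l ^ 6) with (br l ^ 2 * br l ^ 4) by ring.
    apply Rmult_le_compat; try (left; apply br_pow_pos); apply pow_incr; lra. }
  unfold chi. destruct (Z_le_gt_dec 0 k) as [Hk|Hk], (Z_le_gt_dec 0 m) as [Hm|Hm].
  - replace (1 * Cconj (Akm v j t k m) - 1 * Kkm v j t m k)%C with (RtoC 0); [now rewrite Cmod_0|].
    unfold Akm, Kkm. rewrite !Cmult_conj, cis_conj, fourier_conj, !Z.abs_eq by assumption.
    replace (- (k - m))%Z with (m - k)%Z by lia.
    replace (- (IZR (k - m) * t)) with ((IZR m - IZR k) * t) by (rewrite minus_IZR; ring).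
    replace (Cconj (cos (IZR j * t))) with (RtoC (cos (IZR j * t)))
      by (unfold Cconj, RtoC; cbn; f_equal; ring). ring.
  - replace (1 * Cconj (Akm v j t k m) - 0 * Kkm v j t m k)%C with (Cconj (Akm v j t k m)) by ring.
    rewrite Cmod_conj. eapply Rle_trans; [apply Akm_bound|].
    apply Hopp; unfold br; apply Rplus_le_compat_l, IZR_le; lia.
  - replace (0 * Cconj (Akm v j t k m) - 1 * Kkm v j t m k)%C with (- Kkm v j t m k)%C by ring.
    rewrite Cmod_opp. eapply Rle_trans; [apply Kkm_bound|].
    apply Hopp; unfold br; apply Rplus_le_compat_l, IZR_le; lia.
  - replace (0 * Cconj (Akm v j t k m) - 0 * Kkm v j t m k)%C with (RtoC 0) by ring. now rewrite Cmod_0.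
Qed.

(** The smallness of the packet at low frequency and its boundedness at high frequency merge into
    one estimate, |W_m| <= 4 CW br m ^ 2 / A^2, because A <= 2 br m when m > A / 2. The coupling
    absorbs the weight, and the two remaining sums contribute 4 each: 64 = 4 * 4 * 4. *)
Lemma coupling_sum_bound v j D t n A CW (W u : Z -> C) :
  smooth_periodic v -> (forall l, Cmod (fourier v l) <= D * / br l ^ 6) ->
  0 < A -> 0 <= CW ->
  (forall k, Cmod (W k) <= CW) -> (forall k, IZR k <= A / 2 -> Cmod (W k) <= CW / A ^ 2) ->
  (forall k, Cmod (u k) <= 1) ->
  Cmod (csum n (fun k => csum n (fun m =>
    Cconj (W m) * u k * (chi k * Cconj (Akm v j t k m) - chi m * Kkm v j t m k))%C))
  <= 64 * CW * D / A ^ 2.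
Proof.
  intros Hv HD HA HCW HW HWlow Hu.
  pose proof (decay_nonneg (fourier v) D 6 HD) as HD0.
  assert (HA2 : 0 < A ^ 2) by now apply pow_lt.
  assert (HW2 : forall m, Cmod (W m) <= 4 * CW / A ^ 2 * br m ^ 2).
  { intros m. pose proof (br_ge_1 m).
    assert (H4 : 0 <= CW / A ^ 2) by (apply Rmult_le_pos; [assumption|left; now apply Rinv_0_lt_compat]).
    destruct (Rle_dec (IZR m) (A / 2)) as [Hm|Hm].
    - eapply Rle_trans; [now apply HWlow|]. replace (4 * CW / A ^ 2) with (4 * (CW / A ^ 2)) by (field; lra).
      pose proof (br_pow_ge_1 m 2). set (x := CW / A ^ 2) in *. set (b := br m ^ 2) in *. nra.
    - eapply Rle_trans; [apply HW|].
      assert (A <= 2 * br m).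
      { unfold br. rewrite abs_IZR. pose proof (Rle_abs (IZR m)). lra. }
      replace (4 * CW / A ^ 2 * br m ^ 2) with ((CW / A ^ 2) * (2 * br m) ^ 2) by (field; lra).
      replace CW with ((CW / A ^ 2) * A ^ 2) at 1 by (field; lra).
      apply Rmult_le_compat_l; [assumption|]. apply pow_incr. lra. }
  set (q := 4 * CW * D / A ^ 2).
  assert (Hq : 0 <= q).
  { unfold q. apply Rmult_le_pos; [|left; now apply Rinv_0_lt_compat]. repeat apply Rmult_le_pos; lra. }
  apply Rle_trans with (rsum n (fun k => 4 * q * / br k ^ 2)).
  - apply Cmod_csum_le. intros k _.
    apply Rle_trans with (rsum n (fun m => (q * / br k ^ 2) * / br m ^ 2)).
    + apply Cmod_csum_le. intros m _. rewrite !Cmod_mult, Cmod_conj.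
      pose proof (coupling_bound v j D t k m Hv HD) as H1.
      set (z := Cmod (chi k * Cconj (Akm v j t k m) - chi m * Kkm v j t m k)) in *.
      apply Rle_trans with ((4 * CW / A ^ 2 * br m ^ 2) * (D * / br k ^ 2 * / br m ^ 4)).
      * apply Rmult_le_compat; [|apply Cmod_ge_0| |exact H1].
        { apply Rmult_le_pos; apply Cmod_ge_0. }
        rewrite <- (Rmult_1_r (4 * CW / A ^ 2 * br m ^ 2)).
        apply Rmult_le_compat; auto using Cmod_ge_0.
      * apply Req_le. unfold q. pose proof (br_pos k). pose proof (br_pos m). field. repeat split; lra.
    + rewrite rsum_scal. pose proof (rsum_inv_br2_0 n). pose proof (inv_br_pow_pos k 2).
      assert (0 <= q * / br k ^ 2) by (apply Rmult_le_pos; lra). nra.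
  - rewrite rsum_scal. pose proof (rsum_inv_br2_0 n).
    replace (64 * CW * D / A ^ 2) with (4 * q * 4) by (unfold q; field; lra). nra.
Qed.

(** * Lower bound for the mass at high frequencies *)

Definition high (A : R) (u : Z -> C) (k : Z) : R :=
  if Rlt_dec (A / 2) (IZR k) then Cmod (u k) ^ 2 else 0.

(* Young's inequality, with the packet's smallness below frequency [A / 2]. *)
Lemma pairing_high_bound A CW p0 n (W u : Z -> C) :
  0 < CW -> 0 < p0 -> 2 <= A -> 8 * CW / p0 <= A ->
  rsum n (fun k => Cmod (W k) ^ 2) <= CW ^ 2 ->
  (forall k, IZR k <= A / 2 -> Cmod (W k) <= CW / A ^ 2) ->
  rsum n (fun k => Cmod (u k) ^ 2) <= 1 ->
  p0 / 2 <= Cmod (csum n (fun k => chi k * (Cconj (W k) * u k))%C) ->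
  p0 ^ 2 / (16 * CW ^ 2) <= rsum n (high A u).
Proof.
  intros HCW Hp0 HA HA8 HW HWlow Hu HF.
  (* The weights in Young's inequality make three of the four resulting sums at most p0 / 8: the
     total mass of [u], the total mass of [W], and the low-frequency part of [W], for which A >= 8
     CW / p0 is used. The high part must supply the remaining p0 / 8. *)
  set (eta := p0 / 4). set (eps := p0 / (4 * CW ^ 2)).
  assert (Heta : 0 < eta) by (unfold eta; lra).
  assert (HCW2 : 0 < CW ^ 2) by now apply pow_lt.
  assert (Heps : 0 < eps) by (apply Rdiv_lt_0_compat; lra).
  assert (Hyoung : forall h x y, 0 < h -> x * y <= h / 2 * y ^ 2 + / (2 * h) * x ^ 2).
  { intros h x y Hh. assert (0 <= / (2 * h) * (x - h * y) ^ 2).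
    { apply Rmult_le_pos; [left; apply Rinv_0_lt_compat; lra|apply pow2_ge_0]. }
    replace (/ (2 * h) * (x - h * y) ^ 2) with (h / 2 * y ^ 2 + / (2 * h) * x ^ 2 - x * y) in H
      by (field; lra). lra. }
  assert (Hterm : forall k, Cmod (chi k * (Cconj (W k) * u k)) <=
    ((eta / 2 * Cmod (u k) ^ 2 + (/ (2 * eta) * (CW ^ 2 / A ^ 2)) * / br k ^ 2)
     + (eps / 2 * Cmod (W k) ^ 2 + / (2 * eps) * high A u k))).
  { intros k.
    assert (T1 : 0 <= eta / 2 * Cmod (u k) ^ 2) by (apply Rmult_le_pos; [lra|apply pow2_ge_0]).
    assert (T2 : 0 <= (/ (2 * eta) * (CW ^ 2 / A ^ 2)) * / br k ^ 2).
    { apply Rmult_le_pos; [|left; apply inv_br_pow_pos]. apply Rmult_le_pos.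
      - left; apply Rinv_0_lt_compat; lra.
      - left; apply Rdiv_lt_0_compat; [assumption|apply pow_lt; lra]. }
    assert (T3 : 0 <= eps / 2 * Cmod (W k) ^ 2) by (apply Rmult_le_pos; [lra|apply pow2_ge_0]).
    assert (T4 : 0 <= / (2 * eps) * high A u k).
    { apply Rmult_le_pos; [left; apply Rinv_0_lt_compat; lra|]. unfold high.
      destruct (Rlt_dec (A / 2) (IZR k)); [apply pow2_ge_0|lra]. }
    rewrite !Cmod_mult, Cmod_conj. pose proof (Cmod_ge_0 (W k)). pose proof (Cmod_ge_0 (u k)).
    unfold chi. destruct (Z_le_gt_dec 0 k) as [Hk|Hk]; [rewrite Cmod_1|rewrite Cmod_0; lra].
    rewrite Rmult_1_l. destruct (Rlt_dec (A / 2) (IZR k)) as [Hhi|Hlo].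
    - pose proof (Hyoung eps (Cmod (u k)) (Cmod (W k)) Heps).
      unfold high in *. destruct (Rlt_dec (A / 2) (IZR k)); [|lra]. lra.
    - pose proof (Hyoung eta (Cmod (W k)) (Cmod (u k)) Heta) as H1.
      (* Here 0 <= k <= A / 2 and A >= 2. Two of the four powers of 1 / A are exchanged for 1 / br k
         ^ 2, which makes the low-frequency bound summable over [k]. *)
      assert (Hbr : br k <= A) by (unfold br; rewrite Z.abs_eq by assumption; lra).
      assert (Cmod (W k) ^ 2 <= (CW ^ 2 / A ^ 2) * / br k ^ 2).
      { apply Rle_trans with ((CW / A ^ 2) ^ 2).
        - apply pow_incr. split; [assumption|]. apply HWlow. lra.
        - replace ((CW / A ^ 2) ^ 2) with ((CW ^ 2 / A ^ 2) * / A ^ 2) by (field; lra).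
          apply Rmult_le_compat_l; [left; apply Rdiv_lt_0_compat; [assumption|apply pow_lt; lra]|].
          apply Rinv_le_contravar; [apply br_pow_pos|]. apply pow_incr.
          split; [left; apply br_pos|assumption]. }
      assert (/ (2 * eta) * Cmod (W k) ^ 2 <= / (2 * eta) * (CW ^ 2 / A ^ 2) * / br k ^ 2).
      { rewrite Rmult_assoc. apply Rmult_le_compat_l; [left; apply Rinv_0_lt_compat; lra|assumption]. }
      lra. }
  pose proof (Cmod_csum_le n _ _ (fun k _ => Hterm k)) as Hsum.
  rewrite !rsum_plus, !rsum_scal in Hsum.
  pose proof (rsum_inv_br2_0 n) as H4.
  set (U := rsum n (high A u)) in *.
  assert (S1 : eta / 2 * rsum n (fun k => Cmod (u k) ^ 2) <= p0 / 8) by (unfold eta; nra).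
  assert (S3 : eps / 2 * rsum n (fun k => Cmod (W k) ^ 2) <= p0 / 8).
  { apply Rle_trans with (eps / 2 * CW ^ 2); [apply Rmult_le_compat_l; lra|].
    unfold eps. apply Req_le. field. lra. }
  assert (S2 : / (2 * eta) * (CW ^ 2 / A ^ 2) * rsum n (fun m => / br m ^ 2) <= p0 / 8).
  { assert (HA8' : 64 * CW ^ 2 <= p0 ^ 2 * A ^ 2).
    { apply Rle_div_l in HA8; [|lra]. nra. }
    assert (HA2 : 0 < A ^ 2) by (apply pow_lt; lra).
    apply Rle_trans with (/ (2 * eta) * (CW ^ 2 / A ^ 2) * 4).
    - apply Rmult_le_compat_l; [|assumption]. apply Rmult_le_pos.
      + left; apply Rinv_0_lt_compat; lra.
      + left; apply Rdiv_lt_0_compat; assumption.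
    - unfold eta. replace (/ (2 * (p0 / 4)) * (CW ^ 2 / A ^ 2) * 4) with (8 * CW ^ 2 / (p0 * A ^ 2)) by (field; lra).
      apply Rle_div_l; [nra|]. nra. }
  assert (S4 : p0 / 8 <= / (2 * eps) * U) by lra.
  apply (Rmult_le_compat_l (2 * eps)) in S4; [|lra].
  replace (2 * eps * (/ (2 * eps) * U)) with U in S4 by (field; lra).
  replace (p0 ^ 2 / (16 * CW ^ 2)) with (2 * eps * (p0 / 8)) by (unfold eps; field; lra). assumption.
Qed.

Lemma exists_Z_ge (x : R) : exists N : Z, (0 <= N)%Z /\ x <= IZR N.
Proof.
  destruct (INR_unbounded x) as [n Hn]. exists (Z.of_nat n).
  split; [lia|]. rewrite <- INR_IZR_INZ. lra.
Qed.

(** The correlation starts at p0 and loses at most p0 / 4 to the coupling over all times and p0 / 4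
    to truncation. The window [n] may depend on t, since the bound for [u] does, but the mass [kap]
    may not. *)
Lemma mass_transport v j c0 y0 p :
  smooth_periodic v -> 0 < c0 -> 0 <= y0 < 2 * PI -> c0 < drift v j y0 -> (3 <= p)%nat ->
  exists (u : R -> Z -> C) D kap,
    0 <= D /\ 0 < kap /\
    (forall t k m, Cmod (Kkm v j t k m) <= D * / br (k - m) ^ (p + 3)) /\
    (forall T, exists B, 0 <= B /\ forall t k, Rabs t <= T -> Cmod (u t k) <= B * / br k ^ p) /\
    (forall t k, cder (fun s => u s k) t (- Ci * Lop (Kkm v j) t (u t) k)%C) /\
    (forall t, 0 <= t -> exists n, kap <= rsum n (high (c0 * t) (u t))).
Proof.
  intros Hv Hc0 Hy0 Hdr Hp.
  destruct (fourier_decay 3 v Hv) as [D3 [HD3 Hdec3]].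
  destruct (fourier_decay 6 v Hv) as [D6 [HD6 Hdec6]].
  destruct (wave_packet v j c0 y0 Hv Hc0 Hy0 Hdr D3 Hdec3) as [CW [p0 [N0 [HCW [Hp0 HWP]]]]].
  set (Kc := 64 * CW * D6).
  assert (HKc : 0 <= Kc) by (unfold Kc; repeat apply Rmult_le_pos; lra).
  (* In order, the summands secure the packet estimates, A >= 2, A >= 8 CW / p0, and Kc / (c0 A(0))
     <= p0 / 8, where A(0) = N / 2. *)
  destruct (exists_Z_ge (Rabs N0 + 4 + 16 * CW / p0 + 16 * Kc / (c0 * p0))) as [N [HN0 HN]].
  assert (Hx1 : 0 <= 16 * CW / p0) by (left; apply Rdiv_lt_0_compat; lra).
  assert (Hx2 : 0 <= 16 * Kc / (c0 * p0)).
  { apply Rmult_le_pos; [lra|left; apply Rinv_0_lt_compat; nra]. }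
  pose proof (Rabs_pos N0). pose proof (Rle_abs N0).
  destruct (HWP N ltac:(lra)) as [W [lW [HdW [HWb [HWbes [HWlow [HWt HW0]]]]]]].
  destruct (mode_solution v j Hv p N Hp) as [u [D [HD [HK [Hu0 [Hub [Hud Hul2]]]]]]].
  exists u, D, (p0 ^ 2 / (16 * CW ^ 2)).
  split; [assumption|]. split.
  { apply Rdiv_lt_0_compat; [now apply pow_lt|]. assert (0 < CW ^ 2) by now apply pow_lt. lra. }
  split; [assumption|]. split; [assumption|]. split; [assumption|].
  intros t Ht.
  assert (Hu1 : forall s k, 0 <= s -> Cmod (u s k) <= 1).
  { intros s k Hs.
    pose proof (rsum_term_le (S (Z.to_nat (Z.abs k))) (fun k => Cmod (u s k) ^ 2) k
      (fun k => pow2_ge_0 _) ltac:(lia)) as H1.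
    pose proof (Hul2 s (S (Z.to_nat (Z.abs k))) Hs). pose proof (Cmod_ge_0 (u s k)).
    cbv beta in H1. nra. }
  destruct (Hub t) as [B [HB Hu]].
  set (A := fun s => IZR N / 2 + c0 * s).
  assert (HA : forall s, 0 <= s -> IZR N / 2 <= A s).
  { intros s Hs. unfold A. assert (0 <= c0 * s) by (apply Rmult_le_pos; lra). lra. }
  set (E := CW + 4 * D * B).
  assert (HDB : 0 <= 4 * D * B) by (repeat apply Rmult_le_pos; lra).
  assert (Hpair : forall n, Cmod (pairing W u chi n t - pairing W u chi n 0)
    <= 2 * (- (Kc / c0) / A t - - (Kc / c0) / A 0 + 4 * E * (CW + B) / (INR n + 1) * t)).
  { intros n. apply (pairing_bound W u lW (fun s k => Lop (Kkm v j) s (u s) k) (Akm v j) (Kkm v j) chi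
      t CW B E (fun s => - (Kc / c0) / A s) (fun s => Kc / A s ^ 2)).
    - assumption.
    - unfold E; lra.
    - lra.
    - assumption.
    - apply Cmod_chi.
    - intros; apply HWb.
    - intros s k Hs. apply (decay_weaken _ B k p 3); [assumption|assumption|].
      apply Hu. rewrite Rabs_pos_eq; lra.
    - intros; apply HdW.
    - intros; apply Hud.
    - intros s k n' Hs. eapply Rle_trans; [apply HWt|].
      apply Rmult_le_compat_r; [left; apply Rinv_0_lt_compat; pose proof (pos_INR n'); lra|].
      apply Rmult_le_compat_r; [left; apply br_pos|unfold E; lra].
    - intros s k n' Hs. eapply Rle_trans.
      + apply (Lop_tail (Kkm v j) D p B); try assumption.
        intros m. apply Hu. rewrite Rabs_pos_eq; lra.
      + apply Rmult_le_compat_r; [left; apply Rinv_0_lt_compat; pose proof (pos_INR n'); lra|].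
        apply Rmult_le_compat_r; [left; apply inv_br_pow_pos|unfold E; lra].
    - intros s Hs. pose proof (HA s ltac:(lra)). unfold A in *.
      auto_derive; [lra|]. field. split; lra.
    - intros s n' Hs. pose proof (HA s ltac:(lra)). unfold Kc.
      apply coupling_sum_bound; try assumption; try lra.
      + apply HWb.
      + intros k Hk. apply HWlow; [lra|exact Hk].
      + intros k. apply Hu1. lra. }
  assert (HG : - (Kc / c0) / A t - - (Kc / c0) / A 0 <= p0 / 8).
  { pose proof (HA t Ht) as HAt.
    assert (0 <= Kc / c0 / A t).
    { apply Rmult_le_pos; [apply Rmult_le_pos; [assumption|]|]; left; apply Rinv_0_lt_compat; lra. }
    assert (EA0 : A 0 = IZR N / 2) by (unfold A; ring).
    assert (Kc / c0 / A 0 <= p0 / 8).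
    { rewrite EA0. assert (HN2 : 16 * Kc / (c0 * p0) <= IZR N) by lra.
      apply Rle_div_l in HN2; [|nra].
      apply Rle_div_l; [lra|]. apply Rle_div_l; [assumption|]. nra. }
    unfold Rdiv in *. lra. }
  destruct (inv_INR_small (2 * (4 * E * (CW + B)) * t) (p0 / 4)) as [n1 Hn1]; [lra|].
  (* The window must beat the truncation error at time t and also contain the initial mode N, which
     is why the successor appears. *)
  set (n := Nat.max n1 (S (Z.to_nat N))). exists n.
  assert (Hinit : pairing W u chi n 0 = RtoC p0).
  { unfold pairing. rewrite (csum_ext n _ (fun k => (chi k * Cconj (W 0 k)) * delta N k)%C)
      by (intros; rewrite Hu0; ring).
    rewrite csum_delta by lia. rewrite HW0. unfold chi. destruct (Z_le_gt_dec 0 N); [|lia].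
    unfold Cconj, RtoC, Cmult; cbn. f_equal; ring. }
  assert (HF : p0 / 2 <= Cmod (pairing W u chi n t)).
  { specialize (Hpair n). rewrite Hinit in Hpair.
    assert (Hsmall : 2 * (4 * E * (CW + B) / (INR n + 1) * t) <= p0 / 4).
    { pose proof (pos_INR n1). assert (INR n1 <= INR n) by (apply le_INR; lia).
      replace (2 * (4 * E * (CW + B) / (INR n + 1) * t))
        with ((2 * (4 * E * (CW + B)) * t) * / (INR n + 1)) by (field; lra).
      apply Rle_trans with ((2 * (4 * E * (CW + B)) * t) * / (INR n1 + 1)); [|unfold Rdiv in Hn1; lra].
      apply Rmult_le_compat_l; [|apply Rinv_le_contravar; lra].
      assert (0 <= E) by (unfold E; lra). repeat apply Rmult_le_pos; lra. }
    pose proof (Cmod_triangle (pairing W u chi n t) (- (pairing W u chi n t - p0))) as Htri.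
    replace (pairing W u chi n t + - (pairing W u chi n t - p0))%C with (RtoC p0) in Htri by ring.
    rewrite Cmod_opp, Cmod_R, (Rabs_pos_eq p0) in Htri by lra. lra. }
  apply Rle_trans with (rsum n (high (A t) (u t))).
  - apply (pairing_high_bound (A t) CW p0 n (W t) (u t)); try assumption.
    + pose proof (HA t Ht). lra.
    + pose proof (HA t Ht). unfold Rdiv in *. lra.
    + apply HWbes.
    + intros k Hk. now apply HWlow.
    + now apply Hul2.
  - apply rsum_le. intros k _. unfold high.
    destruct (Rlt_dec (A t / 2) (IZR k)) as [H1|H1], (Rlt_dec (c0 * t / 2) (IZR k)) as [H2|H2];
      try lra; [|apply pow2_ge_0].
    exfalso. apply H2. unfold A in H1. lra.
Qed.

Theorem mainTheorem16 (v : R -> R) (j : Z) :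
  smooth_periodic v ->
  j <> 0%Z ->
  fourier v j <> RtoC 0 ->
  forall r : R, 0 < r ->
    exists psi : R -> Z -> C,
      half_wave_Hr_solution (fun t x => cos (IZR j * t) * v x) r psi /\
      exists C0 T0 : R, 0 < C0 /\ 0 < T0 /\
        forall t : R, T0 < t -> Hr_norm r (psi t) >= C0 * Rpower (jbracket t) r.
Proof.
  intros Hv Hj Hf r Hr. pose proof PI_RGT_0.
  destruct (drift_positive v j (fun x => smooth_continuous v x Hv) Hj Hf) as [y0 [Hy0 Hdr]].
  (* Half of the value at [y0], so that the cut-off at level [c0] is strictly positive at [y0]. *)
  set (c0 := drift v j y0 / 2).
  assert (Hc0 : 0 < c0) by (unfold c0; lra).
  destruct (INR_unbounded r) as [n0 Hn0].
  destruct (mass_transport v j c0 y0 (n0 + 3) Hv Hc0 Hy0 ltac:(unfold c0; lra) ltac:(lia))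
    as [u [D [kap [HD [Hkap [HK [Hub [Hud Hmass]]]]]]]].
  pose proof (half_wave_of_modes v j Hv r n0 u D ltac:(lra) HD HK Hub Hud) as Hsol.
  set (psi := fun t k => (cis (- IZR (Z.abs k) * t) * u t k)%C) in *.
  exists psi. split; [exact Hsol|].
  (* For t > 1 the bracket is at most 2 t, so frequencies above c0 t / 2 exceed c0 / 4 times the
     bracket; the square root comes from the mass [kap] and the factor 2 pi in the norm. *)
  exists (sqrt (2 * PI * kap) * Rpower (c0 / 4) r), 1.
  split; [|split; [lra|]].
  { apply Rmult_lt_0_compat; [apply sqrt_lt_R0; apply Rmult_lt_0_compat; lra|apply exp_pos]. }
  intros t Ht. apply Rle_ge.
  destruct (Hmass t ltac:(lra)) as [n Hn].
  destruct Hsol as [HinH _]. destruct (HinH t) as [He1 He2].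
  assert (Hjb0 : 0 < jbracket t) by (apply sqrt_lt_R0; nra).
  assert (Hjb : jbracket t <= 2 * t).
  { unfold jbracket. rewrite <- (sqrt_pow2 (2 * t)) by lra. apply sqrt_le_1_alt. nra. }
  set (w := Rpower (c0 / 4 * jbracket t) r).
  assert (Hw : 0 < w) by apply exp_pos.
  rewrite Rmult_assoc, Rpower_mult_distr by lra. fold w.
  unfold Hr_norm.
  rewrite <- (sqrt_pow2 w) by lra. rewrite <- sqrt_mult by (try apply pow2_ge_0; nra).
  apply sqrt_le_1_alt. rewrite Rmult_assoc. apply Rmult_le_compat_l; [lra|].
  eapply Rle_trans; [|apply (rsum_le_Series (Hterm r (psi t)) n); auto using Hterm_nonneg].
  apply Rle_trans with (rsum n (fun k => w ^ 2 * high (c0 * t) (u t) k)).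
  { rewrite rsum_scal, Rmult_comm. apply Rmult_le_compat_l; [apply pow2_ge_0|assumption]. }
  apply rsum_le. intros k _. unfold high, Hterm.
  destruct (Rlt_dec (c0 * t / 2) (IZR k)) as [Hk|Hk]; [|rewrite Rmult_0_r; apply pow2_ge_0].
  replace (Cmod (psi t k)) with (Cmod (u t k)) by (unfold psi; rewrite Cmod_mult, Cmod_cis; ring).
  rewrite <- Rpow_mult_distr. apply pow_incr. split.
  { apply Rmult_le_pos; [lra|apply Cmod_ge_0]. }
  apply Rmult_le_compat_r; [apply Cmod_ge_0|]. unfold w, Hweight.
  apply Rle_Rpower_l; [lra|]. split; [apply Rmult_lt_0_compat; lra|].
  rewrite abs_IZR. pose proof (Rle_abs (IZR k)). nra.
Qed.
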